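(* Let $f_1,f_2:\mathbb{R}^d\to\mathbb{R}^d$ be contracting similarities with contraction ratios $0<r_1<r_2<1$, and suppose there is a non-empty bounded open set $U\subset\mathbb{R}^d$ such that $f_i(U)\subset U$ for $i=1,2$, $f_1(U)\cap f_2(U)=\emptyset$, and $U$ is the interior of its closure. For $p\in(0,1)$ let $F$ be the random set generated by $\{f_1,f_2\}$, the binary tree ($M=2$), and the probability vector $(p,1-p)$, as described in the context. Let $s_0$ be the unique number with $r_1^{s_0}+r_2^{s_0}=1$, and let $\tilde{s}=\tilde{s}(p)$ be the number satisfying $$p r_1^{\tilde{s}}+(1-p)r_2^{\tilde{s}}=\tfrac12.$$ Furthermore (for $p\ne 1/2$), define $$\hat{s}=\hat{s}(p):=\frac{\log c_1(p)\log(2(1-p))-\log c_2(p)\log(2p)}{\log r_1\log(2(1-p))-\log r_2\log(2p)},$$ where $$c_1(p):=\frac{\log(2(1-p))}{\log(1-p)-\log p},\qquad c_2(p):=\frac{\log(2p)}{\log p-\log(1-p)}=1-c_1(p).$$ Then there are thresholds $p_*$ and $p^*$ (depending only on $r_1,r_2$) satisfying $0<p_*<1/2<p^*<1$ such that, for every $p\in(0,1)$, with probability one, $$\dim_H F=\dim_B F=\begin{cases} s_0 & \text{if } p_*\leq p\leq 1/2,\\ \tilde{s}(p) & \text{if } 1/2\leq p\leq p^*,\\ \hat{s}(p) & \text{if } p\leq p_* \text{ or } p\geq p^*.\end{cases}$$ Specifically, $p_*$ is the unique solution in $(0,1/2)$ of the equation $$\frac{\log(2p)}{\log(2(1-p))}=-\left(\frac{r_2}{r_1}\right)^{s_0},$$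 and $p^*$ is the first coordinate of the unique pair $(p,s)$ of real numbers satisfying $1/2<p<1$ and the system of equations $$p r_1^s+(1-p)r_2^s=\tfrac12,\qquad p r_1^s\log p+(1-p)r_2^s\log(1-p)=-\tfrac12\log 2.$$ Thus the almost sure value of $\dim_H F$, as a function of $p$, is strictly increasing on $[0,p_*]$, constant on $[p_*,1/2]$, and strictly decreasing on $[1/2,1]$.
   Context: Logarithms are natural. $\dim_H$ and $\dim_B$ denote Hausdorff and box-counting dimension. A similarity $f$ with contraction ratio $r$ satisfies $|f(x)-f(y)|=r|x-y|$ for all $x,y$. Construction of $F$: consider the infinite binary tree (the rooted tree in which every vertex has exactly 2 children) with edge set $E$. Let $\omega(e)$, $e\in E$, be independent random variables with values in $\{1,2\}$, $\mathbb{P}(\omega(e)=1)=p$ and $\mathbb{P}(\omega(e)=2)=1-p$. Let $\mathcal{P}$ be the set of infinite paths starting at the root (moving away from the root), and let $P(k)$ denote the $k$-th edge of $P\in\mathcal{P}$. Then $$F=F(\omega):=\Big\{\lim_{n\to\infty} f_{\omega(P(1))}\circ\dots\circ f_{\omega(P(n))}(0): P\in\mathcal{P}\Big\}.$$ For the monotonicity statement, the endpoint values $p=0$ and $p=1$ refer to the same construction with all labels almost surely equal to $2$, respectively $1$ (so that $F$ is almost surely a single point). *)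

(* Defs.v *)
From HB Require Import structures.
From mathcomp Require Import all_boot all_order all_algebra.
From mathcomp Require Import all_classical all_reals all_analysis.
Set Implicit Arguments.
Unset Strict Implicit.
Unset Printing Implicit Defensive.
Import Order.TTheory GRing.Theory Num.Theory.
Import numFieldNormedType.Exports.
Local Open Scope classical_set_scope.
Local Open Scope ring_scope.

Section Dimensions.
Context {R : realType} {d : nat}.
Implicit Types (x y : 'rV[R]_d) (A U : set 'rV[R]_d).

(* The norm `|x| that the library puts on 'rV[R]_d is the sup norm; its
   topology is the usual one, but similarities and diameters are Euclidean. *)
Definition enorm x : R := Num.sqrt (\sum_(i < d) x ord0 i ^+ 2).

Definition similarity (r : R) (f : 'rV[R]_d -> 'rV[R]_d) : Prop :=
  forall x y, enorm (f x - f y) = r * enorm (x - y).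

(* The diameter of the empty set is -oo. *)
Definition diam U : \bar R :=
  ereal_sup [set z | exists x y, [/\ U x, U y & z = (enorm (x - y))%:E]].

(* diam(U)^s, with the usual conventions diam(set0)^s = 0 for every s (also for
   s = 0), and diam(U)^0 = 1 if U is nonempty. *)
Definition diam_pow (s : R) U : \bar R :=
  if U == set0 then 0%E else poweR (diam U) s.

Definition hausdorff_content (s delta : R) A : \bar R :=
  ereal_inf [set (\sum_(0 <= i <oo) diam_pow s (V i))%E |
    V in [set V : (set 'rV[R]_d)^nat |
      A `<=` \bigcup_i V i /\ forall i, (diam (V i) <= delta%:E)%E]].

Definition hausdorff_measure (s : R) A : \bar R :=
  ereal_sup [set hausdorff_content s delta A | delta in [set t : R | 0 < t]].

Definition hausdorff_dim A : \bar R :=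
  ereal_inf [set s%:E | s in [set s : R | 0 <= s /\ hausdorff_measure s A = 0%E]].

(* Least number of sets of diameter at most delta needed to cover A
   (+oo if finitely many never suffice). *)
Definition covering_number (delta : R) A : \bar R :=
  ereal_inf [set n%:R%:E | n in [set n : nat | exists V : 'I_n -> set 'rV[R]_d,
    (forall i, (diam (V i) <= delta%:E)%E) /\ A `<=` \bigcup_i V i]].

(* The box-counting dimension of A exists, and its value is s. *)
Definition has_box_dim A (s : \bar R) : Prop :=
  (lne (covering_number delta A) * ((- ln delta)^-1)%:E)%E
    @[delta --> (0 : R)^'+] --> s.

End Dimensions.

Definition mutually_independent (R : realType) (disp disp' : measure_display)
    (T : measurableType disp) (T' : measurableType disp') (P : probability T R)
    (I : eqType) (X : I -> {RV P >-> T'}) : Prop :=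
  forall (s : seq I) (B : I -> set T'), uniq s -> (forall i, measurable (B i)) ->
    P (\bigcap_(i in [set` s]) (X i @^-1` B i)) =
    (\prod_(i <- s) P (X i @^-1` B i))%E.

(* A vertex of the infinite rooted binary tree is the finite word of left/right
   choices that leads to it from the root [::]; the edge (v, b) joins v to its
   child rcons v b. *)
Definition edge : Type := (seq bool * bool)%type.

(* An infinite path from the root is given by its sequence of choices
   xi : nat -> bool; path_edge xi k is its edge number k, counted from 0. *)
Definition path_edge (xi : nat -> bool) (k : nat) : edge := (mkseq xi k, xi k).

(* The labels 1 and 2 are encoded by the booleans true and false. *)
Definition iid_labels (R : realType) (disp : measure_display)
    (T : measurableType disp) (P : probability T R) (p : R)
    (omega : edge -> {RV P >-> bool}) : Prop :=
  mutually_independent omega /\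
  forall e, P (omega e @^-1` [set true]) = p%:E /\
            P (omega e @^-1` [set false]) = (1 - p)%:E.

Section RandomSet.
Context {R : realType} {d : nat}.
Variables f1 f2 : 'rV[R]_d -> 'rV[R]_d.

Definition label_map (b : bool) : 'rV[R]_d -> 'rV[R]_d := if b then f1 else f2.

(* f_{w(P(1))} o ... o f_{w(P(n))} (0), for the path P given by xi. *)
Definition path_point (w : edge -> bool) (xi : nat -> bool) (n : nat) : 'rV[R]_d :=
  foldr (fun b x => label_map b x) 0 (mkseq (fun k => w (path_edge xi k)) n).

Definition generated_set (w : edge -> bool) : set 'rV[R]_d :=
  [set x | exists xi : nat -> bool, path_point w xi n @[n --> \oo] --> x].

End RandomSet.

Section Formulas.
Context {R : realType}.

Definition c1 (p : R) : R := ln (2 * (1 - p)) / (ln (1 - p) - ln p).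
Definition c2 (p : R) : R := ln (2 * p) / (ln p - ln (1 - p)).

Definition s_hat (r1 r2 p : R) : R :=
  (ln (c1 p) * ln (2 * (1 - p)) - ln (c2 p) * ln (2 * p)) /
  (ln r1 * ln (2 * (1 - p)) - ln r2 * ln (2 * p)).

End Formulas.

(* Main.v *)
Require Import Defs.
From HB Require Import structures.
From mathcomp Require Import all_boot all_order all_algebra.
From mathcomp Require Import all_classical all_reals all_analysis.
From mathcomp Require Import measurable_realfun.
From mathcomp Require Import ring lra zify.
Set Implicit Arguments.
Unset Strict Implicit.
Unset Printing Implicit Defensive.
Import Order.TTheory GRing.Theory Num.Theory.
Import numFieldNormedType.Exports.
Local Open Scope classical_set_scope.
Local Open Scope ring_scope.

(** Let p_1 = p, p_2 = 1 - p. A word w over the labels, of length n, is carried on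
    average by M(w) = prod (2 p_a) of the 2^n vertices of level n, and the images of
    a fixed ball under the maps f_w of the words of length n that occur cover the
    generated set F. As several vertices may carry the same word, the dimension is
    governed by the number of distinct occurring words.

    The upper bound. A word occurs with probability at most min (1, M(w)), hence at
    most M(w)^t for each t in [0, 1]. The expected sum of r_w^s over the occurring
    words of length n is thus at most (sum of (2 p_a)^t r_a^s)^n, and if this base is
    less than 1 the sum over all words is almost surely finite; the pieces of size
    e then number O(e^(-s)) (occurring_weight_decay, cover_upper_bound). The
    dimension is at most the minimum D of the s for which some t in [0, 1] makes the
    base equal to 1, and the first-order conditions for this convex problem define
    the relation critical. The three formulas of the theorem are its solutions with
    t = 0, t = 1 and t between; which case occurs depends on the sign of the
    derivative in t (drift) at both ends, and those signs change at p_lo, 1/2 and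
    p_hi (lo_threshold, hi_threshold). Bernoulli's inequality shows how D moves with
    p (critical_shift). All this is collected in critical_exponents.

    The lower bound. Below D the words of some type occur in large numbers with a
    probability that is not exponentially small (growth). If the drift at the
    optimal tilt is nonnegative, a typical word for the tilted law occurs with such a
    probability, and the first moment suffices (growth_of_ge0_drift); if t = 1 and
    the drift is negative, the expected number of carriers of a typical word decays,
    there are few repetitions, and a second moment argument applies
    (growth_of_le0_drift). A few initial levels boost the probability to nearly 1
    (block_family_exists), so that blocks of levels with many distinct words can be
    concatenated: with probability close to 1 every stage can be continued
    (survival_probability). In a tree that survives, a mass distribution argument
    with the open set condition bounds all covers from below (cover_lower_bound).
    Instead of a measure it uses a supermartingale of excluded mass, along which a
    path is followed that avoids the cover.

    Exponents near D on both sides determine the Hausdorff and box dimensions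
    (hausdorff_dim_eq, has_box_dimI). All probabilities are computed on finitely many
    levels, as finite sums that mutual independence identifies with probabilities on
    the given space (config_expectation). *)

(** * Elementary inequalities *)

Section Elementary.
Context {R : realType}.
Implicit Types x y s t : R.

Lemma powR_expR x s : 0 < x -> x `^ s = expR (s * ln x).
Proof. by move=> x0; rewrite /powR gt_eqF. Qed.

Lemma ln_le_sub1 x : 0 < x -> ln x <= x - 1.
Proof. by move=> x0; have := expR_ge1Dx (ln x); rewrite lnK ?posrE//; lra. Qed.

Lemma ln_lt_sub1 x : 0 < x -> x != 1 -> ln x < x - 1.
Proof.
move=> x0 x1; have : ln x != 0 by rewrite ln_eq0.
by move=> /expR_gt1Dx; rewrite lnK ?posrE//; lra.
Qed.

Lemma ln_ge_1subV x : 0 < x -> 1 - x^-1 <= ln x.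
Proof.
move=> x0; have := ln_le_sub1 (x := x^-1); rewrite invr_gt0 => /(_ x0).
by rewrite lnV ?posrE//; lra.
Qed.

Lemma ln2_gt_half : 2^-1 <= ln 2 :> R.
Proof. by have := @ln_ge_1subV 2; lra. Qed.

(** The tangent 1 + x <= expR x bounds the mean of x1, x2 by that of their
    exponentials; this is the convexity behind every minimality statement below. *)
Lemma exp_mean_le0 (b1 b2 x1 x2 : R) : 0 <= b1 -> 0 <= b2 -> b1 + b2 = 1 ->
  b1 * expR x1 + b2 * expR x2 <= 1 -> b1 * x1 + b2 * x2 <= 0.
Proof. by move=> ? ? ? ?; have := expR_ge1Dx x1; have := expR_ge1Dx x2; nra. Qed.

Lemma exp_mean_lt0 (b1 b2 x1 x2 : R) : 0 <= b1 -> 0 <= b2 -> b1 + b2 = 1 ->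
  b1 * expR x1 + b2 * expR x2 < 1 -> b1 * x1 + b2 * x2 < 0.
Proof. by move=> ? ? ? ?; have := expR_ge1Dx x1; have := expR_ge1Dx x2; nra. Qed.

(** With a1, a2 = ln r1, ln r2, the equations of s0 and of s-tilde prescribe the
    value of such a sum. *)
Definition exp_sum (w1 w2 a1 a2 s : R) := w1 * expR (s * a1) + w2 * expR (s * a2).

Lemma exp_sum_decr w1 w2 a1 a2 s s' : 0 < w1 -> 0 < w2 -> a1 < 0 -> a2 < 0 ->
  s < s' -> exp_sum w1 w2 a1 a2 s' < exp_sum w1 w2 a1 a2 s.
Proof.
move=> w10 w20 a10 a20 ss; apply: ltrD; rewrite ltr_pM2l// ltr_expR; nra.
Qed.

Lemma exp_sum_inj w1 w2 a1 a2 s s' : 0 < w1 -> 0 < w2 -> a1 < 0 -> a2 < 0 ->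
  exp_sum w1 w2 a1 a2 s = exp_sum w1 w2 a1 a2 s' -> s = s'.
Proof.
move=> w10 w20 a10 a20 e; case: (ltgtP s s') => // h;
  by have := exp_sum_decr w10 w20 a10 a20 h; rewrite e ltxx.
Qed.

Lemma exp_sum_root w1 w2 a1 a2 v : 0 < w1 -> 0 < w2 -> a1 < 0 -> a2 < 0 ->
  0 < v -> exists s, exp_sum w1 w2 a1 a2 s = v.
Proof.
move=> w10 w20 a10 a20 v0.
(* By 1 + x <= expR x, the first term already exceeds v at A, and at B each
   term is at most its share w_i / (w1 + w2) of v. *)
pose A := v / (w1 * a1); pose B := (w1 + w2) / v * (- a1^-1 - a2^-1).
have A0 : A <= 0 by rewrite /A pmulr_rle0// invr_le0; nra.
have na1 : 0 < - a1^-1 by rewrite oppr_gt0 invr_lt0.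
have na2 : 0 < - a2^-1 by rewrite oppr_gt0 invr_lt0.
have W0 : 0 < (w1 + w2) / v by rewrite divr_gt0// addr_gt0.
have B0 : 0 <= B by rewrite /B mulr_ge0//; lra.
have FA : v <= exp_sum w1 w2 a1 a2 A.
  apply: (@le_trans _ _ (w1 * expR (A * a1))); last first.
    by rewrite /exp_sum lerDl mulr_ge0 ?ltW// expR_gt0.
  have e : A * a1 = v / w1 by rewrite /A; field; rewrite !(lt_eqF a10, gt_eqF w10).
  rewrite e mulrC -ler_pdivrMr//; apply: le_trans (expR_ge1Dx _); lra.
have FB : exp_sum w1 w2 a1 a2 B <= v.
  have k a : a < 0 -> - a^-1 <= - a1^-1 - a2^-1 -> expR (B * a) <= v / (w1 + w2).
    move=> a0 ha; rewrite -[B * a]opprK expRN -[v / _]invf_div.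
    rewrite lef_pV2 ?posrE ?expR_gt0//; apply: le_trans (expR_ge1Dx _).
    have : (w1 + w2) / v * - a^-1 <= B by rewrite /B ler_pM2l.
    move=> hB; have : (w1 + w2) / v * - a^-1 * - a <= B * - a by rewrite ler_pM2r// oppr_gt0.
    have -> : (w1 + w2) / v * - a^-1 * - a = (w1 + w2) / v by field; rewrite gt_eqF// lt_eqF.
    lra.
  have := k a1 a10; have := k a2 a20; rewrite /exp_sum.
  move=> /(_ ltac:(lra)) k2 /(_ ltac:(lra)) k1.
  have : w1 * (v / (w1 + w2)) + w2 * (v / (w1 + w2)) = v by field; rewrite gt_eqF// addr_gt0.
  by move=> <-; apply: lerD; rewrite ler_pM2l.
have AB : A <= B by lra.
have cont : {within `[A, B], continuous (exp_sum w1 w2 a1 a2)}.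
  apply: continuous_subspaceT => s.
  apply: cvgD; apply: cvgMl_tmp;
    apply: (@continuous_comp _ _ _ (fun s : R => s * _) expR);
    [exact: mulrr_continuous | exact: continuous_expR |
     exact: mulrr_continuous | exact: continuous_expR].
have [|s _ hs] := IVT AB cont (v := v); last by exists s.
by rewrite ge_min FB orbT le_max FA.
Qed.

(** A secant inequality for the convex function x ln x, one end of the secant
    being the zero at 1. *)
Lemma xlnx_secant (z l y : R) : 0 < z -> 0 <= l <= 1 -> y = 1 + l * (z - 1) ->
  y * ln y <= l * (z * ln z).
Proof.
move=> z0 /andP[l0 l1] yE.
have y0 : 0 < y by rewrite yE; nra.
have tangent x : 0 < x -> y * ln y + (ln y + 1) * (x - y) <= x * ln x.
  move=> x0; have := @ln_le_sub1 (y / x); rewrite divr_gt0// => /(_ isT).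
  rewrite ln_div ?posrE// => h.
  have : x * (ln y - ln x) <= x * (y / x - 1) by rewrite ler_pM2l.
  have -> : x * (y / x - 1) = y - x by field; rewrite gt_eqF.
  nra.
have := tangent _ z0; have := tangent _ (ltr01 : (0:R) < 1); rewrite ln1 mulr0.
move=> h1 hz.
have : (1 - l) * (y * ln y + (ln y + 1) * (1 - y)) <= (1 - l) * 0 by apply: ler_wpM2l; lra.
have : l * (y * ln y + (ln y + 1) * (z - y)) <= l * (z * ln z) by apply: ler_wpM2l.
rewrite yE; lra.
Qed.

End Elementary.

(** * The thresholds p_lo and p_hi *)

Section Thresholds.
Context {R : realType}.
Implicit Types x y s t p q : R.

Lemma ln_strict_concave x y l : 0 < x -> 0 < y -> x != y -> 0 < l < 1 ->
  (1 - l) * ln x + l * ln y < ln ((1 - l) * x + l * y).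
Proof.
move=> x0 y0 xy /andP[l0 l1]; have : 0 < (1 - l) * x + l * y by nra.
move zE : ((1 - l) * x + l * y) => z z0.
have xz : x / z != 1.
  apply/negP => /eqP; move/(congr1 (fun t => t * z)).
  rewrite divfK ?gt_eqF// mul1r -zE => h.
  have : l * (x - y) = 0 by lra.
  by move/eqP; rewrite mulf_eq0 gt_eqF//= subr_eq0 (negbTE xy).
have h1 : ln x - ln z < x / z - 1.
  by rewrite -ln_div ?posrE//; apply: ln_lt_sub1 => //; exact: divr_gt0.
have h2 : ln y - ln z <= y / z - 1.
  by rewrite -ln_div ?posrE//; apply: ln_le_sub1; exact: divr_gt0.
have : (1 - l) * (x / z) + l * (y / z) = 1.
  by rewrite !mulrA -mulrDl zE divff// gt_eqF.
nra.
Qed.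

Lemma ln_2pos_cont p : 0 < p -> {for p, continuous (fun p => ln (2 * p))}.
Proof.
move=> p0; apply: (@continuous_comp _ _ _ (fun p : R => 2 * p) (@ln R)).
  exact: mulrl_continuous.
by apply: continuous_ln; rewrite mulr_gt0.
Qed.

Lemma ln_2neg_cont p : p < 1 -> {for p, continuous (fun p => ln (2 * (1 - p)))}.
Proof.
move=> p0; apply: (@continuous_comp _ _ _ (fun p : R => 2 * (1 - p)) (@ln R)).
  by apply: cvgMl_tmp; apply: cvgB; [exact: cvg_cst | exact: cvg_id].
by apply: continuous_ln; rewrite mulr_gt0// subr_gt0.
Qed.

(** For rho = (r2 / r1)^s0 the zero of lo_fun in (0, 1/2) is p_lo; the sign of
    lo_fun is that of the drift of the labels under the tilt r_a^s0 (drift_base). *)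
Definition lo_fun rho p := ln (2 * p) + rho * ln (2 * (1 - p)).

(** lo_fun is strictly concave and vanishes at 1/2. *)
Lemma lo_fun_chord rho p q : 0 < rho -> 0 < p -> p < q -> q < 2^-1 ->
  exists2 c, 0 < c & c * lo_fun rho p < lo_fun rho q.
Proof.
move=> rho0 p0 pq q2; pose l := (q - p) / (2^-1 - p).
have d0 : 0 < 2^-1 - p by lra.
have l01 : 0 < l < 1.
  by rewrite /l divr_gt0 ?ltr_pdivrMr//=; lra.
have ql : q = (1 - l) * p + l * 2^-1 by rewrite /l; field; rewrite gt_eqF//; lra.
exists (1 - l); first by lra.
have h1 := @ln_strict_concave (2 * p) 1 l ltac:(lra) ltac:(lra) ltac:(lra) l01.
have h2 := @ln_strict_concave (2 * (1 - p)) 1 l ltac:(lra) ltac:(lra) ltac:(lra) l01.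
rewrite ln1 mulr0 addr0 in h1; rewrite ln1 mulr0 addr0 in h2.
have e1 : (1 - l) * (2 * p) + l * 1 = 2 * q by rewrite ql; lra.
have e2 : (1 - l) * (2 * (1 - p)) + l * 1 = 2 * (1 - q) by rewrite ql; lra.
rewrite e1 in h1; rewrite e2 in h2; rewrite /lo_fun; nra.
Qed.

(** A strictly concave function that vanishes at 1/2 has at most one zero to the
    left of 1/2, and changes sign there. *)
Lemma lo_threshold rho : 1 < rho -> exists p0,
  [/\ 0 < p0 < 2^-1, lo_fun rho p0 = 0,
   forall p, 0 < p < p0 -> lo_fun rho p < 0 &
   forall p, p0 < p < 2^-1 -> 0 < lo_fun rho p].
Proof.
move=> rho1; have rho0 : 0 < rho by lra.
(* pb is the critical point of lo_fun; at pa the two logarithms of 2 cancel. *)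
pose pb := (1 + rho)^-1; pose pa := 2^-1 * expR (- (rho * ln 2)).
have l2 := @ln2_gt_half R.
have r1 : 0 < 1 + rho by lra.
have pb0 : 0 < pb by rewrite /pb invr_gt0.
have pb2 : pb < 2^-1 by rewrite /pb ltf_pV2 ?posrE//; lra.
have pbE : pb * (1 + rho) = 1 by rewrite /pb mulVf// gt_eqF.
have pa0 : 0 < pa by rewrite /pa mulr_gt0 ?expR_gt0.
have papb : pa <= pb.
  rewrite /pa expRN -invfM /pb lef_pV2 ?posrE ?mulr_gt0 ?expR_gt0//.
  have := expR_ge1Dx (rho * ln 2); nra.
have Ga : lo_fun rho pa <= 0.
  have -> : lo_fun rho pa = rho * ln (1 - pa).
    rewrite /lo_fun [ln (2 * (1 - pa))]lnM ?posrE//; last by lra.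
    have -> : 2 * pa = expR (- (rho * ln 2)) by rewrite /pa; lra.
    by rewrite expRK; lra.
  have := @ln_le0 R (1 - pa); nra.
have Gb : 0 <= lo_fun rho pb.
  have h1 := @ln_ge_1subV R (2 * pb) ltac:(lra).
  have h2 := @ln_ge_1subV R (2 * (1 - pb)) ltac:(lra).
  have e1 : (2 * pb)^-1 = (1 + rho) / 2 by rewrite invfM /pb invrK; lra.
  have e2 : rho * (2 * (1 - pb))^-1 = (1 + rho) / 2.
    rewrite /pb; field; rewrite !gt_eqF//; lra.
  rewrite /lo_fun; rewrite e1 in h1.
  have : rho * (1 - (2 * (1 - pb))^-1) <= rho * ln (2 * (1 - pb)) by rewrite ler_pM2l.
  rewrite mulrBr e2; lra.
have cont : {within `[pa, pb], continuous (lo_fun rho)}.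
  apply: continuous_in_subspaceT => p; rewrite inE/= in_itv/= => /andP[p1 p2].
  apply: cvgD; first by apply: ln_2pos_cont; lra.
  by apply: cvgMl_tmp; apply: ln_2neg_cont; lra.
have [|p0 p0ab Gp0] := IVT papb cont (v := 0); first by rewrite ge_min Ga le_max Gb orbT.
move: p0ab; rewrite in_itv/= => /andP[p1 p2].
exists p0; split => //; first by lra.
- move=> p /andP[hp0 hp]; have [|c c0] := lo_fun_chord rho0 hp0 hp; first by lra.
  by rewrite Gp0; nra.
- move=> p /andP[hp0 hp]; have [|c c0] := lo_fun_chord rho0 _ hp0 hp; first by lra.
  by rewrite Gp0; nra.
Qed.

Section Upper.
Variables a1 a2 : R.
Hypotheses (a12 : a1 < a2) (a20 : a2 < 0).
Let a10 : a1 < 0. Proof. exact: lt_trans a20. Qed.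

(** The equation of s-tilde(p), where a1 and a2 stand for ln r1 and ln r2. *)
Definition tilde_eq p s := exp_sum p (1 - p) a1 a2 s = 2^-1.

Lemma tilde_eq_ex p : 0 < p < 1 -> exists s, tilde_eq p s.
Proof. by move=> /andP[p0 p1]; apply: exp_sum_root => //; rewrite ?subr_gt0 ?invr_gt0. Qed.

Lemma tilde_eq_pos p s : 0 < p < 1 -> tilde_eq p s -> 0 < s.
Proof.
move: (a12) (a20) (a10) => A12 A20 A10.
move=> /andP[p0 p1]; rewrite /tilde_eq /exp_sum => h; rewrite ltNge; apply/negP => s0.
have h1 : 1 <= expR (s * a1) by apply: le_trans (expR_ge1Dx _); nra.
have h2 : 1 <= expR (s * a2) by apply: le_trans (expR_ge1Dx _); nra.
nra.
Qed.

Lemma tilde_eq_half p s : 0 < p < 1 -> tilde_eq p s ->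
  expR (s * a1) < 2^-1 < expR (s * a2).
Proof.
move: (a12) (a20) (a10) => A12 A20 A10.
move=> p01 ts; have s0 := tilde_eq_pos p01 ts.
have xy : expR (s * a1) < expR (s * a2) by rewrite ltr_expR; nra.
move: ts p01; rewrite /tilde_eq /exp_sum => h /andP[p0 p1]; apply/andP; split; nra.
Qed.

(** As r1^s < 1/2 < r2^s, shifting mass to r1 lowers the sum, which has to be
    compensated by a smaller s. *)
Lemma tilde_eq_decr p q s s' : 0 < p -> p < q -> q < 1 ->
  tilde_eq p s -> tilde_eq q s' -> s' < s.
Proof.
move: (a12) (a20) (a10) => A12 A20 A10.
move=> p0 pq q1 tp tq; have p01 : 0 < p < 1 by lra.
have h := tilde_eq_half p01 tp; rewrite ltNge; apply/negP => ss.
have : exp_sum q (1 - q) a1 a2 s < 2^-1 by rewrite -tp /exp_sum; nra.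
rewrite -tq; apply/negP; rewrite -leNgt.
move: ss; rewrite le_eqVlt => /orP[/eqP->//|ss].
by apply: ltW; apply: exp_sum_decr => //; lra.
Qed.

Lemma tilde_eq_inj p s s' : 0 < p < 1 -> tilde_eq p s -> tilde_eq p s' -> s = s'.
Proof.
move: (a12) (a20) (a10) => A12 A20 A10.
move=> /andP[p0 p1] h h'; have e := etrans h (esym h').
by apply: exp_sum_inj e => //; lra.
Qed.

(** Given tilde_eq p s, the second equation of the system of p_hi says that hi_fun
    vanishes; up to a factor 2 this is the drift at the tilt t = 1 (drift_tilde). *)
Definition hi_fun p s :=
  p * expR (s * a1) * ln (2 * p) + (1 - p) * expR (s * a2) * ln (2 * (1 - p)).

(** The secant inequality for x ln x, between 1 and 2q and between 1 and 2(1 - q),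
    compares both terms of hi_fun at p with a common multiple of those at q. The
    first, positive one carries moreover the factor (r1 / r2)^s, which is smaller at
    p because the exponent is larger there. *)
Lemma hi_fun_sign p q s s' : 2^-1 < p -> p < q -> q < 1 ->
  tilde_eq p s -> tilde_eq q s' -> hi_fun q s' <= 0 -> hi_fun p s < 0.
Proof.
move: (a12) (a20) (a10) => A12 A20 A10.
move=> p2 pq q1 tp tq; have ss : s' < s by apply: tilde_eq_decr tp tq; lra.
pose l := (2 * p - 1) / (2 * q - 1).
have d0 : 0 < 2 * q - 1 by lra.
have l0 : 0 < l by rewrite /l divr_gt0//; lra.
have l1 : l <= 1 by rewrite /l ler_pdivrMr//; lra.
have l01 : 0 <= l <= 1 by rewrite ltW.
have lE : l * (2 * q - 1) = 2 * p - 1 by rewrite /l divfK// gt_eqF.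
have k1 := @xlnx_secant R (2 * q) l (2 * p) ltac:(lra) l01 ltac:(lra).
have k2 := @xlnx_secant R (2 * (1 - q)) l (2 * (1 - p)) ltac:(lra) l01 ltac:(lra).
have u0 : 0 < ln (2 * q) by apply: ln_gt0; lra.
rewrite /hi_fun.
have xE : expR (s * a1) = expR (s * a2) * expR (s * (a1 - a2)).
  by rewrite -expRD; congr expR; lra.
have xE' : expR (s' * a1) = expR (s' * a2) * expR (s' * (a1 - a2)).
  by rewrite -expRD; congr expR; lra.
have rr : expR (s * (a1 - a2)) < expR (s' * (a1 - a2)) by rewrite ltr_expR; nra.
rewrite xE xE'.
have y0 := expR_gt0 (s * a2); have y0' := expR_gt0 (s' * a2).
have r0 := expR_gt0 (s * (a1 - a2)).
move: y0 y0' r0 rr; set y := expR (s * a2); set y' := expR (s' * a2).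
set r := expR _; set r' := expR _ => y0 y0' r0 rr.
move=> hq.
have hq' : q * r' * ln (2 * q) + (1 - q) * ln (2 * (1 - q)) <= 0.
  rewrite -(pmulr_rle0 _ y0'); apply: le_trans hq; rewrite le_eqVlt; apply/orP; left.
  by apply/eqP; ring.
have -> : p * (y * r) * ln (2 * p) + (1 - p) * y * ln (2 * (1 - p)) =
   y * (r * (p * ln (2 * p)) + (1 - p) * ln (2 * (1 - p))) by ring.
rewrite pmulr_rlt0//.
have h1 : r * (p * ln (2 * p)) <= r * (l * (q * ln (2 * q))) by rewrite ler_pM2l//; lra.
have h2 : (1 - p) * ln (2 * (1 - p)) <= l * ((1 - q) * ln (2 * (1 - q))) by lra.
have h3 : l * (r * (q * ln (2 * q))) < l * (r' * (q * ln (2 * q))).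
  by rewrite ltr_pM2l// ltr_pM2r// mulr_gt0//; lra.
have h4 : l * (q * r' * ln (2 * q) + (1 - q) * ln (2 * (1 - q))) <= 0 by rewrite pmulr_rle0.
lra.
Qed.

Lemma hi_funE p s : hi_fun p s = expR (s * a2) *
  (expR (s * (a1 - a2)) * (p * ln (2 * p)) + (1 - p) * ln (2 * (1 - p))).
Proof.
have -> : expR (s * (a1 - a2)) = expR (s * a1) / expR (s * a2).
  by rewrite -expRN -expRD; congr expR; ring.
by rewrite /hi_fun; field; rewrite gt_eqF// expR_gt0.
Qed.

(** The bound s3 <= s on the exponent keeps (r1 / r2)^s below a constant k < 1, so
    that p k <= 1 - p for some p > 1/2; the negative logarithm then dominates. *)
Lemma hi_fun_le0_ex : exists p s, [/\ 2^-1 < p <= 3 / 4, tilde_eq p s & hi_fun p s <= 0].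
Proof.
move: (a12) (a20) (a10) => A12 A20 A10.
have q01 : 0 < (3 / 4 : R) < 1 by lra.
have [s3 t3] := tilde_eq_ex q01.
have s30 := tilde_eq_pos q01 t3.
pose k := expR (s3 * (a1 - a2)).
have k0 : 0 < k by exact: expR_gt0.
have k1 : k < 1 by rewrite /k expR_lt1; nra.
pose p := Num.min (1 + k)^-1 (3 / 4).
have k1' : 0 < 1 + k by lra.
have p2 : 2^-1 < p.
  by rewrite lt_min ltf_pV2 ?posrE//; apply/andP; split; lra.
have p3 : p <= 3 / 4 by rewrite ge_min lexx orbT.
have pk : p <= (1 + k)^-1 by rewrite ge_min lexx.
have kp : k * p <= 1 - p.
  have : p * (1 + k) <= 1 by rewrite -ler_pdivlMr// mul1r.
  lra.
clearbody p.
have p01 : 0 < p < 1 by lra.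
have [s ts] := tilde_eq_ex p01.
have ss : s3 <= s.
  move: p3; rewrite le_eqVlt => /orP[/eqP e|lt].
    by rewrite e in ts; rewrite (tilde_eq_inj q01 t3 ts).
  by apply/ltW; apply: tilde_eq_decr ts t3 => //; lra.
exists p, s; split=> //; first by rewrite p2.
have rk : expR (s * (a1 - a2)) <= k by rewrite ler_expR; nra.
have r0 := expR_gt0 (s * (a1 - a2)).
have u0 : 0 <= ln (2 * p) by apply: ln_ge0; lra.
have uv : ln (2 * p) + ln (2 * (1 - p)) <= 0.
  by rewrite -lnM ?posrE; [|lra|lra]; apply: ln_le0; nra.
rewrite hi_funE pmulr_rle0 ?expR_gt0// mulrA.
have : expR (s * (a1 - a2)) * p <= 1 - p by nra.
move: (expR _ * p) => z hz; clear - hz u0 uv p01; nra.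
Qed.

(** As p tends to 1 the first term of hi_fun stays bounded below, because s stays
    bounded above, whereas (1 - p) ln (2 (1 - p)) tends to 0. *)
Lemma hi_fun_ge0_ex : exists p s, [/\ 3 / 4 <= p < 1, tilde_eq p s & 0 <= hi_fun p s].
Proof.
move: (a12) (a20) (a10) => A12 A20 A10.
have q01 : 0 < (3 / 4 : R) < 1 by lra.
have [s3 t3] := tilde_eq_ex q01.
have s30 := tilde_eq_pos q01 t3.
pose k := expR (s3 * (a1 - a2)).
have k0 : 0 < k by exact: expR_gt0.
have k1 : k < 1 by rewrite /k expR_lt1; nra.
(* 1 - p is chosen as expR (- T) / 2, so that its logarithm is explicit. *)
pose T := 1 + 4 / k.
have k4 : 0 < 4 / k by rewrite divr_gt0.
have T1 : 1 <= T by rewrite /T; lra.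
have TK : 1 / T <= k / 4.
  rewrite ler_pdivrMr; last by lra.
  have -> : k / 4 * T = k / 4 + 1 by rewrite /T; field; rewrite gt_eqF.
  lra.
pose z := 2^-1 * expR (- T); pose p := 1 - z.
have eT : 1 + T ^+ 2 / 2 <= expR T.
  by have := @expR_ge1Dxn R T 1 ltac:(lra); rewrite (_ : 2`! = 2)%N.
have eN0 := expR_gt0 (- T).
have eN : expR (- T) * expR T = 1 by rewrite -expRD addNr expR0.
have eT2 : expR (- T) <= 2^-1.
  have h := expR_ge1Dx T; clear - h eN eN0 T1; nra.
have zv : z * T <= k / 4.
  apply: le_trans TK; rewrite ler_pdivlMr; last by lra.
  have h : expR (- T) * (1 + T ^+ 2 / 2) <= 1 by rewrite -[leRHS]eN ler_pM2l.
  rewrite /z; move: h; rewrite expr2; clear - eN0; nra.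
have p3 : 3 / 4 <= p by rewrite /p /z; lra.
have p1 : p < 1 by rewrite /p /z; lra.
have zE : 2 * (1 - p) = expR (- T) by rewrite /p /z; lra.
have zp : 1 - p = z by rewrite /p; lra.
clearbody p z; have p01 : 0 < p < 1 by lra.
have [s ts] := tilde_eq_ex p01.
have ss : s <= s3.
  move: p3; rewrite le_eqVlt => /orP[/eqP e|lt].
    by rewrite e in t3; rewrite (tilde_eq_inj p01 t3 ts).
  by apply/ltW; apply: tilde_eq_decr t3 ts => //; lra.
exists p, s; split=> //; first by rewrite p3.
have rk : k <= expR (s * (a1 - a2)) by rewrite ler_expR; nra.
have u0 : 3^-1 <= ln (2 * p).
  have h := @ln_ge_1subV R (3 / 2) ltac:(lra); rewrite invf_div in h.
  apply: (@le_trans _ _ (ln (3 / 2))); first by lra.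
  by rewrite ler_ln ?posrE; lra.
rewrite hi_funE pmulr_rge0 ?expR_gt0// zE expRK zp.
have : 4^-1 <= p * ln (2 * p) by nra.
move: (p * ln _) (expR _) rk => x r rk hx; nra.
Qed.

(** The probability p with s-tilde(p) = s, which parametrises the curve tilde_eq
    by s. *)
Definition tilde_prob s := (expR (s * a2) - 2^-1) / (expR (s * a2) - expR (s * a1)).

Lemma tilde_probE p s : 0 < p < 1 -> tilde_eq p s -> tilde_prob s = p.
Proof.
move=> p01 ts; have := tilde_eq_half p01 ts => /andP[h1 h2].
have d : expR (s * a2) - expR (s * a1) != 0 by rewrite gt_eqF//; lra.
apply: (mulIf d); rewrite /tilde_prob divfK//.
by move: ts; rewrite /tilde_eq /exp_sum; lra.
Qed.

Lemma tilde_prob_facts s : expR (s * a1) < 2^-1 < expR (s * a2) ->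
  [/\ 0 < tilde_prob s < 1, tilde_eq (tilde_prob s) s & {for s, continuous tilde_prob}].
Proof.
move=> /andP[h1 h2].
have d : 0 < expR (s * a2) - expR (s * a1) by lra.
have cexp a : {for s, continuous (fun s => expR (s * a))}.
  apply: (@continuous_comp _ _ _ (fun s : R => s * a) expR);
    [exact: mulrr_continuous | exact: continuous_expR].
split; first by rewrite /tilde_prob divr_gt0 ?ltr_pdivrMr; lra.
  by rewrite /tilde_eq /exp_sum /tilde_prob; field; rewrite gt_eqF.
apply: cvgM; first by apply: cvgB; [exact: cexp | exact: cvg_cst].
by apply: cvgV; [rewrite gt_eqF | apply: cvgB; exact: cexp].
Qed.

(** The intermediate value theorem on the curve s |-> (tilde_prob s, s). *)
Lemma hi_threshold : exists p s, [/\ 2^-1 < p < 1, tilde_eq p s & hi_fun p s = 0].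
Proof.
move: (a12) (a20) (a10) => A12 A20 A10.
have [pa [sa [/andP[pa2 pa3] ta Ja]]] := hi_fun_le0_ex.
have [pb [sb [/andP[pb3 pb1] tb Jb]]] := hi_fun_ge0_ex.
have pa01 : 0 < pa < 1 by lra.
have pb01 : 0 < pb < 1 by lra.
have ba : sb <= sa.
  have [e|ne] := eqVneq pa pb.
    by rewrite e in ta; rewrite (tilde_eq_inj pb01 ta tb).
  have pab : pa < pb by rewrite lt_neqAle ne /=; exact: le_trans pb3.
  by apply/ltW; apply: tilde_eq_decr ta tb => //; lra.
have facts s : sb <= s <= sa -> [/\ 0 < tilde_prob s < 1, tilde_eq (tilde_prob s) s &
    {for s, continuous tilde_prob}].
  move=> /andP[h1 h2]; apply: tilde_prob_facts.
  have /andP[x1 _] := tilde_eq_half pb01 tb.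
  have /andP[_ x2] := tilde_eq_half pa01 ta.
  by apply/andP; split; [apply: le_lt_trans x1|apply: lt_le_trans x2 _]; rewrite ler_expR; nra.
have cexp a (s : R) : {for s, continuous (fun s => expR (s * a))}.
  apply: (@continuous_comp _ _ _ (fun s : R => s * a) expR);
    [exact: mulrr_continuous | exact: continuous_expR].
have cont : {within `[sb, sa], continuous (fun s => hi_fun (tilde_prob s) s)}.
  apply: continuous_in_subspaceT => s; rewrite inE/= in_itv/= => /facts[/andP[p1 p2] _ cp].
  apply: cvgD; apply: cvgM.
  - by apply: cvgM; [exact: cp | exact: cexp].
  - by apply: (@continuous_comp _ _ _ tilde_prob (fun p => ln (2 * p))); [exact: cp|exact: ln_2pos_cont].
  - by apply: cvgM; [apply: cvgB; [exact: cvg_cst|exact: cp] | exact: cexp].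
  - by apply: (@continuous_comp _ _ _ tilde_prob (fun p => ln (2 * (1 - p)))); [exact: cp|exact: ln_2neg_cont].
have [|s sab hs] := IVT ba cont (v := 0).
  by rewrite (tilde_probE pa01 ta) (tilde_probE pb01 tb) ge_min Ja orbT le_max Jb.
rewrite in_itv/= in sab; have [/andP[p1 p2] ts _] := facts _ sab.
exists (tilde_prob s), s; split => //.
rewrite p2 andbT; apply: lt_le_trans pa2 _; rewrite leNgt; apply/negP => lt.
have pa1 : pa < 1 by case/andP: pa01.
by have := tilde_eq_decr p1 lt pa1 ts ta; rewrite ltNge; case/andP: sab => _ ->.
Qed.

End Upper.
End Thresholds.

(** * Critical exponents *)

Section Critical.
Context {R : realType}.
Implicit Types x y s t p q D : R.

(** Concavity of the logarithm, in the form z^t <= 1 + t (z - 1). *)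
Lemma bernoulli_le t z : 0 <= t <= 1 -> 0 < z -> expR (t * ln z) <= 1 + t * (z - 1).
Proof.
move=> /andP[t0 t1] z0; have m0 : 0 < 1 + t * (z - 1) by nra.
move mE : (1 + t * (z - 1)) m0 => m m0.
have h1 : ln z - ln m <= z / m - 1.
  by rewrite -ln_div ?posrE//; apply: ln_le_sub1; exact: divr_gt0.
have h2 : - ln m <= m^-1 - 1.
  by rewrite -lnV ?posrE//; apply: ln_le_sub1; rewrite invr_gt0.
have e : t * (z / m) + (1 - t) * m^-1 = 1.
  have -> : t * (z / m) + (1 - t) * m^-1 = m / m by rewrite -mE; ring.
  by rewrite divff// gt_eqF.
rewrite -[leRHS]lnK ?posrE// ler_expR; nra.
Qed.

Definition lprob p (b : bool) := if b then p else 1 - p.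
Definition lratio (r1 r2 : R) (b : bool) := if b then r1 else r2.

Variables r1 r2 : R.

(** (2 p_a)^t r_a^s: at t = 1 the expected s-weight of the children with label a,
    at t = 0 the s-weight of the label a, which ignores how often it occurs. *)
Definition weight p t s (b : bool) :=
  expR (t * ln (2 * lprob p b) + s * ln (lratio r1 r2 b)).

(** The derivative in t of the sum of the weights. Under the probability vector
    given by the weights it is the mean of ln (2 p_a), hence the growth rate of the
    expected number of vertices that carry a typical word. *)
Definition drift p t s :=
  weight p t s true * ln (2 * p) + weight p t s false * ln (2 * (1 - p)).

(** The exponent D minimises s under the constraint that the weights sum to 1 for
    some t in [0, 1]. The constraint curve being convex, the first-order condition
    at t characterises the minimum: the drift vanishes at an interior t, is
    nonnegative at t = 0 and nonpositive at t = 1. The three cases of the formula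
    for the dimension are t = 0, t = 1 and an interior t. *)
Definition critical p D := exists t, [/\ 0 <= t <= 1,
  weight p t D true + weight p t D false = 1 &
  (t * drift p t D = 0 /\ 0 <= drift p t D) \/ (t = 1 /\ drift p t D <= 0)].

Hypotheses (r1_gt0 : 0 < r1) (r1_lt_r2 : r1 < r2) (r2_lt1 : r2 < 1).
Let a1_lt_a2 : ln r1 < ln r2.
Proof. by rewrite ltr_ln ?posrE//; apply: lt_trans r1_lt_r2. Qed.
Let a2_lt0 : ln r2 < 0.
Proof. by apply: ln_lt0; rewrite r2_lt1 andbT; apply: lt_trans r1_lt_r2. Qed.
Let a1_lt0 : ln r1 < 0. Proof. exact: lt_trans a2_lt0. Qed.

Lemma weight_tilt p t t' s s' b : weight p t' s' b =
  weight p t s b * expR ((t' - t) * ln (2 * lprob p b) + (s' - s) * ln (lratio r1 r2 b)).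
Proof. by rewrite /weight -expRD; congr expR; ring. Qed.

(** Tilting the weights at (t, D) into those at (t', D') and using convexity turns
    the first-order condition at t into a linear inequality for D' - D; K is the
    contribution of the drift, A the mean of ln r_a. *)
Lemma critical_tangent p D t' D' : critical p D -> 0 <= t' <= 1 ->
  exists A K, [/\ A < 0, 0 <= K,
    weight p t' D' true + weight p t' D' false <= 1 -> K + (D' - D) * A <= 0 &
    weight p t' D' true + weight p t' D' false < 1 -> K + (D' - D) * A < 0].
Proof.
move=> [t [/andP[t0 t1] w1 sl]] /andP[t'0 t'1].
have u0 : 0 < weight p t D true by exact: expR_gt0.
have v0 : 0 < weight p t D false by exact: expR_gt0.
exists (weight p t D true * ln r1 + weight p t D false * ln r2), ((t' - t) * drift p t D).
have -> : (t' - t) * drift p t D + (D' - D) * (weight p t D true * ln r1 + weight p t D false * ln r2) =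
   weight p t D true * ((t' - t) * ln (2 * p) + (D' - D) * ln r1) +
   weight p t D false * ((t' - t) * ln (2 * (1 - p)) + (D' - D) * ln r2) by rewrite /drift; ring.
rewrite !(weight_tilt p t t' D D'); split.
- by have := a1_lt0; have := a2_lt0; nra.
- case: sl => [[e K]|[e K]]; first by rewrite mulrBl e subr0 mulr_ge0.
  by apply: mulr_le0 => //; rewrite e subr_le0.
- by apply: exp_mean_le0 => //; exact: ltW.
- by apply: exp_mean_lt0 => //; exact: ltW.
Qed.

Lemma critical_min p D t' D' : critical p D -> 0 <= t' <= 1 ->
  weight p t' D' true + weight p t' D' false <= 1 -> D <= D'.
Proof.
move=> cD t01; have [A [K [A0 K0 h _]]] := critical_tangent D' cD t01.
move=> /h hK; rewrite -subr_ge0 -(nmulr_lle0 _ A0); lra.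
Qed.

Lemma critical_min_lt p D t' D' : critical p D -> 0 <= t' <= 1 ->
  weight p t' D' true + weight p t' D' false < 1 -> D < D'.
Proof.
move=> cD t01; have [A [K [A0 K0 _ h]]] := critical_tangent D' cD t01.
move=> /h hK; rewrite -subr_gt0 -(nmulr_llt0 _ A0); lra.
Qed.

Lemma critical_uniq p D D' : critical p D -> critical p D' -> D = D'.
Proof.
move=> c c'; apply/eqP; rewrite eq_le; apply/andP; split.
  by case: c' => t [t01 w _]; apply: critical_min c t01 _; rewrite w.
by case: (c) => t [t01 w _]; apply: critical_min c' t01 _; rewrite w.
Qed.

Lemma critical_gt0 p D : 0 < p < 1 -> critical p D -> 0 < D.
Proof.
move=> /andP[p0 p1] [t [/andP[t0 t1] w1 _]]; rewrite ltNge; apply/negP => D0.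
have A2 := a2_lt0; have A1 := a1_lt0.
suff : 1 < weight p t D true + weight p t D false by rewrite w1 ltxx.
have [p2|p2] := lerP 2^-1 p.
  apply: le_lt_trans (_ : weight p t D true < _); last by rewrite ltrDl expR_gt0.
  rewrite /weight/= -[leLHS]expR0 ler_expR.
  have : 0 <= ln (2 * p) by apply: ln_ge0; lra.
  nra.
apply: le_lt_trans (_ : weight p t D false < _); last by rewrite ltrDr expR_gt0.
rewrite /weight/= -[leLHS]expR0 ler_expR.
have : 0 <= ln (2 * (1 - p)) by apply: ln_ge0; lra.
nra.
Qed.

(** By Bernoulli's inequality (2p)^t <= (2q)^t (1 + t (p / q - 1)): at the tilt t
    that is optimal for q, the weights for p sum to less than 1 if p lies on the
    side of q given by the sign condition. *)
Lemma critical_shift p q t D Dp : 0 < p < 1 -> 0 < q < 1 -> 0 < t <= 1 ->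
  weight q t D true + weight q t D false = 1 -> critical p Dp ->
  (p - q) * (weight q t D true - q) < 0 -> Dp < D.
Proof.
move=> /andP[p0 p1] /andP[q0 q1] /andP[t0 t1] w1 cp h.
apply: critical_min_lt cp (_ : 0 <= t <= 1) _; first by rewrite ltW.
have shift b : weight p t D b <= weight q t D b * (1 + t * (lprob p b / lprob q b - 1)).
  have p0' : 0 < lprob p b by case: (b) => //=; lra.
  have q0' : 0 < lprob q b by case: (b) => //=; lra.
  have -> : weight p t D b = weight q t D b * expR (t * ln (lprob p b / lprob q b)).
    rewrite /weight -expRD ln_div ?posrE// !lnM ?posrE//; congr expR; ring.
  rewrite ler_pM2l ?expR_gt0//; apply: bernoulli_le; first by rewrite ltW.
  exact: divr_gt0.
apply: le_lt_trans (lerD (shift true) (shift false)) _ => /=.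
move: w1 h; move: (weight _ _ _ _) => u; move: (weight _ _ _ _) => v w1 h.
have -> : u * (1 + t * (p / q - 1)) + v * (1 + t * ((1 - p) / (1 - q) - 1)) =
  (u + v) + t * ((p - q) * (u * (1 - q) - v * q)) / (q * (1 - q)).
  by field; rewrite !gt_eqF//; lra.
rewrite w1 -[ltRHS]addr0 ltrD2l.
have d : 0 < (q * (1 - q))^-1 by rewrite invr_gt0 mulr_gt0//; lra.
rewrite pmulr_llt0// pmulr_rlt0//.
have -> : v = 1 - u by lra.
by have -> : u * (1 - q) - (1 - u) * q = u - q by ring.
Qed.

Lemma weight_t0 p s b : weight p 0 s b = expR (s * ln (lratio r1 r2 b)).
Proof. by rewrite /weight mul0r add0r. Qed.

Lemma weight_t1 p s b : 0 < p < 1 ->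
  weight p 1 s b = 2 * lprob p b * expR (s * ln (lratio r1 r2 b)).
Proof.
move=> p01; rewrite /weight mul1r expRD lnK// posrE.
by case: b => /=; lra.
Qed.

Lemma weight_tilde p s : 0 < p < 1 -> tilde_eq (ln r1) (ln r2) p s ->
  weight p 1 s true + weight p 1 s false = 1.
Proof. by move=> p01; rewrite !weight_t1//= /tilde_eq /exp_sum => h; lra. Qed.

Lemma drift_tilde p s : 0 < p < 1 -> drift p 1 s = 2 * hi_fun (ln r1) (ln r2) p s.
Proof. by move=> p01; rewrite /drift !weight_t1//= /hi_fun; ring. Qed.

Lemma critical_base p s0 : exp_sum 1 1 (ln r1) (ln r2) s0 = 1 -> 0 <= drift p 0 s0 ->
  critical p s0.
Proof.
move=> h d; exists 0; split; [lra| |by left; rewrite mul0r].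
by move: h; rewrite !weight_t0 /exp_sum !mul1r.
Qed.

Lemma critical_tilde p s : 0 < p < 1 -> tilde_eq (ln r1) (ln r2) p s ->
  hi_fun (ln r1) (ln r2) p s <= 0 -> critical p s.
Proof.
move=> p01 h d; exists 1; split; [lra|exact: weight_tilde|right].
by rewrite drift_tilde//; split=> //; lra.
Qed.

(** The tilt at which, together with s_hat, the drift vanishes; it exists for
    p <> 1/2 but need not lie in [0, 1]. *)
Definition hat_t p := (ln (c1 p) - s_hat r1 r2 p * ln r1) / ln (2 * p).

Lemma ln_2p_eq p : 0 < p < 1 -> ln (2 * p) = ln 2 + ln p /\ ln (2 * (1 - p)) = ln 2 + ln (1 - p).
Proof. by move=> p01; rewrite !lnM ?posrE//; lra. Qed.

Lemma half_side p : 0 < p < 1 -> p != 2^-1 ->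
  (ln (2 * p) < 0 /\ 0 < ln (2 * (1 - p))) \/ (0 < ln (2 * p) /\ ln (2 * (1 - p)) < 0).
Proof.
move=> /andP[p0 p1] p2; case: (ltgtP p 2^-1) => [h|h|e]; last by rewrite e eqxx in p2.
  by left; split; [apply: ln_lt0|apply: ln_gt0]; lra.
by right; split; [apply: ln_gt0|apply: ln_lt0]; lra.
Qed.

Lemma c1E p : 0 < p < 1 -> c1 p = ln (2 * (1 - p)) / (ln (2 * (1 - p)) - ln (2 * p)).
Proof. by move=> /ln_2p_eq[h1 h2]; rewrite /c1; congr (_ / _); rewrite h1 h2; ring. Qed.

Lemma c2E p : 0 < p < 1 -> c2 p = ln (2 * p) / (ln (2 * p) - ln (2 * (1 - p))).
Proof. by move=> /ln_2p_eq[h1 h2]; rewrite /c2; congr (_ / _); rewrite h1 h2; ring. Qed.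

Lemma c12_facts p : 0 < p < 1 -> p != 2^-1 ->
  [/\ 0 < c1 p, 0 < c2 p, c1 p + c2 p = 1 &
    c1 p * ln (2 * p) + c2 p * ln (2 * (1 - p)) = 0].
Proof.
move=> p01 p2; rewrite c1E// c2E//; have := half_side p01 p2.
move: (ln (2 * p)) (ln (2 * (1 - p))) => x y h.
have xy : x - y != 0 by case: h => [[h1 h2]|[h1 h2]]; [rewrite lt_eqF|rewrite gt_eqF]; lra.
have yx : y - x != 0 by case: h => [[h1 h2]|[h1 h2]]; [rewrite gt_eqF|rewrite lt_eqF]; lra.
split; [| |by field; rewrite xy yx|by field; rewrite xy yx].
  case: h => [[h1 h2]|[h1 h2]]; first by rewrite divr_gt0//; lra.
  by rewrite -[y / _]mulrNN -invrN divr_gt0//; lra.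
case: h => [[h1 h2]|[h1 h2]]; last by rewrite divr_gt0//; lra.
by rewrite -[x / _]mulrNN -invrN divr_gt0//; lra.
Qed.

Lemma hat_det p : 0 < p < 1 -> p != 2^-1 ->
  ln r1 * ln (2 * (1 - p)) - ln r2 * ln (2 * p) != 0.
Proof.
move=> p01 p2; have A1 := a1_lt0; have A2 := a2_lt0.
case: (half_side p01 p2) => [[h1 h2]|[h1 h2]]; [rewrite lt_eqF//|rewrite gt_eqF//]; nra.
Qed.

(** Zero drift and sum 1 are two linear equations for the weights, whose solution
    (c1 p, c2 p) does not involve r1 and r2. *)
Lemma weight_hat p : 0 < p < 1 -> p != 2^-1 ->
  weight p (hat_t p) (s_hat r1 r2 p) true = c1 p /\
  weight p (hat_t p) (s_hat r1 r2 p) false = c2 p.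
Proof.
move=> p01 p2; have [c10 c20 _ _] := c12_facts p01 p2; have dd := hat_det p01 p2.
have x0 : ln (2 * p) != 0.
  by case: (half_side p01 p2) => [[h1 h2]|[h1 h2]]; [rewrite lt_eqF|rewrite gt_eqF].
by rewrite /weight/= /hat_t; split; rewrite -[RHS]lnK ?posrE//; congr expR;
  rewrite /s_hat; field; rewrite x0 dd.
Qed.

(** On the convex curve where the weights sum to 1, s is minimal at hat_t; the sign
    of the drift at t1 therefore tells on which side of t1 the minimum lies. *)
Lemma hat_slope p t1 s1 : 0 < p < 1 -> p != 2^-1 ->
  weight p t1 s1 true + weight p t1 s1 false = 1 ->
  [/\ (hat_t p - t1) * drift p t1 s1 <= 0,
      drift p t1 s1 = 0 -> hat_t p = t1 &
      hat_t p = t1 -> drift p t1 s1 = 0].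
Proof.
move=> p01 p2 w1; have [c10 c20 c12 cK] := c12_facts p01 p2.
have [e1 e2] := weight_hat p01 p2.
have A1 := a1_lt0; have A2 := a2_lt0.
have u0 := expR_gt0 (t1 * ln (2 * lprob p true) + s1 * ln (lratio r1 r2 true)).
have v0 := expR_gt0 (t1 * ln (2 * lprob p false) + s1 * ln (lratio r1 r2 false)).
rewrite -/(weight p t1 s1 true) in u0; rewrite -/(weight p t1 s1 false) in v0.
have h1 : (s1 - s_hat r1 r2 p) * (c1 p * ln r1 + c2 p * ln r2) <= 0.
  have := w1; rewrite (weight_tilt p (hat_t p) t1 (s_hat r1 r2 p)) e1.
  rewrite (weight_tilt p (hat_t p) t1 (s_hat r1 r2 p)) e2 /= => h.
  have := @exp_mean_le0 _ _ _ ((t1 - hat_t p) * ln (2 * p) + (s1 - s_hat r1 r2 p) * ln r1)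
    ((t1 - hat_t p) * ln (2 * (1 - p)) + (s1 - s_hat r1 r2 p) * ln r2) (ltW c10) (ltW c20) c12.
  rewrite h lexx => /(_ isT).
  have -> : c1 p * ((t1 - hat_t p) * ln (2 * p) + (s1 - s_hat r1 r2 p) * ln r1) +
    c2 p * ((t1 - hat_t p) * ln (2 * (1 - p)) + (s1 - s_hat r1 r2 p) * ln r2) =
    (t1 - hat_t p) * (c1 p * ln (2 * p) + c2 p * ln (2 * (1 - p))) +
    (s1 - s_hat r1 r2 p) * (c1 p * ln r1 + c2 p * ln r2) by ring.
  by rewrite cK mulr0 add0r.
have Ac : c1 p * ln r1 + c2 p * ln r2 < 0 by nra.
have s1h : s_hat r1 r2 p <= s1 by nra.
have h2 : (hat_t p - t1) * drift p t1 s1 + (s_hat r1 r2 p - s1) *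
   (weight p t1 s1 true * ln r1 + weight p t1 s1 false * ln r2) <= 0.
  have := c12; rewrite -e1 -e2 (weight_tilt p t1 (hat_t p) s1).
  rewrite (weight_tilt p t1 (hat_t p) s1) => h.
  have := @exp_mean_le0 _ _ _ ((hat_t p - t1) * ln (2 * p) + (s_hat r1 r2 p - s1) * ln r1)
    ((hat_t p - t1) * ln (2 * (1 - p)) + (s_hat r1 r2 p - s1) * ln r2) (ltW u0) (ltW v0) w1.
  rewrite h lexx => /(_ isT); apply: le_trans; rewrite le_eqVlt; apply/orP; left.
  by apply/eqP; rewrite /drift/=; ring.
have A0 : weight p t1 s1 true * ln r1 + weight p t1 s1 false * ln r2 < 0 by nra.
have h3 : (hat_t p - t1) * drift p t1 s1 <= 0 by nra.
have det := hat_det p01 p2.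
split=> // [d0|te].
- have e3 : weight p t1 s1 true = c1 p.
    have ne : ln (2 * p) - ln (2 * (1 - p)) != 0.
      by case: (half_side p01 p2) => [[]|[]] ? ?; [rewrite lt_eqF|rewrite gt_eqF]; lra.
    apply: (mulIf ne).
    move: d0; rewrite /drift.
    have -> : weight p t1 s1 false = 1 - weight p t1 s1 true by lra.
    have c2e : c2 p = 1 - c1 p by lra.
    move: cK; rewrite c2e; move: (weight _ _ _ _) => u; nra.
  have e4 : weight p t1 s1 false = c2 p by lra.
  move: e3 e4; rewrite -e1 -e2 => /expR_inj/= E1 /expR_inj/= E2.
  have : (hat_t p - t1) * (ln r1 * ln (2 * (1 - p)) - ln r2 * ln (2 * p)) = 0.
    have F1 : (hat_t p - t1) * ln (2 * p) = (s1 - s_hat r1 r2 p) * ln r1 by lra.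
    have F2 : (hat_t p - t1) * ln (2 * (1 - p)) = (s1 - s_hat r1 r2 p) * ln r2 by lra.
    rewrite mulrBr [_ * (ln r1 * _)]mulrCA [_ * (ln r2 * _)]mulrCA F1 F2; ring.
  by move/eqP; rewrite mulf_eq0 (negbTE det) orbF subr_eq0 => /eqP.
- have h4 : 0 <= s_hat r1 r2 p - s1.
    move: h2; rewrite te subrr mul0r add0r; nra.
  have es : s_hat r1 r2 p = s1 by lra.
  by rewrite /drift -te -es e1 e2.
Qed.

Lemma critical_hat p : 0 < p < 1 -> p != 2^-1 -> 0 <= hat_t p <= 1 ->
  critical p (s_hat r1 r2 p).
Proof.
move=> p01 p2 t01; exists (hat_t p); have [e1 e2] := weight_hat p01 p2.
have [_ _ c12 cK] := c12_facts p01 p2.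
by split=> //; rewrite ?e1 ?e2//; left; rewrite /drift e1 e2 cK mulr0.
Qed.

End Critical.

(** * The dimension as a function of p *)

Section Exponents.
Context {R : realType}.
Implicit Types x y s t p q D : R.

(** The relative entropy of (p, 1 - p) with respect to (1/2, 1/2) is positive. *)
Lemma entropy_gap p : 0 < p < 1 -> p != 2^-1 ->
  0 < p * ln (2 * p) + (1 - p) * ln (2 * (1 - p)).
Proof.
move=> /andP[p0 p1] p2.
have h (z : R) : 0 < z -> z != 1 -> z - 1 < z * ln z.
  move=> z0 z1; have := @ln_lt_sub1 R z^-1.
  rewrite invr_gt0 invr_eq1 lnV ?posrE// => /(_ z0 z1) h.
  have : z * (1 - z^-1) < z * ln z by rewrite ltr_pM2l//; lra.
  by rewrite mulrBr mulr1 divff// gt_eqF.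
have h1 := h (2 * p) ltac:(lra); have h2 := h (2 * (1 - p)) ltac:(lra).
have n1 : 2 * p != 1 by apply: contraNneq p2 => e; apply/eqP; lra.
have n2 : 2 * (1 - p) != 1 by apply: contraNneq p2 => e; apply/eqP; lra.
have := h1 n1; have := h2 n2; lra.
Qed.

Lemma ln_half_sum p : 0 < p < 1 -> ln (2 * p) + ln (2 * (1 - p)) <= 0.
Proof.
by move=> /andP[p0 p1]; rewrite -lnM ?posrE; [|lra|lra]; apply: ln_le0; have := sqr_ge0 (1 - 2 * p); rewrite expr2; lra.
Qed.

(** Under (c1 p, c2 p) the mean of ln (2 p_a) vanishes, while under (p, 1 - p) it is
    the positive relative entropy. *)
Lemma c1_side p : 0 < p < 1 -> p != 2^-1 -> (2^-1 - p) * (c1 p - p) > 0.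
Proof.
move=> p01 p2; have [c10 c20 c12 cK] := c12_facts p01 p2.
have g := entropy_gap p01 p2.
have e : (p - c1 p) * (ln (2 * p) - ln (2 * (1 - p))) > 0.
  have c2e : c2 p = 1 - c1 p by lra.
  by rewrite c2e in cK; nra.
case: (half_side p01 p2) => [[h1 h2]|[h1 h2]].
  have : p < 2^-1.
    rewrite ltNge; apply/negP => h; have : 0 <= ln (2 * p) by apply: ln_ge0; lra.
    lra.
  nra.
have : 2^-1 < p.
  rewrite ltNge; apply/negP => h; have : ln (2 * p) <= 0 by apply: ln_le0; lra.
  lra.
nra.
Qed.

Section Regimes.
Variables r1 r2 : R.
Hypotheses (r1_gt0 : 0 < r1) (r1_lt_r2 : r1 < r2) (r2_lt1 : r2 < 1).

Let r2_gt0 : 0 < r2. Proof. exact: lt_trans r1_lt_r2. Qed.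
Let a12 : ln r1 < ln r2. Proof. by rewrite ltr_ln ?posrE. Qed.
Let a20 : ln r2 < 0. Proof. by apply: ln_lt0; rewrite r2_gt0. Qed.
Let a10 : ln r1 < 0. Proof. exact: lt_trans a20. Qed.

(** st stands for s-tilde; the hypotheses are what exp_sum_root, lo_threshold and
    hi_threshold provide. *)
Variables (s0 : R) (st : R -> R) (p_lo p_hi s_hi : R).
Let rho := expR (s0 * (ln r2 - ln r1)).
Hypothesis es0 : exp_sum 1 1 (ln r1) (ln r2) s0 = 1.
Hypothesis est : forall p, 0 < p < 1 -> tilde_eq (ln r1) (ln r2) p (st p).
Hypothesis lo_in : 0 < p_lo < 2^-1.
Hypothesis loE : lo_fun rho p_lo = 0.
Hypothesis lo_neg : forall p, 0 < p < p_lo -> lo_fun rho p < 0.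
Hypothesis lo_pos : forall p, p_lo < p < 2^-1 -> 0 < lo_fun rho p.
Hypothesis hi_in : 2^-1 < p_hi < 1.
Hypothesis hiT : tilde_eq (ln r1) (ln r2) p_hi s_hi.
Hypothesis hiE : hi_fun (ln r1) (ln r2) p_hi s_hi = 0.

Let hi01 : 0 < p_hi < 1. Proof. by have := hi_in; lra. Qed.

Lemma drift_base p : drift r1 r2 p 0 s0 = expR (s0 * ln r1) * lo_fun rho p.
Proof.
have e : expR (s0 * ln r2) = expR (s0 * ln r1) * rho by rewrite -expRD; congr expR; ring.
by rewrite /drift !weight_t0/= e /lo_fun; ring.
Qed.

Lemma weight_base p : weight r1 r2 p 0 s0 true + weight r1 r2 p 0 s0 false = 1.
Proof. by rewrite !weight_t0/=; move: es0; rewrite /exp_sum !mul1r. Qed.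

Lemma drift_base_lt0 p : 0 < p < p_lo \/ 2^-1 < p < 1 -> drift r1 r2 p 0 s0 < 0.
Proof.
move=> [hp|/andP[p2 p1]]; rewrite drift_base pmulr_rlt0 ?expR_gt0//; first exact: lo_neg.
rewrite /lo_fun.
have rho1 : 1 < rho.
  rewrite /rho expR_gt1 mulr_gt0 ?subr_gt0// ltNge; apply/negP => s00.
  have := es0; rewrite /exp_sum !mul1r.
  have h1 : 0 <= s0 * ln r1 by rewrite mulr_le0// ltW.
  by have := expR_ge1Dx (s0 * ln r1); have := expR_gt0 (s0 * ln r2); lra.
have := @ln_half_sum p ltac:(lra).
have : 0 < ln (2 * p) by apply: ln_gt0; lra.
by move: (ln (2 * p)) (ln (2 * (1 - p))) => u v u0 uv; nra.
Qed.

Lemma drift_base_ge0 p : p_lo <= p <= 2^-1 -> 0 <= drift r1 r2 p 0 s0.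
Proof.
move=> /andP[pl p2]; rewrite drift_base pmulr_rge0 ?expR_gt0//.
move: pl; rewrite le_eqVlt => /orP[/eqP<-|pl]; first by rewrite loE.
move: p2; rewrite le_eqVlt => /orP[/eqP->|p2]; last by apply/ltW/lo_pos; rewrite pl.
rewrite /lo_fun (_ : 2 * 2^-1 = 1); last by lra.
by rewrite (_ : 2 * (1 - 2^-1) = 1) ?ln1; lra.
Qed.

Lemma hi_fun_le0 p : 2^-1 <= p <= p_hi -> hi_fun (ln r1) (ln r2) p (st p) <= 0.
Proof.
have /andP[hi2 hi1] := hi_in; move=> /andP[p2 ph].
move: p2; rewrite le_eqVlt => /orP[/eqP<-|p2].
  rewrite /hi_fun (_ : 2 * 2^-1 = 1); last by lra.
  by rewrite (_ : 2 * (1 - 2^-1) = 1) ?ln1; lra.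
move: ph; rewrite le_eqVlt => /orP[/eqP->|ph].
  by rewrite (tilde_eq_inj a12 a20 hi01 (est hi01) hiT) hiE.
apply/ltW; apply: (hi_fun_sign a12 a20 p2 ph hi1 _ hiT); last by rewrite hiE.
by apply: est; lra.
Qed.

Lemma hi_fun_gt0 p : 0 < p < 2^-1 \/ p_hi < p < 1 ->
  0 < hi_fun (ln r1) (ln r2) p (st p).
Proof.
have /andP[hi2 hi1] := hi_in; move=> [/andP[p0 p2]|/andP[ph p1]]; last first.
  rewrite ltNge; apply/negP => h.
  have tp : tilde_eq (ln r1) (ln r2) p (st p) by apply: est; lra.
  by have := hi_fun_sign a12 a20 hi2 ph p1 hiT tp h; rewrite hiE ltxx.
have p01 : 0 < p < 1 by lra.
have /andP[h1 h2] := tilde_eq_half a12 a20 p01 (est p01).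
have pne : p != 2^-1 by rewrite lt_eqF.
have g := entropy_gap p01 pne; rewrite /hi_fun.
have l1 : ln (2 * p) < 0 by apply: ln_lt0; lra.
have l2 : 0 < ln (2 * (1 - p)) by apply: ln_gt0; lra.
have k1 : 2^-1 * (p * ln (2 * p)) < expR (st p * ln r1) * (p * ln (2 * p)).
  by rewrite ltr_nM2r// pmulr_rlt0.
have k2 : 2^-1 * ((1 - p) * ln (2 * (1 - p))) < expR (st p * ln r2) * ((1 - p) * ln (2 * (1 - p))).
  by rewrite ltr_pM2r// mulr_gt0//; lra.
lra.
Qed.

Lemma critical_mid p : p_lo <= p <= 2^-1 -> critical r1 r2 p s0.
Proof. by move=> hp; apply: critical_base => //; exact: drift_base_ge0. Qed.

Lemma critical_mid_right p : 2^-1 <= p <= p_hi -> critical r1 r2 p (st p).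
Proof.
have /andP[hi2 hi1] := hi_in.
by move=> hp; apply: critical_tilde; [lra|apply: est; lra|exact: hi_fun_le0].
Qed.

(** Outside (p_lo, p_hi) the drift is nonpositive at t = 0 and nonnegative at t = 1,
    which confines the minimum hat_t to [0, 1]. *)
Lemma hat_t_range p : 0 < p < 1 -> (p <= p_lo) || (p_hi <= p) ->
  [/\ p != 2^-1, 0 <= hat_t r1 r2 p <= 1 & p != p_lo -> 0 < hat_t r1 r2 p].
Proof.
have /andP[lo0 lo2] := lo_in; have /andP[hi2 hi1] := hi_in.
move=> p01 hp; have p2 : p != 2^-1.
  by case/orP: hp => hp; [rewrite lt_eqF|rewrite gt_eqF]; lra.
have [S1 S2 S3] := hat_slope r1_gt0 r1_lt_r2 r2_lt1 p01 p2 (weight_base p).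
have w1 := weight_tilde (r1:=r1) (r2:=r2) p01 (est p01).
have [T1 T2 _] := hat_slope r1_gt0 r1_lt_r2 r2_lt1 p01 p2 w1.
rewrite drift_tilde// in T1 T2.
have h0 : 0 <= hi_fun (ln r1) (ln r2) p (st p).
  case/orP: hp => hp; first by apply/ltW/hi_fun_gt0; left; lra.
  move: hp; rewrite le_eqVlt => /orP[/eqP<-|hp]; last by apply/ltW/hi_fun_gt0; right; lra.
  by rewrite (tilde_eq_inj a12 a20 hi01 (est hi01) hiT) hiE.
have t1 : hat_t r1 r2 p <= 1.
  move: h0; rewrite le_eqVlt => /orP[/eqP h0|h0]; first by rewrite T2// -h0 mulr0.
  by rewrite -subr_le0 -(pmulr_lle0 _ h0); move: T1; lra.
have [e|ne] := eqVneq p p_lo.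
  have d0 : drift r1 r2 p 0 s0 = 0 by rewrite drift_base e loE mulr0.
  by split=> //; rewrite S2// lexx ler01.
have d0 : drift r1 r2 p 0 s0 < 0.
  apply: drift_base_lt0; case/orP: hp => hp; last by right; lra.
  have hp' : p < p_lo by rewrite lt_neqAle ne.
  by left; rewrite hp' andbT; case/andP: p01.
have t0 : 0 < hat_t r1 r2 p.
  rewrite lt_neqAle; apply/andP; split.
    by apply/eqP => e; move: d0; rewrite S3 ?ltxx.
  by move: S1; rewrite subr0 nmulr_lle0.
by split=> //; rewrite t1 ltW.
Qed.

Lemma critical_outer p : 0 < p < 1 -> (p <= p_lo) || (p_hi <= p) ->
  critical r1 r2 p (s_hat r1 r2 p).
Proof. by move=> p01 /(hat_t_range p01)[p2 t01 _]; apply: critical_hat. Qed.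

Definition dim_value p := if 0 < p < 1 then
  if (p <= p_lo) || (p_hi <= p) then s_hat r1 r2 p else if p <= 2^-1 then s0 else st p
  else 0.

Lemma dim_value_critical p : 0 < p < 1 -> critical r1 r2 p (dim_value p).
Proof.
have /andP[lo0 lo2] := lo_in; have /andP[hi2 hi1] := hi_in.
move=> p01; rewrite /dim_value p01; case: ifPn => [|]; first exact: critical_outer.
rewrite negb_or -!ltNge => /andP[pl ph]; case: ifPn => [p2|]; first by apply: critical_mid; lra.
by rewrite -ltNge => p2; apply: critical_mid_right; lra.
Qed.

Lemma dim_valueE p d : 0 < p < 1 -> critical r1 r2 p d -> dim_value p = d.
Proof. by move=> p01; apply: critical_uniq => //; exact: dim_value_critical. Qed.

Lemma dim_value_gt0 p : 0 < p < 1 -> 0 < dim_value p.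
Proof. by move=> p01; apply: critical_gt0 (dim_value_critical p01). Qed.

Lemma dim_value_end p : ~~ (0 < p < 1) -> dim_value p = 0.
Proof. by rewrite /dim_value => /negbTE->. Qed.

Lemma dim_value_cases p : 0 < p < 1 ->
  [/\ p_lo <= p <= 2^-1 -> dim_value p = s0,
      2^-1 <= p <= p_hi -> dim_value p = st p &
      (p <= p_lo) || (p_hi <= p) -> dim_value p = s_hat r1 r2 p].
Proof.
move=> p01; split => hp; apply: dim_valueE => //;
  [exact: critical_mid|exact: critical_mid_right|exact: critical_outer].
Qed.

Lemma dim_value_mid p : p_lo <= p <= 2^-1 -> dim_value p = s0.
Proof.
have /andP[lo0 lo2] := lo_in.
by move=> hp; apply: dim_valueE; [lra|exact: critical_mid].
Qed.

(** critical_shift at the tilt hat_t q, where the weight of the label 1 is c1 q;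
    its position relative to q is given by c1_side. *)
Lemma dim_value_shift_hat p q : 0 < p < 1 -> 0 < q < 1 -> (q <= p_lo) || (p_hi <= q) ->
  q != p_lo -> (p - q) * (2^-1 - q) < 0 -> dim_value p < dim_value q.
Proof.
move=> p01 q01 qo ql pq.
have [q2 /andP[t0 t1] tpos] := hat_t_range q01 qo.
have [e1 e2] := weight_hat r1_gt0 r1_lt_r2 r2_lt1 q01 q2.
have [_ _ c12 _] := c12_facts q01 q2.
have cs := c1_side q01 q2.
have t01 : 0 < hat_t r1 r2 q <= 1 by rewrite t1 tpos.
rewrite (dim_valueE q01 (critical_outer q01 qo)).
apply: (critical_shift r1_gt0 r1_lt_r2 r2_lt1 p01 q01 t01 _ (dim_value_critical p01));
  rewrite ?e1 ?e2//.
(* The two given signs are multiplied, which produces the square of 1/2 - q. *)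
have h : ((p - q) * (2^-1 - q)) * ((2^-1 - q) * (c1 q - q)) < 0 by rewrite nmulr_rlt0.
rewrite ltNge; apply/negP => h2; have := mulr_ge0 h2 (sqr_ge0 (2^-1 - q)).
by rewrite leNgt (_ : _ * _ ^+ 2 = (p - q) * (2^-1 - q) * ((2^-1 - q) * (c1 q - q))) ?h//; ring.
Qed.

Lemma dim_value_incr_lo p q : 0 < p -> p < q -> q < p_lo -> dim_value p < dim_value q.
Proof.
have /andP[lo0 lo2] := lo_in => p0 pq ql; apply: dim_value_shift_hat; try by lra.
by rewrite nmulr_rlt0 ?subr_gt0 ?subr_lt0//; exact: lt_trans lo2.
Qed.

Lemma dim_value_incr_left : {in `[0, p_lo] &, forall p q, p < q -> dim_value p < dim_value q}.
Proof.
have /andP[lo0 lo2] := lo_in.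
move=> p q; rewrite !in_itv/= => /andP[p0 pl] /andP[q0 ql] pq.
move: p0; rewrite le_eqVlt => /orP[/eqP e|p0].
  by rewrite -e (@dim_value_end 0) ?ltxx//; apply: dim_value_gt0; lra.
move: ql; rewrite le_eqVlt => /orP[/eqP e|ql]; last exact: dim_value_incr_lo.
(* At p_lo itself the exponent s0 is compared through the tilt t = 0. *)
rewrite e in pq *; have h : p < (p + p_lo) / 2 < p_lo by lra.
apply: (@lt_le_trans _ _ (dim_value ((p + p_lo) / 2))); first by apply: dim_value_incr_lo; lra.
rewrite (@dim_value_mid p_lo) ?lexx ?(ltW lo2)//.
have m01 : 0 < (p + p_lo) / 2 < 1 by lra.
apply: (critical_min r1_gt0 r1_lt_r2 r2_lt1 (dim_value_critical m01) (_ : 0 <= 0 <= 1)).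
  by rewrite lexx ler01.
by rewrite weight_base.
Qed.

(** Up to p_hi the critical tilt is t = 1, and critical_shift applies since
    r1^s < 1/2; beyond p_hi this is dim_value_shift_hat. *)
Lemma dim_value_decr_right : {in `[2^-1, 1] &, forall p q, p < q -> dim_value q < dim_value p}.
Proof.
have /andP[lo0 lo2] := lo_in; have /andP[hi2 hi1] := hi_in.
move=> q p; rewrite !in_itv/= => /andP[q2 q1] /andP[p2 p1] qp.
move: p1; rewrite le_eqVlt => /orP[/eqP e|p1].
  by rewrite e (@dim_value_end 1) ?ltxx ?andbF//; apply: dim_value_gt0; lra.
have q01 : 0 < q < 1 by lra.
have p01 : 0 < p < 1 by lra.
case: (leP q p_hi) => hq; last first.
  apply: dim_value_shift_hat => //.
  - by rewrite (ltW hq) orbT.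
  - by rewrite gt_eqF//; lra.
  - by rewrite pmulr_rlt0 ?subr_gt0// subr_lt0; exact: lt_trans hq.
rewrite (@dim_valueE q (st q) q01); last by apply: critical_mid_right; rewrite q2.
have w1 := weight_tilde (r1:=r1) (r2:=r2) q01 (est q01).
apply: (critical_shift r1_gt0 r1_lt_r2 r2_lt1 p01 q01 _ w1 (dim_value_critical p01)).
  by rewrite ltr01 lexx.
rewrite weight_t1//=.
have /andP[h1 h2] := tilde_eq_half a12 a20 q01 (est q01).
rewrite pmulr_rlt0 ?subr_gt0//.
have : q * expR (st q * ln r1) < q * 2^-1 by rewrite ltr_pM2l//; case/andP: q01.
lra.
Qed.

Lemma p_lo_uniq : unique (fun p => 0 < p < 2^-1 /\
  ln (2 * p) / ln (2 * (1 - p)) = - ((r2 / r1) `^ s0)) p_lo.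
Proof.
have rhoE : (r2 / r1) `^ s0 = rho by rewrite powR_expR ?divr_gt0// ln_div ?posrE.
have lnE p : 0 < p < 2^-1 -> ln (2 * p) / ln (2 * (1 - p)) = - rho <-> lo_fun rho p = 0.
  move=> hp; have l0 : 0 < ln (2 * (1 - p)) by apply: ln_gt0; lra.
  rewrite /lo_fun; split => h.
    by rewrite -[ln (2 * p)](divfK (lt0r_neq0 l0)) h; ring.
  apply: (mulIf (lt0r_neq0 l0)); rewrite divfK ?lt0r_neq0//.
  by move/eqP: h; rewrite addr_eq0 -mulNr => /eqP.
rewrite rhoE; split; first by split; [exact: lo_in|apply/lnE].
move=> p [/andP[p0 p2]] /lnE h; have {}h : lo_fun rho p = 0 by apply: h; rewrite p0.
case: (ltgtP p p_lo) => // hp.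
  by have := @lo_neg p; rewrite h ltxx p0 hp => /(_ isT).
by have := @lo_pos p; rewrite h ltxx p2 hp => /(_ isT).
Qed.

Lemma p_hi_uniq : unique (fun ps : R * R => let: (p, s) := ps in
  [/\ 2^-1 < p < 1, p * r1 `^ s + (1 - p) * r2 `^ s = 2^-1 &
      p * r1 `^ s * ln p + (1 - p) * r2 `^ s * ln (1 - p) = - (2^-1 * ln 2)]) (p_hi, s_hi).
Proof.
have eqE p s : 2^-1 < p < 1 -> tilde_eq (ln r1) (ln r2) p s ->
   (p * r1 `^ s * ln p + (1 - p) * r2 `^ s * ln (1 - p) = - (2^-1 * ln 2)) <->
   hi_fun (ln r1) (ln r2) p s = 0.
  move=> p21; rewrite !powR_expR// /tilde_eq /exp_sum /hi_fun => ts.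
  have [-> ->] := ln_2p_eq (p := p) ltac:(lra).
  have -> : p * expR (s * ln r1) * (ln 2 + ln p) + (1 - p) * expR (s * ln r2) * (ln 2 + ln (1 - p)) =
    (p * expR (s * ln r1) + (1 - p) * expR (s * ln r2)) * ln 2 +
    (p * expR (s * ln r1) * ln p + (1 - p) * expR (s * ln r2) * ln (1 - p)) by ring.
  rewrite ts; move: (_ + (1 - p) * _ * ln (1 - p)) => x.
  by split=> [->|h]; [rewrite subrr|lra].
split.
  by split; [exact: hi_in|rewrite !powR_expR//; exact: hiT|apply/(eqE _ _ hi_in hiT)].
move=> [p s] [p21 ts]; have ts' : tilde_eq (ln r1) (ln r2) p s by move: ts; rewrite !powR_expR.
move=> /(eqE _ _ p21 ts') h; have p01 : 0 < p < 1 by lra.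
have /andP[hi2 hi1] := hi_in; have /andP[p2 p1] := p21.
have e : p_hi = p.
  have es := tilde_eq_inj a12 a20 p01 (est p01) ts'.
  case: (ltgtP p_hi p) => // hp.
    by have := @hi_fun_gt0 p; rewrite es h ltxx hp p1 => /(_ (or_intror isT)).
  have := hi_fun_sign a12 a20 p2 hp hi1 ts' hiT.
  by rewrite hiE h ltxx => /(_ (lexx _)).
by rewrite -e in ts' *; congr pair; exact: (tilde_eq_inj a12 a20 hi01 hiT ts').
Qed.

End Regimes.

(** All statements of the theorem that do not concern the random set, with a
    function D whose values are critical exponents. *)
Theorem critical_exponents (r1 r2 : R)
    (r1_gt0 : 0 < r1) (r1_lt_r2 : r1 < r2) (r2_lt1 : r2 < 1) :
  exists (s0 : R) (s_tilde : R -> R) (p_lo p_hi : R) (D : R -> R),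
    [/\ unique (fun s => r1 `^ s + r2 `^ s = 1) s0,
    (forall p, 0 < p < 1 ->
      unique (fun s => p * r1 `^ s + (1 - p) * r2 `^ s = 2^-1) (s_tilde p)),
    [/\ 0 < p_lo, p_lo < 2^-1, 2^-1 < p_hi & p_hi < 1],
    unique (fun p => 0 < p < 2^-1 /\
              ln (2 * p) / ln (2 * (1 - p)) = - ((r2 / r1) `^ s0)) p_lo &
    (exists s_hi : R,
      unique (fun ps : R * R => let: (p, s) := ps in
        [/\ 2^-1 < p < 1,
            p * r1 `^ s + (1 - p) * r2 `^ s = 2^-1 &
            p * r1 `^ s * ln p + (1 - p) * r2 `^ s * ln (1 - p) =
              - (2^-1 * ln 2)]) (p_hi, s_hi))] /\
    [/\ D 0 = 0, D 1 = 0, (forall p, 0 < p < 1 -> critical r1 r2 p (D p)),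
     (forall p, 0 < p < 1 ->
          [/\ p_lo <= p <= 2^-1 -> D p = s0,
              2^-1 <= p <= p_hi -> D p = s_tilde p &
              (p <= p_lo) || (p_hi <= p) -> D p = s_hat r1 r2 p]) &
     [/\ {in `[0, p_lo] &, forall p q, p < q -> D p < D q},
            {in `[p_lo, 2^-1] &, forall p q, D p = D q} &
            {in `[2^-1, 1] &, forall p q, p < q -> D q < D p}]].
Proof.
have r2_gt0 : 0 < r2 by apply: lt_trans r1_lt_r2.
have a12 : ln r1 < ln r2 by rewrite ltr_ln ?posrE.
have a20 : ln r2 < 0 by apply: ln_lt0; rewrite r2_gt0.
have a10 : ln r1 < 0 by apply: lt_trans a20.
have [s0 es0] : exists s, exp_sum 1 1 (ln r1) (ln r2) s = 1 by apply: exp_sum_root.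
have s0pos : 0 < s0.
  rewrite ltNge; apply/negP => s00; move: es0; rewrite /exp_sum !mul1r.
  have : 1 <= expR (s0 * ln r1) by apply: le_trans (expR_ge1Dx _); nra.
  by have := expR_gt0 (s0 * ln r2); lra.
have /choice[st est] p : exists s, 0 < p < 1 -> tilde_eq (ln r1) (ln r2) p s.
  have [p01|_] := boolP (0 < p < 1); last by exists 0.
  by have [s es] := tilde_eq_ex a12 a20 p01; exists s.
have rho1 : 1 < expR (s0 * (ln r2 - ln r1)) by rewrite expR_gt1 mulr_gt0// subr_gt0.
have [p_lo [lo_in loE lo_neg lo_pos]] := lo_threshold rho1.
have [p_hi [s_hi [hi_in hiT hiE]]] := hi_threshold a12 a20.
exists s0, st, p_lo, p_hi, (dim_value r1 r2 s0 st p_lo p_hi); split; split => //.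
- split; first by move: es0; rewrite /exp_sum !powR_expR// !mul1r.
  move=> s; rewrite !powR_expR// => hs; apply: (@exp_sum_inj R 1 1 _ _ _ _ _ _ a10 a20) => //.
  by rewrite es0 /exp_sum !mul1r hs.
- move=> p p01; split; first by rewrite !powR_expR//; exact: est.
  by move=> s; rewrite !powR_expR// => hs; exact: (tilde_eq_inj a12 a20 p01 (est _ p01)).
- by case/andP: lo_in hi_in => -> -> /andP[-> ->].
- exact: (p_lo_uniq r1_gt0 r1_lt_r2 lo_in loE lo_neg lo_pos).
- by exists s_hi; exact: (p_hi_uniq r1_gt0 r1_lt_r2 r2_lt1 est hi_in hiT hiE).
- by rewrite dim_value_end// ltxx.
- by rewrite dim_value_end// ltxx andbF.
- exact: (dim_value_critical r1_gt0 r1_lt_r2 r2_lt1 es0 est lo_in loE lo_neg lo_pos hi_in hiT hiE).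
- exact: (dim_value_cases r1_gt0 r1_lt_r2 r2_lt1 es0 est lo_in loE lo_neg lo_pos hi_in hiT hiE).
- split.
  + exact: (dim_value_incr_left r1_gt0 r1_lt_r2 r2_lt1 es0 est lo_in loE lo_neg lo_pos hi_in hiT hiE).
  + move=> p q; rewrite !in_itv/= => hp hq.
    have mid := dim_value_mid r1_gt0 r1_lt_r2 r2_lt1 es0 est lo_in loE lo_neg lo_pos hi_in hiT hiE.
    by rewrite !mid.
  + exact: (dim_value_decr_right r1_gt0 r1_lt_r2 r2_lt1 es0 est lo_in loE lo_neg lo_pos hi_in hiT hiE).
Qed.

End Exponents.

(** * Expectations over the first levels of the tree *)

(** c u b is the label of the edge that joins the vertex u to its child rcons u b. *)
Definition labelling := seq bool -> bool -> bool.
(** The labellings of the subtrees at a child of the root and at a vertex x. *)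
Definition child (b : bool) (c : labelling) : labelling := fun u => c (b :: u).
Definition subtree (x : seq bool) (c : labelling) : labelling := fun u => c (x ++ u).
Definition graft (a b : bool) (c1 c2 : labelling) : labelling := fun u x =>
  if u is y :: u' then (if y then c1 else c2) u' x else if x then a else b.

Lemma graft_child c : graft (c [::] true) (c [::] false) (child true c) (child false c) = c.
Proof. by apply/funext => -[|[] u]; apply/funext => -[]. Qed.

Fixpoint edges (n : nat) : seq (seq bool * bool) :=
  if n is n'.+1 then
    [:: ([::], true), ([::], false) &
      [seq (true :: e.1, e.2) | e <- edges n'] ++ [seq (false :: e.1, e.2) | e <- edges n']]
  else [::].

Definition bools := [:: true; false].

(** One labelling for each assignment of labels to edges n; deeper edges carry an
    arbitrary label. *)
Fixpoint confs (n : nat) : seq labelling :=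
  if n is n'.+1 then
    [seq graft x.1.1 x.1.2 x.2.1 x.2.2 | x <-
      [seq (ab, cc) | ab <- [seq (a, b) | a <- bools, b <- bools],
                      cc <- [seq (c1, c2) | c1 <- confs n', c2 <- confs n']]]
  else [:: fun _ _ => true].

Fixpoint words (n : nat) : seq (seq bool) :=
  if n is n'.+1 then [seq b :: w | b <- bools, w <- words n'] else [:: [::]].

Lemma mem_words n w : (w \in words n) = (size w == n).
Proof.
elim: n w => [|n IH] [|b w] //=; rewrite !mem_cat in_nil orbF.
  by apply/negbTE; rewrite negb_or; apply/andP; split; apply/negP => /mapP[].
rewrite eqSS -IH; apply/idP/idP => [/orP[|] /mapP[v hv [_ ->]]//|hw].
by case: b; apply/orP; [left|right]; apply/mapP; exists w.
Qed.

Lemma words_uniq n : uniq (words n).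
Proof.
elim: n => [//|n IH]; apply: allpairs_uniq => //.
by move=> [a u] [b v] _ _ /= [-> ->].
Qed.

Lemma edges_uniq n : uniq (edges n).
Proof.
elim: n => [//|n IH] /=; rewrite !inE !mem_cat !negb_or.
have no b (l : bool) : ([::], l) \notin [seq (b :: e.1, e.2) | e <- edges n].
  by apply/negP => /mapP[e _].
rewrite !no/= cat_uniq !map_inj_uniq ?IH ?andbT//=; last 2 first.
  by move=> [u x] [v y] /= [-> ->].
  by move=> [u x] [v y] /= [-> ->].
by apply/hasPn => e /mapP[e1 _ ->]; apply/negP => /mapP[e2 _] [].
Qed.

Definition depends_upto {X : Type} (n : nat) (f : labelling -> X) :=
  forall c c', (forall u x, (size u < n)%N -> c u x = c' u x) -> f c = f c'.

Lemma depends_graftl X n (f : labelling -> X) a b c2 : depends_upto n.+1 f -> depends_upto n (fun c1 => f (graft a b c1 c2)).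
Proof. by move=> df c c' e; apply: df => -[|[] u] x //= h; rewrite e. Qed.

Lemma depends_graftr X n (f : labelling -> X) a b c1 : depends_upto n.+1 f -> depends_upto n (fun c2 => f (graft a b c1 c2)).
Proof. by move=> df c c' e; apply: df => -[|[] u] x //= h; rewrite e. Qed.

Section Wsum.
Context {R : realType}.
Implicit Types (f g : labelling -> R) (k : seq bool -> bool -> bool -> R).

Definition tree_weight k n (c : labelling) : R := \prod_(e <- edges n) k e.1 e.2 (c e.1 e.2).
(** With the label probabilities as weights k this is an expectation (mean); with
    indicators of a given labelling it is an evaluation (tree_sum_eval). *)
Definition tree_sum k n f : R := \sum_(c <- confs n) tree_weight k n c * f c.

Lemma tree_weightS k n a b c1 c2 : tree_weight k n.+1 (graft a b c1 c2) =
  k [::] true a * k [::] false b *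
  (tree_weight (fun u => k (true :: u)) n c1 * tree_weight (fun u => k (false :: u)) n c2).
Proof. by rewrite /tree_weight /= !big_cons big_cat !big_map/= mulrA. Qed.

Lemma tree_sumS k n f : tree_sum k n.+1 f =
  \sum_(a : bool) \sum_(b : bool) k [::] true a * k [::] false b *
    tree_sum (fun u => k (true :: u)) n (fun c1 =>
      tree_sum (fun u => k (false :: u)) n (fun c2 => f (graft a b c1 c2))).
Proof.
have confsS : confs n.+1 = [seq graft x.1.1 x.1.2 x.2.1 x.2.2 | x <-
      [seq (ab, cc) | ab <- [seq (a, b) | a <- bools, b <- bools],
                      cc <- [seq (c1, c2) | c1 <- confs n, c2 <- confs n]]] by [].
rewrite /tree_sum confsS big_map big_allpairs_dep big_allpairs_dep.
rewrite !big_cons !big_nil !big_bool /= !addr0.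
have h a b : \sum_(i <- [seq (c1, c2) | c1 <- confs n, c2 <- confs n])
    tree_weight k n.+1 (graft a b i.1 i.2) * f (graft a b i.1 i.2) =
  k [::] true a * k [::] false b * \sum_(c1 <- confs n) tree_weight (fun u => k (true :: u)) n c1 *
     \sum_(c2 <- confs n) tree_weight (fun u => k (false :: u)) n c2 * f (graft a b c1 c2).
  rewrite big_allpairs_dep/= mulr_sumr; apply: eq_bigr => c1 _.
  rewrite mulrA !mulr_sumr; apply: eq_bigr => c2 _; rewrite tree_weightS; ring.
by rewrite !h.
Qed.

Lemma tree_sum0 k f : tree_sum k 0 f = f (fun _ _ => true).
Proof. by rewrite /tree_sum /= big_seq1 /tree_weight big_nil mul1r. Qed.

Lemma eq_tree_sum k n f g : (forall c, f c = g c) -> tree_sum k n f = tree_sum k n g.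
Proof. by move=> e; apply: eq_bigr => c _; rewrite e. Qed.

Lemma tree_sum_sum k n I (s : seq I) (P : pred I) (F : I -> labelling -> R) :
  tree_sum k n (fun c => \sum_(i <- s | P i) F i c) = \sum_(i <- s | P i) tree_sum k n (F i).
Proof. by rewrite /tree_sum exchange_big/=; apply: eq_bigr => c _; rewrite mulr_sumr. Qed.

Lemma tree_sumD k n f g : tree_sum k n (fun c => f c + g c) = tree_sum k n f + tree_sum k n g.
Proof. by rewrite /tree_sum -big_split; apply: eq_bigr => c _; rewrite mulrDr. Qed.

Lemma tree_sumZ k n x f : tree_sum k n (fun c => x * f c) = x * tree_sum k n f.
Proof. by rewrite /tree_sum mulr_sumr; apply: eq_bigr => c _; rewrite mulrCA. Qed.

Lemma tree_sumZr k n x f : tree_sum k n (fun c => f c * x) = tree_sum k n f * x.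
Proof. by rewrite /tree_sum mulr_suml; apply: eq_bigr => c _; rewrite mulrA. Qed.

Lemma tree_sum_le k n f g : (forall u b x, 0 <= k u b x) -> (forall c, f c <= g c) ->
  tree_sum k n f <= tree_sum k n g.
Proof.
by move=> k0 fg; apply: ler_sum => c _; apply: ler_wpM2l => //; apply: prodr_ge0.
Qed.

(** This writes a function of finitely many labels as a linear combination of
    indicators of cylinders, whose probabilities follow from independence. *)
Lemma tree_sum_eval c n f : depends_upto n f ->
  tree_sum (fun u b x => (c u b == x)%:R) n f = f c.
Proof.
elim: n c f => [|n IH] c f df; first by rewrite tree_sum0; apply: df.
rewrite tree_sumS.
have e a b : tree_sum (fun u b0 x => (c (true :: u) b0 == x)%:R) n (fun c1 =>
   tree_sum (fun u b0 x => (c (false :: u) b0 == x)%:R) n (fun c2 => f (graft a b c1 c2))) =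
   f (graft a b (child true c) (child false c)).
  rewrite (@eq_tree_sum _ _ _ (fun c1 => f (graft a b c1 (child false c)))); last first.
    by move=> c1; apply: (IH (child false c)); exact: depends_graftr.
  by apply: (IH (child true c)); exact: depends_graftl.
rewrite !big_bool !e -[in RHS](graft_child c).
by case: (c [::] true); case: (c [::] false); rewrite /= ?(mul0r, mul1r, mulr0, mulr1, addr0, add0r).
Qed.

End Wsum.

Section Expectation.
Context {R : realType}.
Variable p : R.
Hypothesis p01 : 0 <= p <= 1.
Implicit Types (f g : labelling -> R).

(** The expectation of f under independent labels with law (p, 1 - p), for
    functions f that depend on the first n levels only. *)
Definition mean n f : R := tree_sum (fun _ _ => lprob p) n f.

Lemma lprob_ge0 b : 0 <= lprob p b.
Proof. by have := p01; case: b => /=; lra. Qed.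

Lemma meanS n f : mean n.+1 f = \sum_(a : bool) \sum_(b : bool) lprob p a * lprob p b *
    mean n (fun c1 => mean n (fun c2 => f (graft a b c1 c2))).
Proof. exact: tree_sumS. Qed.

Lemma eq_mean n f g : (forall c, f c = g c) -> mean n f = mean n g.
Proof. exact: eq_tree_sum. Qed.

Lemma mean_le n f g : (forall c, f c <= g c) -> mean n f <= mean n g.
Proof. by apply: tree_sum_le => _ _; exact: lprob_ge0. Qed.

Lemma mean_cst n x : mean n (fun=> x) = x.
Proof.
elim: n => [|n IH]; first by rewrite /mean tree_sum0.
rewrite meanS !big_bool/=.
have e : mean n (fun=> mean n (fun=> x)) = x by rewrite -[RHS]IH; apply: eq_mean => _.
by rewrite !e; ring.
Qed.

Lemma meanD n f g : mean n (fun c => f c + g c) = mean n f + mean n g.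
Proof. exact: tree_sumD. Qed.

Lemma meanZ n x f : mean n (fun c => x * f c) = x * mean n f.
Proof. exact: tree_sumZ. Qed.

Lemma mean_ge0 n f : (forall c, 0 <= f c) -> 0 <= mean n f.
Proof. by move=> f0; rewrite -[leLHS](mean_cst n 0); apply: mean_le. Qed.

Lemma mean1B n f : mean n (fun c => 1 - f c) = 1 - mean n f.
Proof.
rewrite (@eq_mean _ _ (fun c => 1 + (-1) * f c)); last by move=> c; ring.
by rewrite /mean tree_sumD tree_sumZ -/(mean n (fun=> 1)) mean_cst /mean; ring.
Qed.

Lemma mean_prod n f g : mean n (fun c1 => mean n (fun c2 => f c1 * g c2)) = mean n f * mean n g.
Proof.
rewrite (@eq_mean _ _ (fun c1 => f c1 * mean n g)) => [|c1]; first exact: tree_sumZr.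
exact: tree_sumZ.
Qed.

Lemma mean_depends n m f : depends_upto n f -> mean (n + m) f = mean n f.
Proof.
elim: n f => [|n IH] f df.
  rewrite /mean tree_sum0 -/(mean _ _) -[RHS](mean_cst m); apply: eq_mean => c; exact: df.
rewrite addSn !meanS; do 2 (apply: eq_bigr => ? _); congr (_ * _).
rewrite IH => [|c c' e]; last by apply: eq_mean => c2; apply: depends_graftl e.
by apply: eq_mean => c1; apply: IH; exact: depends_graftr.
Qed.

(** The labels of the subtree at a vertex of level n are independent of those above
    it. *)
Lemma mean_subtree n m f v x : size x = n -> depends_upto n f ->
  mean (n + m) (fun c => f c * v (subtree x c)) = mean n f * mean m v.
Proof.
elim: n f x => [|n IH] f x.
  move/size0nil => -> df; rewrite {2}/mean tree_sum0 /= add0n.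
  by rewrite -[RHS]tree_sumZ; apply: eq_mean => c; congr (_ * _); exact: df.
case: x => [//|b x] [sx] df; rewrite addSn !meanS !mulr_suml; apply: eq_bigr => a _.
rewrite !mulr_suml; apply: eq_bigr => a' _; rewrite -!mulrA; congr (_ * (_ * _)).
case: b.
  transitivity (mean (n + m) (fun c1 => mean n (fun c2 => f (graft a a' c1 c2)) * v (subtree x c1))).
    apply: eq_mean => c1; rewrite -(@mean_depends n m); last exact: depends_graftr.
    by rewrite -tree_sumZr.
  by apply: IH => // c c' e; apply: eq_mean => c2; apply: depends_graftl e.
transitivity (mean (n + m) (fun c1 => mean n (fun c2 => f (graft a a' c1 c2)) * mean m v)).
  by apply: eq_mean => c1; apply: IH => //; exact: depends_graftr.
rewrite /mean tree_sumZr -!/(mean _ _); congr (_ * _); apply: mean_depends => c c' e.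
by apply: eq_mean => c2; apply: depends_graftl e.
Qed.

(** The labels of the subtrees at two vertices of level n and those above level n
    form three independent families. *)
Lemma mean_subtree2 n m f v v' x x' : size x = n -> size x' = n -> x != x' -> depends_upto n f ->
  mean (n + m) (fun c => f c * v (subtree x c) * v' (subtree x' c)) = mean n f * mean m v * mean m v'.
Proof.
elim: n f v v' x x' => [|n IH] f v v' x x'; first by move=> /size0nil-> /size0nil->; rewrite eqxx.
case: x => [//|b x]; case: x' => [//|b' x'] [sx] [sx'] ne df.
have dl a a' : depends_upto n (fun c1 => mean n (fun c2 => f (graft a a' c1 c2))).
  by move=> c c' e; apply: eq_mean => c2; apply: depends_graftl e.
rewrite addSn !meanS !mulr_suml; apply: eq_bigr => a _.
rewrite !mulr_suml; apply: eq_bigr => a' _; rewrite -!mulrA; congr (_ * (_ * _)).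
case: b b' ne => [] [] ne.
- transitivity (mean (n + m) (fun c1 => mean n (fun c2 => f (graft a a' c1 c2)) *
     v (subtree x c1) * v' (subtree x' c1))).
    apply: eq_mean => c1; rewrite -(@mean_depends n m); last exact: depends_graftr.
    by rewrite -mulrA -tree_sumZr; apply: eq_tree_sum => c2; rewrite !mulrA.
  by rewrite IH// mulrA.
- transitivity (mean (n + m) (fun c1 => (mean n (fun c2 => f (graft a a' c1 c2)) *
     v (subtree x c1)) * mean m v')).
    apply: eq_mean => c1.
    transitivity (mean (n + m) (fun c2 => (f (graft a a' c1 c2) * v' (subtree x' c2)) * v (subtree x c1))).
      by apply: eq_mean => c2; rewrite -!mulrA; congr (_ * _); rewrite mulrC.
    rewrite {1}/mean tree_sumZr -/(mean _ _) mean_subtree//; last exact: depends_graftr.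
    by rewrite mulrAC.
  by rewrite {1}/mean tree_sumZr -/(mean _ _) mean_subtree// mulrA.
- transitivity (mean (n + m) (fun c1 => (mean n (fun c2 => f (graft a a' c1 c2)) *
     v' (subtree x' c1)) * mean m v)).
    apply: eq_mean => c1.
    transitivity (mean (n + m) (fun c2 => (f (graft a a' c1 c2) * v (subtree x c2)) * v' (subtree x' c1))).
      by apply: eq_mean => c2; rewrite -!mulrA.
    rewrite {1}/mean tree_sumZr -/(mean _ _) mean_subtree//; last exact: depends_graftr.
    by rewrite mulrAC.
  by rewrite {1}/mean tree_sumZr -/(mean _ _) mean_subtree//; ring.
- transitivity (mean (n + m) (fun c1 => mean n (fun c2 => f (graft a a' c1 c2)) * (mean m v * mean m v'))).
    apply: eq_mean => c1; rewrite mulrA -(IH _ v v' x x')//; exact: depends_graftr.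
  by rewrite {1}/mean tree_sumZr -/(mean _ _) (@mean_depends n m)//.
Qed.

End Expectation.

Fixpoint path_word (c : labelling) (x : seq bool) : seq bool :=
  if x is b :: x' then c [::] b :: path_word (child b c) x' else [::].

Definition occurs c w := has (fun x => path_word c x == w) (words (size w)).

Lemma size_path_word c x : size (path_word c x) = size x.
Proof. by elim: x c => //= b x IH c; rewrite IH. Qed.

Lemma path_word_cat c x y : path_word c (x ++ y) = path_word c x ++ path_word (subtree x c) y.
Proof. by elim: x c => //= b x IH c; rewrite IH. Qed.

Lemma depends_path_word x : depends_upto (size x) (fun c => path_word c x).
Proof.
elim: x => //= b x IH c c' e; congr (_ :: _); first exact: e.
by apply: IH => u y h; apply: e.
Qed.

Lemma depends_occurs w : depends_upto (size w) (fun c => occurs c w).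
Proof.
move=> c c' e; apply: eq_in_has => x; rewrite mem_words => /eqP sx.
by rewrite (@depends_path_word x c c')// sx.
Qed.

Lemma occursP c w : reflect (exists x, path_word c x = w) (occurs c w).
Proof.
apply: (iffP hasP) => [[x _ /eqP]|[x <-]]; first by exists x.
by exists x; rewrite // mem_words size_path_word.
Qed.

Lemma occurs_nil c : occurs c [::]. Proof. by apply/occursP; exists [::]. Qed.

Lemma occurs_cons c a w : occurs c (a :: w) =
  (c [::] true == a) && occurs (child true c) w || (c [::] false == a) && occurs (child false c) w.
Proof.
apply/occursP/orP => [[[|b x]//= [<- <-]]|].
  by case: b; [left|right]; rewrite eqxx; apply/occursP; exists x.
by case=> /andP[/eqP <- /occursP[x <-]]; [exists (true :: x)|exists (false :: x)].
Qed.

Section WordProbability.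
Context {R : realType}.
Variable p : R.
Hypothesis p01 : 0 <= p <= 1.

Definition occ_prob w : R := mean p (size w) (fun c => (occurs c w)%:R).

Lemma occ_prob_nil : occ_prob [::] = 1.
Proof. by rewrite /occ_prob /mean tree_sum0 occurs_nil. Qed.

(** The word a :: w fails to occur when it fails through both children of the root,
    which are independent. *)
Lemma occ_prob_cons a w : occ_prob (a :: w) = 1 - (1 - lprob p a * occ_prob w) ^+ 2.
Proof.
have e x y : mean p (size w) (fun c1 => mean p (size w)
    (fun c2 => (occurs (graft x y c1 c2) (a :: w))%:R)) =
   1 - (1 - (x == a)%:R * occ_prob w) * (1 - (y == a)%:R * occ_prob w).
  pose A (z : bool) c : R := (z == a)%:R * (occurs c w)%:R.
  have EA z : mean p (size w) (A z) = (z == a)%:R * occ_prob w by exact: tree_sumZ.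
  transitivity (1 - mean p (size w) (fun c => 1 - A x c) * mean p (size w) (fun c => 1 - A y c)); last first.
    by rewrite !mean1B !EA.
  rewrite -mean_prod -mean1B.
  apply: eq_mean => c1; rewrite -mean1B; apply: eq_mean => c2; rewrite occurs_cons /A /=.
  rewrite -!/(child _ _).
  have -> : child true (graft x y c1 c2) = c1 by [].
  have -> : child false (graft x y c1 c2) = c2 by [].
  by case: (x == a); case: (y == a); case: (occurs c1 w); case: (occurs c2 w) => /=; ring.
rewrite [LHS]/occ_prob meanS !big_bool !e /=; case: (a) => /=; ring.
Qed.

Lemma occ_prob_ge0 w : 0 <= occ_prob w.
Proof. by apply: mean_ge0. Qed.

Lemma occ_prob_le1 w : occ_prob w <= 1.
Proof. by rewrite -[leRHS](mean_cst p (size w)); apply: mean_le => // c; case: occurs. Qed.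

End WordProbability.

(** * Words and their types *)

Section RealEstimates.
Context {R : realType}.
Implicit Types x y : R.

Lemma expR_le_quadratic y : - 2^-1 <= y <= 2^-1 -> expR y <= 1 + y + 2 * y ^+ 2.
Proof.
move=> /andP[y1 y2]; have h : expR y * (1 - y) <= 1.
  rewrite -[leRHS](expRxMexpNx_1 y) ler_pM2l ?expR_gt0//.
  by have := expR_ge1Dx (- y); lra.
have h2 : 1 <= (1 + y + 2 * y ^+ 2) * (1 - y).
  have -> : (1 + y + 2 * y ^+ 2) * (1 - y) = 1 + y ^+ 2 * (1 - 2 * y) by ring.
  by rewrite lerDl mulr_ge0 ?sqr_ge0//; lra.
by rewrite -(@ler_pM2r _ (1 - y)); [exact: le_trans h h2|lra].
Qed.

(** Chernoff's argument: for a variable x of nonpositive mean, the mean of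
    expR (t x) is 1 + O(t^2) or less, hence below expR (t e) for small t. *)
Lemma small_exponent (b1 b2 x1 x2 e : R) : 0 <= b1 -> 0 <= b2 -> b1 + b2 = 1 ->
  b1 * x1 + b2 * x2 <= 0 -> 0 < e ->
  exists2 t, 0 < t <= 1 & b1 * expR (t * x1) + b2 * expR (t * x2) <= expR (t * e).
Proof.
move=> b10 b20 b12 hx e0.
pose X := 1 + `|x1| + `|x2|.
have X1 : 1 <= X by rewrite /X -addrA lerDl addr_ge0.
have n1 := normr_ge0 x1; have n2 := normr_ge0 x2.
have hX1 : - X <= x1 <= X by rewrite -ler_norml /X; lra.
have hX2 : - X <= x2 <= X by rewrite -ler_norml /X; lra.
pose m := Num.min 1 e.
have m0 : 0 < m by rewrite lt_min ltr01.
have m1 : m <= 1 by rewrite ge_min lexx.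
have me : m <= e by rewrite ge_min lexx orbT.
(* For |x| <= X this t makes the quadratic error 2 (t x)^2 at most t e. *)
pose t := m / (2 * X ^+ 2).
have XX : 1 <= X ^+ 2 by rewrite expr2; nra.
have d0 : 0 < 2 * X ^+ 2 by lra.
have t0 : 0 < t by rewrite divr_gt0.
have tX2 : t * (2 * X ^+ 2) = m by rewrite /t divfK// gt_eqF.
have tX : t * X <= 2^-1 by rewrite expr2 in tX2; nra.
exists t; first by rewrite t0 /=; nra.
clearbody t X m.
have q x : - X <= x <= X -> expR (t * x) <= 1 + t * x + t * m.
  move=> /andP[h1 h2].
  have h3 : - X * t <= x * t by rewrite ler_pM2r.
  have h4 : x * t <= X * t by rewrite ler_pM2r.
  apply: le_trans (expR_le_quadratic (_ : - 2^-1 <= t * x <= 2^-1)) _; first by lra.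
  have : x ^+ 2 <= X ^+ 2 by rewrite !expr2; nra.
  move=> h5; rewrite lerD2l exprMn.
  have : t ^+ 2 * x ^+ 2 <= t ^+ 2 * X ^+ 2 by rewrite ler_wpM2l ?sqr_ge0.
  have -> : t * m = 2 * (t ^+ 2 * X ^+ 2) by rewrite -tX2; ring.
  by lra.
have q1 := q _ hX1; have q2 := q _ hX2.
apply: le_trans (expR_ge1Dx _).
have : b1 * expR (t * x1) <= b1 * (1 + t * x1 + t * m) by rewrite ler_wpM2l.
have : b2 * expR (t * x2) <= b2 * (1 + t * x2 + t * m) by rewrite ler_wpM2l.
have : t * m <= t * e by rewrite ler_pM2l.
have : t * (b1 * x1 + b2 * x2) <= 0 by rewrite pmulr_rle0.
have : b1 * (t * m) + b2 * (t * m) = t * m by rewrite -mulrDl b12 mul1r.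
lra.
Qed.

Lemma exp_beats_linear (C k : R) : 0 < C -> 0 < k ->
  exists n0, forall n, (n0 <= n)%N -> C * n.+1%:R <= expR (k * n%:R).
Proof.
move=> C0 k0; pose B := 4 * C / k ^+ 2; exists (Num.truncn B).+2 => n hn.
have nB : B <= n%:R.
  by apply: ltW; apply: lt_le_trans (truncnS_gt B) _; rewrite ler_nat ltnW.
have n1 : 1 <= n%:R :> R by rewrite ler1n; apply: leq_trans hn.
have nE : n.+1%:R = n%:R + 1 :> R by rewrite -natr1.
have k2 : 0 < k ^+ 2 by rewrite exprn_gt0.
have hB : 4 * C <= k ^+ 2 * n%:R by rewrite [leRHS]mulrC -ler_pdivrMr.
have kn0 : 0 <= k * n%:R by rewrite mulr_ge0// ltW.
have := @expR_ge1Dxn R (k * n%:R) 1 kn0; rewrite (_ : 2`! = 2)%N// => h; apply: le_trans h; rewrite nE exprMn.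
have : 4 * C * n%:R <= k ^+ 2 * n%:R * n%:R by rewrite ler_wpM2r.
rewrite [n%:R ^+ 2]expr2 mulrA; nra.
Qed.

Lemma powR_subadd (x y t : R) : 0 <= x -> 0 <= y -> 0 < x + y -> t <= 1 ->
  (x + y) `^ t <= x `^ t + y `^ t.
Proof.
move=> x0 y0 xy t1.
have key z : 0 <= z -> z <= x + y -> z / (x + y) * (x + y) `^ t <= z `^ t.
  rewrite le_eqVlt => /orP[/eqP<- _|z0 zxy]; first by rewrite !mul0r powR_ge0.
  have q0 : 0 < z / (x + y) by rewrite divr_gt0.
  have q1 : 0 < z / (x + y) <= 1 by rewrite q0 ler_pdivrMr// mul1r.
  rewrite -[in leRHS](divfK (lt0r_neq0 xy) z) powRM ?(ltW q0) ?(ltW xy)//.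
  by rewrite ler_wpM2r ?powR_ge0//; exact: ger1_powR.
have := lerD (key x x0 _) (key y y0 _); rewrite lerDl lerDr => /(_ y0 x0).
by rewrite -!mulrDl divff ?gt_eqF// mul1r.
Qed.

End RealEstimates.

Section WordSums.
Context {R : realType}.
Implicit Types (g : bool -> R) (w : seq bool).

Definition word_weight g w : R := \prod_(a <- w) g a.

Lemma word_weight_cons g a w : word_weight g (a :: w) = g a * word_weight g w.
Proof. by rewrite /word_weight big_cons. Qed.

Lemma word_weight_nil g : word_weight g [::] = 1.
Proof. by rewrite /word_weight big_nil. Qed.

Lemma word_weight_cat g v w : word_weight g (v ++ w) = word_weight g v * word_weight g w.
Proof. by rewrite /word_weight big_cat. Qed.

Lemma word_weight_ge0 g w : (forall a, 0 <= g a) -> 0 <= word_weight g w.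
Proof. by move=> g0; apply: prodr_ge0. Qed.

Lemma word_weight_gt0 g w : (forall a, 0 < g a) -> 0 < word_weight g w.
Proof. by move=> g0; apply: prodr_gt0. Qed.

Lemma word_weight_mul g h w : word_weight (fun a => g a * h a) w = word_weight g w * word_weight h w.
Proof. exact: big_split. Qed.

Lemma word_weight_powR g t w : (forall a, 0 <= g a) -> word_weight (fun a => g a `^ t) w = word_weight g w `^ t.
Proof.
move=> g0; elim: w => [|a w IH]; first by rewrite !word_weight_nil powR1.
by rewrite !word_weight_cons IH powRM// word_weight_ge0.
Qed.

Lemma eq_word_weight g h w : (forall a, g a = h a) -> word_weight g w = word_weight h w.
Proof. by move=> e; apply: eq_bigr. Qed.

Lemma sum_wordsS n (F : seq bool -> R) : \sum_(w <- words n.+1) F w =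
  \sum_(w <- words n) F (true :: w) + \sum_(w <- words n) F (false :: w).
Proof. by rewrite [words n.+1]/= !big_cat big_nil !big_map /= addr0. Qed.

Lemma sum_word_weight g n : \sum_(w <- words n) word_weight g w = (g true + g false) ^+ n.
Proof.
elim: n => [|n IH]; first by rewrite big_seq1 word_weight_nil expr0.
rewrite sum_wordsS; under eq_bigr do rewrite word_weight_cons.
under [X in _ + X]eq_bigr do rewrite word_weight_cons.
by rewrite -!mulr_sumr IH -mulrDl exprS.
Qed.

(** The common value of word_weight on the words of length n in which the label 1
    occurs k times. *)
Definition type_weight g n k : R := g true ^+ k * g false ^+ (n - k).

Lemma word_weight_type g w : word_weight g w = type_weight g (size w) (count_mem true w).
Proof.
elim: w => [|a w IH]; first by rewrite word_weight_nil /type_weight /= !expr0 mulr1.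
rewrite word_weight_cons IH /type_weight /=; have h := count_size (pred1 true) w.
by case: a => /=; rewrite ?add1n ?add0n ?subSS ?(subSn h) !exprS; ring.
Qed.

Lemma type_weight_gt0 g n k : (forall a, 0 < g a) -> 0 < type_weight g n k.
Proof. by move=> g0; rewrite /type_weight mulr_gt0 ?exprn_gt0. Qed.

Lemma sum_by_type n (F : seq bool -> R) :
  \sum_(w <- words n) F w = \sum_(k < n.+1) \sum_(w <- words n | count_mem true w == k) F w.
Proof.
rewrite (exchange_big_dep xpredT)//= big_seq [RHS]big_seq; apply: eq_bigr => w.
rewrite mem_words => /eqP sw.
have h : (count_mem true w < n.+1)%N by rewrite ltnS -sw count_size.
by rewrite (bigD1 (Ordinal h))//= big1 ?addr0// => i /andP[/eqP e]; rewrite -val_eqE /= e eqxx.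
Qed.

(** There are only n + 1 types of words of length n, so that restricting a sum to
    its best type costs a polynomial factor. *)
Lemma exists_big_type n (F : seq bool -> R) (x : R) :
  x <= \sum_(w <- words n) F w ->
  exists2 k, (k <= n)%N & x / n.+1%:R <= \sum_(w <- words n | count_mem true w == k) F w.
Proof.
rewrite sum_by_type => hx.
have [/existsP[k hk]|/existsPn h] := boolP [exists k : 'I_n.+1,
    x / n.+1%:R <= \sum_(w <- words n | count_mem true w == k) F w].
  by exists k => //; rewrite -ltnS.
have : \sum_(k < n.+1) \sum_(w <- words n | count_mem true w == k) F w <
   \sum_(k < n.+1) x / n.+1%:R.
  apply: ltr_sum => [|k _]; first by apply/hasP; exists ord0; rewrite ?mem_index_enum.
  by have := h k; rewrite -ltNge.
have -> : \sum_(k < n.+1) x / n.+1%:R = x.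
  by rewrite sumr_const card_ord -[LHS]mulr_natr divfK ?pnatr_eq0.
by move=> /(le_lt_trans hx); rewrite ltxx.
Qed.

End WordSums.

(** * Occurrence of typical words *)

Section Growth.
Context {R : realType}.
Variables r1 r2 p : R.
Hypotheses (r1_gt0 : 0 < r1) (r1_lt_r2 : r1 < r2) (r2_lt1 : r2 < 1).
Hypothesis p01 : 0 < p < 1.

Let p01w : 0 <= p <= 1. Proof. by case/andP: p01 => h1 h2; rewrite !ltW. Qed.

Lemma lprob_gt0 b : 0 < lprob p b.
Proof. by have := p01; case: b => /=; lra. Qed.

Lemma lprob_lt1 b : lprob p b < 1.
Proof. by have := p01; case: b => /=; lra. Qed.

Lemma lratio_gt0 b : 0 < lratio r1 r2 b.
Proof. by case: b => //=; apply: lt_trans r1_lt_r2. Qed.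

Lemma lratio_lt1 b : lratio r1 r2 b < 1.
Proof. by case: b => //=; apply: lt_trans r2_lt1. Qed.

Lemma occ_prob_gt0 w : 0 < occ_prob p w.
Proof.
elim: w => [|a w IH]; first by rewrite occ_prob_nil.
rewrite occ_prob_cons//.
have h1 := lprob_gt0 a; have h2 := lprob_lt1 a; have h3 := occ_prob_le1 p01w w.
have : 0 < lprob p a * occ_prob p w by rewrite mulr_gt0.
have : lprob p a * occ_prob p w < 1 by nra.
move: (lprob p a * occ_prob p w) => x; rewrite expr2; nra.
Qed.

(** With x = p_a occ_prob(w) the recursion gives 1 / (x (2 - x)), which is at most
    1 / (2x) + 1/2. *)
Lemma occ_prob_cons_inv a w : (occ_prob p (a :: w))^-1 <= (2 * lprob p a)^-1 * (occ_prob p w)^-1 + 2^-1.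
Proof.
rewrite occ_prob_cons// -invfM -mulrA.
have h1 := lprob_gt0 a; have h2 := lprob_lt1 a; have h3 := occ_prob_le1 p01w w.
have h4 := occ_prob_gt0 w.
have : 0 < lprob p a * occ_prob p w by rewrite mulr_gt0.
have : lprob p a * occ_prob p w < 1 by nra.
move: (lprob p a * occ_prob p w) => x x1 x0.
have -> : 1 - (1 - x) ^+ 2 = x * (2 - x) by ring.
have d : 0 < 2 - x by lra.
have -> : (2 * x)^-1 + 2^-1 = (1 + x) / (2 * x) by field; rewrite gt_eqF.
rewrite invfM ler_pdivlMr ?mulr_gt0//.
have -> : x^-1 * (2 - x)^-1 * (2 * x) = 2 / (2 - x) by field; rewrite !gt_eqF.
rewrite ler_pdivrMr//; nra.
Qed.

Lemma mean_occurs n (P : pred (seq bool)) (F : seq bool -> R) :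
  mean p n (fun c => \sum_(w <- words n | P w) F w * (occurs c w)%:R) =
  \sum_(w <- words n | P w) F w * occ_prob p w.
Proof.
rewrite /mean tree_sum_sum big_seq_cond [RHS]big_seq_cond; apply: eq_bigr => w.
by rewrite mem_words => /andP[/eqP sw _]; rewrite tree_sumZ /occ_prob sw.
Qed.

Definition type_count n k c : R := \sum_(w <- words n | count_mem true w == k) (occurs c w)%:R.

Lemma mean_type_count (g : bool -> R) n k :
  mean p n (fun c => type_weight g n k * type_count n k c) =
  \sum_(w <- words n | count_mem true w == k) word_weight g w * occ_prob p w.
Proof.
rewrite -mean_occurs; apply: eq_mean => c; rewrite mulr_sumr big_seq_cond [RHS]big_seq_cond.
by apply: eq_bigr => w; rewrite mem_words => /andP[/eqP sw /eqP ck]; rewrite word_weight_type sw ck.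
Qed.

(** Up to factors subexponential in n, the words of some type k that occur number at
    least rho^(-s), where rho is their common contraction ratio, with a probability
    that is not exponentially small. The type may depend on n. *)
Definition growth s := forall e : R, 0 < e -> exists n0, forall n, (n0 <= n)%N ->
  exists (k : nat) (m : R), [/\ (k <= n)%N,
    expR (- e * n%:R) <= m * type_weight (fun a => lratio r1 r2 a `^ s) n k &
    expR (- e * n%:R) <= mean p n (fun c => (m <= type_count n k c)%R%:R)].

Section Tilt.
Variables b g : bool -> R.
Hypotheses (b_gt0 : forall a, 0 < b a) (g_gt0 : forall a, 0 < g a).

(** Random words with independent letters of law b: by occ_prob_cons_inv and
    subadditivity of x |-> x^t, each further letter multiplies the mean of
    (g(w) / occ_prob(w))^t by at most C and adds at most the mean of g(w)^t. *)
Lemma tilt_occ_prob t n (C : R) : 0 < t <= 1 ->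
  b true * (g true / (2 * lprob p true)) `^ t + b false * (g false / (2 * lprob p false)) `^ t <= C ->
  b true * g true `^ t + b false * g false `^ t <= C ->
  \sum_(w <- words n) word_weight b w * (word_weight g w / occ_prob p w) `^ t <= n.+1%:R * C ^+ n.
Proof.
move=> /andP[t0 t1] hC1 hC2.
have b0 a : 0 <= b a := ltW (b_gt0 a).
have C0 : 0 <= C by apply: le_trans hC2; rewrite addr_ge0 ?mulr_ge0 ?powR_ge0.
elim: n => [|n IH].
  by rewrite big_seq1 !word_weight_nil occ_prob_nil// divr1 powR1 expr0 !mulr1.
have step a w : word_weight b (a :: w) * (word_weight g (a :: w) / occ_prob p (a :: w)) `^ t <=
   b a * (g a / (2 * lprob p a)) `^ t * (word_weight b w * (word_weight g w / occ_prob p w) `^ t) +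
   b a * g a `^ t * (word_weight b w * word_weight g w `^ t).
  have l0 := lprob_gt0 a; have f0 := occ_prob_gt0 w; have bw := word_weight_ge0 w b0.
  have gw := word_weight_gt0 w g_gt0; have ga := g_gt0 a.
  have l20 : 0 < 2 * lprob p a by rewrite mulr_gt0.
  set X := g a / (2 * lprob p a); set Y := word_weight g w / occ_prob p w.
  have X0 : 0 < X by rewrite divr_gt0.
  have Y0 : 0 < Y by rewrite divr_gt0.
  have -> : b a * X `^ t * (word_weight b w * Y `^ t) + b a * g a `^ t * (word_weight b w * word_weight g w `^ t)
     = b a * word_weight b w * ((X * Y) `^ t + (g a * word_weight g w) `^ t).
    by rewrite (powRM _ (ltW X0) (ltW Y0)) (powRM _ (ltW ga) (ltW gw)); ring.
  rewrite !word_weight_cons ler_wpM2l ?mulr_ge0//.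
  have G0 : 0 < g a * word_weight g w by rewrite mulr_gt0.
  have XY0 : 0 < X * Y by rewrite mulr_gt0.
  apply: (@le_trans _ _ ((X * Y + g a * word_weight g w) `^ t)); last first.
    by apply: powR_subadd; rewrite ?(ltW XY0) ?(ltW G0) ?addr_gt0.
  apply: ge0_ler_powR; rewrite ?(ltW t0)// ?nnegrE.
  - by rewrite divr_ge0 ?(ltW G0) ?(ltW (occ_prob_gt0 _)).
  - by rewrite addr_ge0 ?(ltW XY0) ?(ltW G0).
  apply: (@le_trans _ _ (g a * word_weight g w * ((2 * lprob p a)^-1 / occ_prob p w + 2^-1))).
    by rewrite ler_pM2l// occ_prob_cons_inv.
  rewrite mulrDr lerD//; last by rewrite ler_piMr ?(ltW G0)//; lra.
  by rewrite le_eqVlt; apply/orP; left; apply/eqP; rewrite /X /Y; field; rewrite !gt_eqF.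
rewrite sum_wordsS.
set S := \sum_(w <- words n) _ in IH; pose T := \sum_(w <- words n) word_weight b w * word_weight g w `^ t.
have part a : \sum_(w <- words n) word_weight b (a :: w) * (word_weight g (a :: w) / occ_prob p (a :: w)) `^ t <=
  b a * (g a / (2 * lprob p a)) `^ t * S + b a * g a `^ t * T.
  apply: le_trans (ler_sum _ (fun w _ => step a w)) _.
  by rewrite big_split/= -!mulr_sumr.
apply: le_trans (lerD (part true) (part false)) _.
have TE : T = (b true * g true `^ t + b false * g false `^ t) ^+ n.
  rewrite -(sum_word_weight (fun a => b a * g a `^ t)); apply: eq_bigr => w _.
  by rewrite word_weight_mul word_weight_powR// => a; exact: ltW.
have TC : T <= C ^+ n.
  by rewrite TE; apply: lerXn2r => //; rewrite nnegrE// addr_ge0 ?mulr_ge0 ?powR_ge0.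
have T0 : 0 <= T by rewrite TE exprn_ge0// addr_ge0 ?mulr_ge0 ?powR_ge0.
have S0 : 0 <= S by apply: sumr_ge0 => w _; rewrite mulr_ge0 ?powR_ge0 ?word_weight_ge0.
have h1 := le_trans (ler_wpM2r S0 hC1) (ler_wpM2l C0 IH).
have h2 := le_trans (ler_wpM2r T0 hC2) (ler_wpM2l C0 TC).
have -> : n.+2%:R * C ^+ n.+1 = C * (n.+1%:R * C ^+ n) + C * C ^+ n.
  by rewrite -natr1 exprS; ring.
move: h1 h2; rewrite !mulrDl; lra.
Qed.

End Tilt.


(** A union bound: f is meant to be the indicator of the good words, g and h are
    Markov bounds for the indicators of the bad ones. *)
Lemma sum_le_indic (I : eqType) (s : seq I) (b f g h : I -> R) : (forall i, 0 <= b i) ->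
  (forall i, 0 <= g i) -> (forall i, 0 <= h i) ->
  (forall i, i \in s -> 1 <= f i + g i + h i) ->
  \sum_(i <- s) b i <= \sum_(i <- s) b i * f i + \sum_(i <- s) b i * g i + \sum_(i <- s) b i * h i.
Proof.
move=> b0 g0 h0 H; rewrite -!big_split/= big_seq [leRHS]big_seq; apply: ler_sum => i /H h1.
by rewrite -!mulrDr -[leLHS]mulr1 ler_wpM2l.
Qed.

Lemma powR_ge1 (x t : R) : 1 <= x -> 0 <= t -> 1 <= x `^ t.
Proof.
move=> x1 t0; have <- : 1 `^ t = 1 :> R by rewrite powR1.
by apply: ge0_ler_powR; rewrite ?nnegrE//; lra.
Qed.

Lemma powR_exp_mulrn (k t : R) n : expR (k * n%:R) `^ t = expR (t * k) ^+ n.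
Proof. by rewrite -expRM -expRM_natr; congr expR; ring. Qed.

(** Cramer's bound: as the relative entropy condition makes ln (b_a / g_a) a variable
    of negative mean under b, words with b(w) > g(w) are exponentially rare. *)
Lemma atypical_mass (b g : bool -> R) : (forall a, 0 < b a) -> (forall a, 0 < g a) ->
  b true + b false = 1 ->
  b true * ln (b true) + b false * ln (b false) < b true * ln (g true) + b false * ln (g false) ->
  exists t k, [/\ 0 < t, 0 < k & forall n,
    \sum_(w <- words n) word_weight b w * (word_weight b w / word_weight g w) `^ t <= expR (- k * n%:R)].
Proof.
move=> b0 g0 b1 ent; have bt := b0 true; have bf := b0 false.
have : exists2 k, 0 < k & b true * (ln (b true / g true) + k) + b false * (ln (b false / g false) + k) <= 0.
  exists (b true * ln (g true) + b false * ln (g false) - (b true * ln (b true) + b false * ln (b false))).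
    by rewrite subr_gt0.
  rewrite !ln_div ?posrE//.
  move: (ln (b true)) (ln (b false)) (ln (g true)) (ln (g false)) b1 => x y z w b1.
  by have -> : b false = 1 - b true by [lra]; lra.
move=> [k k0 yk]; have k20 : 0 < k / 2 by lra.
have [t /andP[t0 t1] ht] := small_exponent (ltW bt) (ltW bf) b1 yk k20.
exists t, (t * k / 2); split => // [|n]; first by rewrite divr_gt0 ?mulr_gt0.
have -> : \sum_(w <- words n) word_weight b w * (word_weight b w / word_weight g w) `^ t =
   (b true * (b true / g true) `^ t + b false * (b false / g false) `^ t) ^+ n.
  rewrite -(sum_word_weight (fun a => b a * (b a / g a) `^ t)); apply: eq_bigr => w _.
  rewrite word_weight_mul word_weight_powR => [|a]; last by rewrite divr_ge0 ?ltW.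
  congr (_ * _ `^ t); rewrite word_weight_mul; congr (_ * _).
  apply: (mulIf (lt0r_neq0 (word_weight_gt0 w g0))); rewrite mulVf ?lt0r_neq0 ?word_weight_gt0// -word_weight_mul.
  by rewrite /word_weight big1// => a _; rewrite mulVf ?lt0r_neq0.
rewrite expRM_natr; apply: lerXn2r; rewrite ?nnegrE ?expR_ge0//.
  by rewrite addr_ge0 ?mulr_ge0 ?powR_ge0 ?ltW.
have e1 a : (b a / g a) `^ t = expR (t * (ln (b a / g a) + k)) * expR (- (t * k)).
  by rewrite powR_expR ?divr_gt0// -expRD; congr expR; ring.
rewrite !e1 !mulrA -mulrDl; apply: (@le_trans _ _ (expR (t * (k / 2)) * expR (- (t * k)))).
  by rewrite ler_wpM2r ?expR_ge0.
by rewrite -expRD ler_expR; lra.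
Qed.

(** Under the law b, words typically satisfy b(w) <= r(w)^s, and by the nonnegative
    drift their occurrence probability is not exponentially small. Hence the b-mass
    of the occurring words of the best type has a mean that is not exponentially
    small, and as it never exceeds 1 it is large with a comparable probability.
    Then about beta^(-1) words occur, where beta <= r^s is their common b-mass. *)
Lemma growth_of_ge0_drift (b : bool -> R) s : (forall a, 0 < b a) -> b true + b false = 1 ->
  0 <= b true * ln (2 * p) + b false * ln (2 * (1 - p)) ->
  b true * ln (b true) + b false * ln (b false) < s * (b true * ln r1 + b false * ln r2) ->
  growth s.
Proof.
move=> b0 b1 drift ent e e0; pose e' := e / 3.
have e'0 : 0 < e' by rewrite divr_gt0.
have bt := b0 true; have bf := b0 false.
have l20 a : 0 < 2 * lprob p a by rewrite mulr_gt0 ?lprob_gt0.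
(* th serves for Markov's inequality on 1 / occ_prob. *)
have [th /andP[th0 th1] hth] := @small_exponent R (b true) (b false)
  (- ln (2 * p)) (- ln (2 * (1 - p))) e' (ltW bt) (ltW bf) b1 ltac:(lra) e'0.
have hphi n : \sum_(w <- words n) word_weight b w * (occ_prob p w)^-1 `^ th <= n.+1%:R * expR (th * e') ^+ n.
  have E w : (occ_prob p w)^-1 = word_weight (fun=> 1) w / occ_prob p w.
    by rewrite [word_weight _ w]big1// mul1r.
  under eq_bigr do rewrite E.
  apply: tilt_occ_prob => //; first by rewrite th0.
    rewrite !powR_expR ?divr_gt0 ?l20// !ln_div ?posrE ?l20// ln1 !add0r.
    exact: hth.
  by rewrite !powR1 !mulr1 b1 -[leLHS]expR0 ler_expR mulr_ge0 ?ltW.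
pose g a := lratio r1 r2 a `^ s.
have g0 a : 0 < g a by rewrite powR_gt0 ?lratio_gt0.
have [t [k [t0 k0 hbad]]] : exists t k, [/\ 0 < t, 0 < k & forall n,
    \sum_(w <- words n) word_weight b w * (word_weight b w / word_weight g w) `^ t <= expR (- k * n%:R)].
  by apply: atypical_mass => //; rewrite !ln_powR /=; move: ent; rewrite mulrDr !(mulrCA s).
clear drift ent hth.
have [n1 hn1] := @exp_beats_linear R 4 k ltac:(lra) k0.
have [n2 hn2] := @exp_beats_linear R 4 (th * e') ltac:(lra) ltac:(rewrite mulr_gt0//).
have [n3 hn3] := @exp_beats_linear R 4 e' ltac:(lra) e'0.
exists (maxn n1 (maxn n2 n3)) => n; rewrite !geq_max => /and3P[h1 h2 h3].
have N1 : 1 <= n.+1%:R :> R by rewrite ler1n.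
(* The good words: G w is typicality of the mass, d bounds the probability of
   occurrence from below. *)
pose d := expR (- (2 * e') * n%:R).
have d0 : 0 < d by exact: expR_gt0.
pose G w := word_weight b w <= word_weight g w.
have key : 2^-1 <= \sum_(w <- words n) word_weight b w * (G w && (d <= occ_prob p w))%:R.
  have := @sum_le_indic _ (words n) (word_weight b) (fun w => (G w && (d <= occ_prob p w))%:R)
    (fun w => (word_weight b w / word_weight g w) `^ t) (fun w => (d * (occ_prob p w)^-1) `^ th)
    (fun w => word_weight_ge0 w (fun a => ltW (b0 a))) (fun w => powR_ge0 _ _) (fun w => powR_ge0 _ _).
  rewrite sum_word_weight b1 expr1n => H.
  have H1 : forall i, i \in words n -> 1 <= (G i && (d <= occ_prob p i))%:R + (word_weight b i / word_weight g i) `^ t +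
    (d * (occ_prob p i)^-1) `^ th.
    move=> w _; case hG : (G w) => /=; last first.
      have := @powR_ge1 (word_weight b w / word_weight g w) t; rewrite ler_pdivlMr ?word_weight_gt0// mul1r.
      move: hG; rewrite /G => /negbT; rewrite -ltNge => /ltW -> /(_ isT (ltW t0)).
      by have := powR_ge0 (d * (occ_prob p w)^-1) th; lra.
    case: (leP d (occ_prob p w)) => [_|hd].
      by have := powR_ge0 (d * (occ_prob p w)^-1) th; have := powR_ge0 (word_weight b w / word_weight g w) t; rewrite /=; lra.
    have := @powR_ge1 (d * (occ_prob p w)^-1) th; rewrite ler_pdivlMr ?occ_prob_gt0// mul1r.
    move=> /(_ (ltW hd) (ltW th0)); have := powR_ge0 (word_weight b w / word_weight g w) t; rewrite /=; lra.
  have {H1}H := H H1; have B := hbad n.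
  have B1 : expR (- k * n%:R) <= 4^-1.
    rewrite mulNr expRN lef_pV2 ?posrE ?expR_gt0//; apply: le_trans (hn1 n h1); lra.
  have B2 : \sum_(w <- words n) word_weight b w * (d * (occ_prob p w)^-1) `^ th <= 4^-1.
    have -> : \sum_(w <- words n) word_weight b w * (d * (occ_prob p w)^-1) `^ th =
       d `^ th * \sum_(w <- words n) word_weight b w * (occ_prob p w)^-1 `^ th.
      rewrite mulr_sumr; apply: eq_bigr => w _.
      by rewrite powRM ?(ltW d0) ?invr_ge0 ?(ltW (occ_prob_gt0 w))//; ring.
    apply: (@le_trans _ _ (d `^ th * (n.+1%:R * expR (th * e') ^+ n))).
      by rewrite ler_wpM2l ?powR_ge0.
    rewrite /d powR_exp_mulrn mulrCA -exprMn -expRD -expRM_natl.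
    have -> : n%:R * (th * - (2 * e') + th * e') = - (th * e' * n%:R) by ring.
    rewrite expRN ler_pdivrMr ?expR_gt0//.
    by have := hn2 n h2; lra.
  lra.
have key2 : d / 2 <= \sum_(w <- words n) (word_weight b w * occ_prob p w) * (G w)%:R.
  apply: (@le_trans _ _ (d * \sum_(w <- words n) word_weight b w * (G w && (d <= occ_prob p w))%:R)).
    by rewrite ler_pM2l.
  rewrite mulr_sumr; apply: ler_sum => w _.
  have bw := word_weight_gt0 w b0; have ow := occ_prob_gt0 w.
  case: (G w) => /=; last by rewrite !mulr0.
  case: (leP d (occ_prob p w)) => hd /=; last by rewrite !(mulr0, mulr1) mulr_ge0 ?(ltW bw) ?(ltW ow).
  by rewrite !mulr1 mulrC ler_pM2l.
have [k' k'n] := exists_big_type key2.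
have [hG|hG] := boolP (type_weight b n k' <= type_weight g n k'); last first.
  rewrite big_seq_cond big1 => [|w].
    have : 0 < d / 2 / n.+1%:R by rewrite !divr_gt0//; lra.
    by move=> h /(lt_le_trans h); rewrite ltxx.
  rewrite mem_words => /andP[/eqP sw /eqP ck].
  by rewrite /G !word_weight_type sw ck (negbTE hG) mulr0.
have -> : \sum_(w <- words n | count_mem true w == k') word_weight b w * occ_prob p w * (G w)%:R =
   mean p n (fun c => type_weight b n k' * type_count n k' c).
  rewrite mean_type_count big_seq_cond [RHS]big_seq_cond; apply: eq_bigr => w.
  rewrite mem_words => /andP[/eqP sw /eqP ck].
  by rewrite /G !word_weight_type sw ck hG mulr1.
move=> hE; have tb : 0 < type_weight b n k' by exact: type_weight_gt0.
(* The total mass of occurring words of type k' is at most 1 and has mean at least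
   2x, hence it exceeds x with probability at least x. *)
pose x := d / 4 / n.+1%:R.
have x0 : 0 < x by rewrite !divr_gt0//; lra.
have xe : expR (- e * n%:R) <= x.
  rewrite /x !ler_pdivlMr//.
  have -> : d = expR (- e * n%:R) * expR (e' * n%:R).
    by rewrite /d -expRD; congr expR; rewrite /e'; field.
  by rewrite -mulrA ler_pM2l ?expR_gt0//; have := hn3 n h3; lra.
exists k', (x / type_weight b n k'); split => //.
  apply: le_trans xe _; rewrite -mulrA ler_peMr ?(ltW x0)//.
  by rewrite mulrC ler_pdivlMr// mul1r.
apply: le_trans xe _.
have tc1 c : type_weight b n k' * type_count n k' c <= 1.
  rewrite -[leRHS](expr1n _ n) -b1 -sum_word_weight.
  rewrite /type_count mulr_sumr big_mkcond/= big_seq [leRHS]big_seq; apply: ler_sum => w.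
  rewrite mem_words => /eqP sw; have bw := word_weight_gt0 w b0.
  case: (eqVneq (count_mem true w) k') => [ck|_]; last by rewrite (ltW bw).
  by rewrite word_weight_type sw ck; case: occurs; rewrite ?mulr1// mulr0 ltW.
have hxx : d / 2 / n.+1%:R = x + x by rewrite /x; field; rewrite gt_eqF//; lra.
have h : mean p n (fun c => type_weight b n k' * type_count n k' c) <=
   mean p n (fun c => (x / type_weight b n k' <= type_count n k' c)%R%:R + x).
  apply: mean_le => // c; case: (leP (x / type_weight b n k') (type_count n k' c)) => h /=.
    by have := tc1 c; rewrite /=; lra.
  by rewrite add0r; move: h; rewrite ltr_pdivlMr// mulrC => /ltW.
by have := le_trans hE h; rewrite hxx meanD mean_cst; lra.
Qed.

(** As each word is counted as often as it is carried by a vertex of level n, this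
    is a branching random walk, for which first and second moments obey recursions. *)
Fixpoint vertex_sum (g : bool -> R) n (c : labelling) : R :=
  if n is n'.+1 then g (c [::] true) * vertex_sum g n' (child true c) +
                     g (c [::] false) * vertex_sum g n' (child false c) else 1.

Lemma word_sum_le_vertex_sum g n c : (forall a, 0 <= g a) ->
  \sum_(w <- words n) word_weight g w * (occurs c w)%:R <= vertex_sum g n c.
Proof.
move=> g0; elim: n c => [|n IH] c; first by rewrite big_seq1 word_weight_nil occurs_nil mulr1.
rewrite sum_wordsS -big_split/=.
apply: le_trans (lerD (ler_wpM2l (g0 (c [::] true)) (IH (child true c)))
                      (ler_wpM2l (g0 (c [::] false)) (IH (child false c)))).
rewrite !mulr_sumr -big_split/=; apply: ler_sum => w _.
rewrite !word_weight_cons !occurs_cons; have w0 := word_weight_ge0 w g0.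
have gt := mulr_ge0 (g0 true) w0; have gf := mulr_ge0 (g0 false) w0.
by case: (c [::] true); case: (c [::] false); case: (occurs (child true c) w);
  case: (occurs (child false c) w); rewrite /= ?(mulr0, mulr1, addr0, add0r); lra.
Qed.

(** The normalisation sum of p_a g_a = 1/2 makes vertex_sum a martingale. *)
Lemma vertex_sum_mean g n : lprob p true * g true + lprob p false * g false = 2^-1 ->
  mean p n (vertex_sum g n) = 1.
Proof.
move=> hg; elim: n => [|n IH]; first by rewrite /mean tree_sum0.
have e a b : mean p n (fun c1 => mean p n (fun c2 => vertex_sum g n.+1 (graft a b c1 c2))) = g a + g b.
  transitivity (mean p n (fun c1 => g a * vertex_sum g n c1 + g b)).
    apply: eq_mean => c1.
    transitivity (mean p n (fun c2 => g a * vertex_sum g n c1 + g b * vertex_sum g n c2)) => //.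
    by rewrite meanD mean_cst meanZ IH mulr1.
  by rewrite meanD mean_cst meanZ IH mulr1.
rewrite meanS !big_bool !e; move: hg => /=; nra.
Qed.

(** The martingale is bounded in mean square when sum of 2 p_a g_a^2 < 1; the
    hypothesis on C says that C is a fixed point bound of the recursion. *)
Lemma vertex_sum_sqr g n C : lprob p true * g true + lprob p false * g false = 2^-1 ->
  1 <= C -> 2 * (lprob p true * g true ^+ 2 + lprob p false * g false ^+ 2) * C + 2^-1 <= C ->
  mean p n (fun c => vertex_sum g n c ^+ 2) <= C.
Proof.
move=> hg C1 hC; elim: n => [|n IH]; first by rewrite /mean tree_sum0 expr1n.
pose S := mean p n (fun c => vertex_sum g n c ^+ 2).
have e a b : mean p n (fun c1 => mean p n (fun c2 => vertex_sum g n.+1 (graft a b c1 c2) ^+ 2)) =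
    g a ^+ 2 * S + g b ^+ 2 * S + 2 * g a * g b.
  transitivity (mean p n (fun c1 => g a ^+ 2 * vertex_sum g n c1 ^+ 2 + g b ^+ 2 * S +
      (2 * g a * g b) * vertex_sum g n c1)).
    apply: eq_mean => c1.
    transitivity (mean p n (fun c2 => g a ^+ 2 * vertex_sum g n c1 ^+ 2 +
       g b ^+ 2 * vertex_sum g n c2 ^+ 2 + (2 * g a * g b * vertex_sum g n c1) * vertex_sum g n c2)).
      by apply: eq_mean => c2 /=; rewrite -/(child _ _) -[child true _]/c1 -[child false _]/c2; ring.
    by rewrite !meanD !meanZ mean_cst vertex_sum_mean// mulr1.
  by rewrite !meanD !meanZ mean_cst vertex_sum_mean// mulr1.
rewrite meanS !big_bool !e.
have S0 : 0 <= S by apply: mean_ge0 => // c; exact: sqr_ge0.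
move: IH hC hg; rewrite -/S /=; set q := lprob p true; move: (g true) (g false) => x y IH hC hg.
apply: le_trans hC.
have -> : p * p * (x ^+ 2 * S + x ^+ 2 * S + 2 * x * x) +
  p * (1 - p) * (x ^+ 2 * S + y ^+ 2 * S + 2 * x * y) +
  ((1 - p) * p * (y ^+ 2 * S + x ^+ 2 * S + 2 * y * x) +
   (1 - p) * (1 - p) * (y ^+ 2 * S + y ^+ 2 * S + 2 * y * y)) =
  2 * (p * x ^+ 2 + (1 - p) * y ^+ 2) * S + 2 * (p * x + (1 - p) * y) ^+ 2 by ring.
have -> : p * x + (1 - p) * y = 2^-1 by exact: hg.
have -> : 2 * (2^-1) ^+ 2 = 2^-1 :> R by rewrite expr2; lra.
rewrite lerD2r ler_wpM2l// mulr_ge0// addr_ge0// mulr_ge0 ?sqr_ge0//; have := p01; lra.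
Qed.

(** For the tilt b_a = 2 p_a r_a^s the drift condition says that a word typically
    has an expected number of carriers that does not grow, and then this number is
    comparable to the probability of occurrence. The occurring words of the best
    type thus have s-weight of mean almost 1; as this weight is dominated by the
    square-integrable vertex_sum, the Paley-Zygmund argument bounds the probability
    that it is large. *)
Lemma growth_of_le0_drift (b : bool -> R) s : 0 < s ->
  (forall a, b a = 2 * lprob p a * lratio r1 r2 a `^ s) -> b true + b false = 1 ->
  b true * ln (2 * p) + b false * ln (2 * (1 - p)) <= 0 -> growth s.
Proof.
pose g a := lratio r1 r2 a `^ s.
move=> s0 bE b1 drift e e0; pose e' := e / 7.
have bg a : b a = 2 * lprob p a * g a := bE a.
have e'0 : 0 < e' by rewrite divr_gt0.
have l20 a : 0 < 2 * lprob p a by rewrite mulr_gt0 ?lprob_gt0.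
have g0 a : 0 < g a by rewrite powR_gt0 ?lratio_gt0.
have g1 a : g a < 1.
  by rewrite /g powR_expR ?lratio_gt0// expR_lt1 pmulr_rlt0//; apply: ln_lt0; rewrite lratio_gt0 lratio_lt1.
have b0 a : 0 < b a by rewrite bg mulr_gt0.
have bt := b0 true; have bf := b0 false.
have [th /andP[th0 th1] hth] := @small_exponent R (b true) (b false)
  (ln (2 * p)) (ln (2 * (1 - p))) e' (ltW bt) (ltW bf) b1 drift e'0.
have hphi n : \sum_(w <- words n) word_weight b w * (word_weight (fun a => 2 * lprob p a) w / occ_prob p w) `^ th
    <= n.+1%:R * expR (th * e') ^+ n.
  apply: tilt_occ_prob => //; first by rewrite th0.
    rewrite !divff ?gt_eqF ?l20// powR1 !mulr1 b1.
    by rewrite -[leLHS]expR0 ler_expR mulr_ge0 ?ltW.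
  by rewrite !powR_expR ?l20.
have hg : lprob p true * g true + lprob p false * g false = 2^-1 by move: b1; rewrite !bg; lra.
pose q := 2 * (lprob p true * g true ^+ 2 + lprob p false * g false ^+ 2).
have q1 : q < 1.
  have -> : 1 = 2 * (lprob p true * g true + lprob p false * g false) by rewrite hg; lra.
  by rewrite /q ltr_pM2l//; apply: ltrD; rewrite ltr_pM2l ?lprob_gt0// expr2 gtr_pMr.
have q0 : 0 <= q by rewrite /q mulr_ge0// addr_ge0// mulr_ge0 ?sqr_ge0// ltW ?lprob_gt0.
pose C := (1 - q)^-1.
have C0 : 0 < C by rewrite invr_gt0 subr_gt0.
have CE : C * (1 - q) = 1 by rewrite mulVf// gt_eqF// subr_gt0.
have C1 : 1 <= C by nra.
have sq n : mean p n (fun c => vertex_sum g n c ^+ 2) <= C.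
  by apply: vertex_sum_sqr => //; rewrite -/q; lra.
have [n2 hn2] := @exp_beats_linear R 4 (th * e') ltac:(lra) ltac:(rewrite mulr_gt0//).
have [n3 hn3] := @exp_beats_linear R 4 e' ltac:(lra) e'0.
have [n4 hn4] := @exp_beats_linear R C e' C0 e'0.
exists (maxn n2 (maxn n3 n4)) => n; rewrite !geq_max => /and3P[h2 h3 h4].
have N1 : 1 <= n.+1%:R :> R by rewrite ler1n.
pose d := expR (- (2 * e') * n%:R).
have d0 : 0 < d by exact: expR_gt0.
pose M w := word_weight (fun a => 2 * lprob p a) w.
have M0 w : 0 < M w by exact: word_weight_gt0.
have key : 2^-1 <= \sum_(w <- words n) word_weight b w * (d * M w <= occ_prob p w)%R%:R.
  have := @sum_le_indic _ (words n) (word_weight b) (fun w => (d * M w <= occ_prob p w)%R%:R)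
    (fun w => 0) (fun w => (d * (M w / occ_prob p w)) `^ th)
    (fun w => word_weight_ge0 w (fun a => ltW (b0 a))) (fun w => lexx _) (fun w => powR_ge0 _ _).
  rewrite sum_word_weight b1 expr1n => H.
  have H1 : forall i, i \in words n -> 1 <= (d * M i <= occ_prob p i)%R%:R + 0 + (d * (M i / occ_prob p i)) `^ th.
    move=> w _; case: (leP (d * M w) (occ_prob p w)) => [_|hd].
      by have := powR_ge0 (d * (M w / occ_prob p w)) th; rewrite /=; lra.
    have := @powR_ge1 (d * (M w / occ_prob p w)) th; rewrite mulrA ler_pdivlMr ?occ_prob_gt0// mul1r.
    by move=> /(_ (ltW hd) (ltW th0)); rewrite /=; lra.
  have {H1}H := H H1.
  have B2 : \sum_(w <- words n) word_weight b w * (d * (M w / occ_prob p w)) `^ th <= 4^-1.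
    have -> : \sum_(w <- words n) word_weight b w * (d * (M w / occ_prob p w)) `^ th =
       d `^ th * \sum_(w <- words n) word_weight b w * (M w / occ_prob p w) `^ th.
      rewrite mulr_sumr; apply: eq_bigr => w _.
      by rewrite powRM ?(ltW d0) ?divr_ge0 ?(ltW (occ_prob_gt0 w)) ?(ltW (M0 w))//; ring.
    apply: (@le_trans _ _ (d `^ th * (n.+1%:R * expR (th * e') ^+ n))).
      by rewrite ler_wpM2l ?powR_ge0//; exact: hphi.
    rewrite /d powR_exp_mulrn mulrCA -exprMn -expRD -expRM_natl.
    have -> : n%:R * (th * - (2 * e') + th * e') = - (th * e' * n%:R) by ring.
    rewrite expRN ler_pdivrMr ?expR_gt0//.
    by have := hn2 n h2; lra.
  rewrite (_ : \sum_(i <- words n) word_weight b i * 0 = 0) in H; last first.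
    by rewrite big1// => i _; rewrite mulr0.
  lra.
have key2 : d / 2 <= \sum_(w <- words n) word_weight g w * occ_prob p w.
  apply: (@le_trans _ _ (d * \sum_(w <- words n) word_weight b w * (d * M w <= occ_prob p w)%R%:R)).
    by rewrite ler_pM2l.
  rewrite mulr_sumr; apply: ler_sum => w _.
  have gw := word_weight_gt0 w g0; have ow := occ_prob_gt0 w.
  case: (leP (d * M w) (occ_prob p w)) => hd /=; last by rewrite !mulr0 mulr_ge0 ?(ltW gw) ?(ltW ow).
  by rewrite mulr1 (eq_word_weight w bg) word_weight_mul -/(M w) mulrA mulrC ler_pM2l.
have [k' k'n] := exists_big_type key2.
rewrite -mean_type_count => hE; have tb : 0 < type_weight g n k' by exact: type_weight_gt0.
pose x := d / 4 / n.+1%:R.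
have x0 : 0 < x by rewrite !divr_gt0//; lra.
have hxx : d / 2 / n.+1%:R = x + x by rewrite /x; field; rewrite gt_eqF//; lra.
have xe : expR (- (3 * e') * n%:R) <= x.
  rewrite /x !ler_pdivlMr//.
  have -> : d = expR (- (3 * e') * n%:R) * expR (e' * n%:R).
    by rewrite /d -expRD; congr expR; ring.
  by rewrite -mulrA ler_pM2l ?expR_gt0//; have := hn3 n h3; lra.
exists k', (x / type_weight g n k'); split => //.
  rewrite divfK ?gt_eqF//; apply: le_trans xe; rewrite ler_expR ler_wpM2r//.
  by rewrite lerN2 /e'; lra.
have tcW c : type_weight g n k' * type_count n k' c <= vertex_sum g n c.
  apply: le_trans (word_sum_le_vertex_sum n c (fun a => ltW (g0 a))).
  rewrite /type_count mulr_sumr big_mkcond/= big_seq [leRHS]big_seq; apply: ler_sum => w.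
  rewrite mem_words => /eqP sw; have gw := word_weight_gt0 w g0.
  case: (eqVneq (count_mem true w) k') => [ck|_]; last by rewrite mulr_ge0 ?ler0n ?(ltW gw).
  by rewrite word_weight_type sw ck.
(* Paley-Zygmund: where the weight is large it is compared with its square. *)
pose Pr := mean p n (fun c => (x / type_weight g n k' <= type_count n k' c)%R%:R).
have PZ : x + x <= x + (x / (2 * C)) * C + C / (2 * x) * Pr.
  rewrite -hxx; apply: le_trans hE _.
  have xC : 0 < x / (2 * C) by rewrite divr_gt0 ?mulr_gt0.
  apply: (@le_trans _ _ (mean p n (fun c => x + (x / (2 * C)) * vertex_sum g n c ^+ 2 +
     C / (2 * x) * (x / type_weight g n k' <= type_count n k' c)%R%:R))).
    apply: mean_le => // c; have := tcW c; have W2 := sqr_ge0 (vertex_sum g n c).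
    have Q0 : 0 <= x / (2 * C) * vertex_sum g n c ^+ 2 by rewrite mulr_ge0// ltW.
    case: (leP (x / type_weight g n k') (type_count n k' c)) => h /= uW; last first.
      by move: h; rewrite ltr_pdivlMr// mulrC; lra.
    have : 0 <= (x * vertex_sum g n c - C) ^+ 2 / (2 * C * x).
      by rewrite divr_ge0 ?sqr_ge0// !mulr_ge0// ltW.
    have -> : (x * vertex_sum g n c - C) ^+ 2 / (2 * C * x) =
       x / (2 * C) * vertex_sum g n c ^+ 2 + C / (2 * x) - vertex_sum g n c.
      by field; rewrite !gt_eqF.
    lra.
  by rewrite !meanD !meanZ mean_cst -/Pr lerD2r lerD2l ler_pM2l.
rewrite -/Pr; apply: (@le_trans _ _ (x ^+ 2 / C)); last first.
  have e1 : x / (2 * C) * C = x / 2 by field; rewrite gt_eqF.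
  have e2 : C / (2 * x) * Pr = (C * Pr) / (2 * x) by field; rewrite gt_eqF.
  rewrite e1 e2 in PZ; have : x / 2 <= C * Pr / (2 * x) by lra.
  by rewrite ler_pdivlMr ?mulr_gt0// ler_pdivrMr// expr2; lra.
have xx : expR (- (6 * e') * n%:R) <= x ^+ 2.
  have -> : expR (- (6 * e') * n%:R) = expR (- (3 * e') * n%:R) ^+ 2.
    by rewrite expr2 -expRD; congr expR; ring.
  by apply: lerXn2r => //; rewrite nnegrE ?expR_ge0// ltW.
rewrite ler_pdivlMr//; apply: le_trans xx.
have Ce : C <= expR (e' * n%:R).
  by apply: le_trans (hn4 n h4); rewrite ler_peMr// ltW.
apply: (@le_trans _ _ (expR (- e * n%:R) * expR (e' * n%:R))).
  by rewrite ler_pM2l ?expR_gt0.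
by rewrite -expRD ler_expR /e'; lra.
Qed.

End Growth.

(** * Robust branching in blocks *)

Lemma count_inj_le (S T : eqType) (f : S -> T) (P : pred S) (Q : pred T) (s : seq S) (t : seq T) :
  uniq s -> (forall x, x \in s -> P x -> f x \in t /\ Q (f x)) ->
  (forall x y, x \in s -> y \in s -> P x -> P y -> f x = f y -> x = y) ->
  (count P s <= count Q t)%N.
Proof.
move=> us fP inj; rewrite -!size_filter -(size_map f).
apply: uniq_leq_size.
  rewrite map_inj_in_uniq ?filter_uniq// => x y.
  by rewrite !mem_filter => /andP[Px xs] /andP[Py ys]; exact: inj.
move=> y /mapP[x]; rewrite mem_filter => /andP[Px xs] ->.
by rewrite mem_filter; have [-> ->] := fP x xs Px.
Qed.

Fixpoint hit (X : labelling -> bool) j (c : labelling) : bool :=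
  if j is j'.+1 then hit X j' (child true c) || hit X j' (child false c) else X c.

Lemma hitP X j c : hit X j c -> exists2 x, size x = j & X (subtree x c).
Proof.
elim: j c => [|j IH] c; first by exists [::].
by move=> /= /orP[] /IH[x sx Xx]; [exists (true :: x)|exists (false :: x)]; rewrite //= sx.
Qed.

(** Words whose first j letters are free: an occurrence of a word of type k in any
    of the 2^j subtrees at level j is the end of an occurring word of this kind. *)
Definition block_lang j n k := [seq w <- words (j + n) | count_mem true (drop j w) == k].

Lemma block_langP j n k w : w \in block_lang j n k ->
  size w = (j + n)%N /\ count_mem true (drop j w) = k.
Proof. by rewrite mem_filter mem_words => /andP[/eqP h /eqP]. Qed.

Section Boost.
Context {R : realType}.
Variable p : R.
Hypothesis p01 : 0 <= p <= 1.

(** The 2^j subtrees at level j are independent. *)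
Lemma mean_hit X j n :
  mean p (j + n) (fun c => 1 - (hit X j c)%:R) = (1 - mean p n (fun c => (X c)%:R)) ^+ (2 ^ j).
Proof.
elim: j => [|j IH]; first by rewrite expr1 mean1B.
rewrite addSn meanS.
have e a b : mean p (j + n) (fun c1 => mean p (j + n) (fun c2 => 1 - (hit X j.+1 (graft a b c1 c2))%:R)) =
   ((1 - mean p n (fun c => (X c)%:R)) ^+ (2 ^ j)) ^+ 2.
  rewrite -IH expr2 -mean_prod; apply: eq_mean => c1; apply: eq_mean => c2 /=.
  rewrite -[child true _]/c1 -[child false _]/c2.
  by case: (hit X j c1); case: (hit X j c2) => /=; ring.
rewrite !big_bool !e expnS mulnC exprM /=; ring.
Qed.

Lemma type_countE n k c : type_count n k c = (count (occurs c) [seq w <- words n | count_mem true w == k])%:R :> R.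
Proof.
rewrite /type_count -big_filter -sum1_count natr_sum [RHS]big_mkcond/=.
by apply: eq_bigr => w _; case: occurs.
Qed.

Lemma hit_block (m : R) j n k c : hit (fun c => m <= type_count n k c) j c ->
  m <= (count (occurs c) (block_lang j n k))%:R.
Proof.
move=> /hitP[x sx] h; apply: le_trans h _; rewrite type_countE ler_nat.
apply: (@count_inj_le _ _ (cat (path_word c x))); rewrite ?filter_uniq ?words_uniq//.
  move=> w; rewrite mem_filter mem_words => /andP[/eqP ck /eqP sw] /occursP[y yw].
  rewrite mem_filter mem_words size_cat size_path_word sx sw eqxx drop_size_cat ?size_path_word// ck eqxx.
  by split=> //; apply/occursP; exists (x ++ y); rewrite path_word_cat yw.
by move=> w w' _ _ _ _ /eqP; rewrite eqseq_cat// eqxx => /eqP.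
Qed.

(** Among the 2^j independent subtrees at level j one is successful with probability
    1 - (1 - c)^(2^j) >= 1 - 1 / (c 2^j). *)
Lemma boosted_block (m : R) j n k (c : R) : 0 < c -> c <= mean p n (fun c => (m <= type_count n k c)%R%:R) ->
  1 - (c * 2 ^+ j)^-1 <= mean p (j + n) (fun c => (m <= (count (occurs c) (block_lang j n k))%:R)%R%:R).
Proof.
move=> c0 hc; set X := fun c => m <= type_count n k c.
apply: (@le_trans _ _ (mean p (j + n) (fun c => (hit X j c)%:R))); last first.
  apply: mean_le => // w; case hw : (hit X j w); last by rewrite ler0n.
  by rewrite (hit_block hw).
set E := mean p (j + n) _.
have -> : E = 1 - (1 - mean p n (fun c => (X c)%:R)) ^+ (2 ^ j).
  by rewrite -mean_hit mean1B -/E; ring.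
rewrite lerD2l lerN2; set y := mean p n _ in hc *.
have y1 : y <= 1 by rewrite -[leRHS](mean_cst p n); apply: mean_le => // w; case: (m <= type_count n k w).
have e0 : 0 < expR (y * 2 ^+ j) by exact: expR_gt0.
apply: (@le_trans _ _ (expR (- y) ^+ (2 ^ j))).
  apply: lerXn2r; rewrite ?nnegrE ?expR_ge0 ?subr_ge0//.
  by have := expR_ge1Dx (- y).
rewrite -expRM_natr natrX mulNr expRN lef_pV2 ?posrE ?mulr_gt0 ?exprn_gt0//.
apply: (@le_trans _ _ (y * 2 ^+ j)); first by rewrite ler_pM2r// exprn_gt0.
by apply: le_trans (expR_ge1Dx _); lra.
Qed.

End Boost.

Section Blocks.
Context {R : realType}.
Variables r1 r2 p : R.
Hypotheses (r1_gt0 : 0 < r1) (r1_lt_r2 : r1 < r2) (r2_lt1 : r2 < 1).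
Hypothesis p01 : 0 < p < 1.

(** Blocks of L levels such that with probability 1 - e at least m of the words in
    lang occur; as their ratios are at least x, the condition 2 <= m x^s makes m / 2
    of them carry s-weight at least 1. *)
Definition block_family (s e : R) (L : nat) (lang : seq (seq bool)) (m x : R) :=
  [/\ uniq lang /\ {in lang, forall w, size w = L},
      {in lang, forall w, x <= word_weight (lratio r1 r2) w},
      16 <= m /\ 0 < x, 2 <= m * x `^ s &
      1 - e <= mean p L (fun c => (m <= (count (occurs c) lang)%:R)%R%:R)].

(** A block consists of j + n levels with j = delta n. The j initial levels boost the
    success probability, which is only expR (- ep n), to 1 - e for ep < delta ln 2
    and large n, and they cost a factor r1^(j s) that is absorbed by the gain
    rho^(s' - s) if delta is small compared with s' - s. *)
Lemma block_family_exists s s' e : 0 <= s -> s < s' -> 0 < e -> growth r1 r2 p s' ->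
  exists L lang m x, block_family s e L lang m x.
Proof.
move=> s0 ss e0 gr.
have lr0 := lratio_gt0 r1_gt0 r1_lt_r2.
have r20 : 0 < r2 := lr0 false.
have a12 : ln r1 < ln r2 by rewrite ltr_ln ?posrE.
have a20 : ln r2 < 0 by apply: ln_lt0; rewrite r20.
pose A1 := - ln r1; pose A2 := - ln r2.
have A20 : 0 < A2 by rewrite oppr_gt0.
have A10 : 0 < A1 by rewrite oppr_gt0; apply: lt_trans a20.
pose De := (s' - s) * A2.
have De0 : 0 < De by rewrite mulr_gt0// subr_gt0.
have sA : 0 <= s * A1 by rewrite mulr_ge0// ltW.
pose de := De / (4 * (s * A1 + 1)).
have de0 : 0 < de by rewrite divr_gt0//; lra.
have deE : de * (s * A1) <= De / 4.
  have -> : De / 4 = de * (s * A1 + 1) by rewrite /de; field; rewrite gt_eqF//; lra.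
  by rewrite ler_pM2l//; lra.
have l20 : 0 < ln 2 :> R by apply: ln_gt0; lra.
pose ep := Num.min (de * ln 2 / 2) (De / 4).
have dl0 : 0 < de * ln 2 / 2 by apply: divr_gt0 => //; exact: mulr_gt0.
have ep0 : 0 < ep by rewrite lt_min dl0 /=; lra.
have ep1 : ep <= de * ln 2 / 2 by rewrite ge_min lexx.
have ep2 : ep <= De / 4 by rewrite ge_min lexx orbT.
have [n0 hn0] := gr ep ep0.
have [n1 hn1] := @exp_beats_linear R (e^-1) (de * ln 2 / 2) ltac:(rewrite invr_gt0//) dl0.
have [n2 hn2] := @exp_beats_linear R 16 (De / 2) ltac:(lra) ltac:(lra).
have [n3 hn3] := @exp_beats_linear R (2 * expR (s * A1)) (De / 2) ltac:(rewrite mulr_gt0 ?expR_gt0//) ltac:(lra).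
pose n := maxn n0 (maxn n1 (maxn n2 n3)).
have h0 : (n0 <= n)%N by rewrite leq_max leqnn.
have h1 : (n1 <= n)%N by rewrite !leq_max leqnn !orbT.
have h2 : (n2 <= n)%N by rewrite !leq_max leqnn !orbT.
have h3 : (n3 <= n)%N by rewrite !leq_max leqnn !orbT.
have {gr hn0}[k [m [kn hm hP]]] := hn0 n h0.
have {hn1}h1 := hn1 n h1; have {hn2}h2 := hn2 n h2; have {hn3}h3 := hn3 n h3.
have N1 : 1 <= n.+1%:R :> R by rewrite ler1n.
have N0 : 0 <= n%:R :> R by [].
pose j := (Num.truncn (de * n%:R)).+1.
have jlb : de * n%:R <= j%:R by apply: ltW; exact: truncnS_gt.
have jub : j%:R <= de * n%:R + 1.
  rewrite /j -natr1 lerD2r.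
  have dn0 : 0 <= de * n%:R by rewrite mulr_ge0// ltW.
  by have /andP[] := truncn_itv dn0.
(* expR (- T) is the contraction ratio of the words of type k. *)
pose T := k%:R * A1 + (n - k)%:R * A2.
have Tn : n%:R * A2 <= T.
  have -> : n%:R * A2 = k%:R * A2 + (n - k)%:R * A2.
    by rewrite -mulrDl -natrD subnKC.
  by rewrite lerD2r ler_wpM2l// /A1 /A2; lra.
have twE u : type_weight (fun a => lratio r1 r2 a `^ u) n k = expR (- (u * T)).
  rewrite /type_weight /= !powR_expR// -!expRM_natr -expRD; congr expR; rewrite /T /A1 /A2; ring.
rewrite twE in hm.
have mlb : expR (s' * T - ep * n%:R) <= m.
  have : expR (- ep * n%:R) * expR (s' * T) <= m * expR (- (s' * T)) * expR (s' * T).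
    by rewrite ler_pM2r ?expR_gt0.
  rewrite -mulrA -!expRD (_ : - (s' * T) + s' * T = 0) ?expR0 ?mulr1; last by ring.
  by rewrite addrC mulNr.
have s'T : De * n%:R <= (s' - s) * T.
  have -> : De * n%:R = (s' - s) * (n%:R * A2) by rewrite /De; ring.
  by rewrite ler_pM2l// subr_gt0.
have T0 : 0 <= T by apply: le_trans Tn; rewrite mulr_ge0// ltW.
have sT : 0 <= s * T by rewrite mulr_ge0.
have epn : ep * n%:R <= De / 4 * n%:R by rewrite ler_wpM2r.
have Den : 0 <= De * n%:R by rewrite mulr_ge0// ltW.
pose x := r1 ^+ j * expR (- T).
have x0 : 0 < x by rewrite mulr_gt0 ?exprn_gt0 ?expR_gt0.
have xE : x = expR (- (j%:R * A1 + T)).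
  by rewrite /x -[r1 in LHS]lnK ?posrE// -expRM_natl -expRD; congr expR; rewrite /A1; ring.
exists (j + n)%N, (block_lang j n k), m, x; split.
- split; first by rewrite filter_uniq ?words_uniq.
  by move=> w /block_langP[].
- move=> w /block_langP[sw ck].
  rewrite -(cat_take_drop j w) word_weight_cat /x; apply: ler_pM; rewrite ?expR_ge0 ?exprn_ge0 ?(ltW r1_gt0)//.
    have st : size (take j w) = j by rewrite size_takel// sw leq_addr.
    rewrite -[in leLHS]st; elim: (take j w) => [|a u IH] /=; first by rewrite word_weight_nil expr0.
    rewrite exprS word_weight_cons; apply: ler_pM => //; rewrite ?exprn_ge0 ?(ltW r1_gt0)//.
    by case: a => //=; exact: ltW.
  rewrite word_weight_type size_drop sw addKn ck -[T]mul1r -twE.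
  by rewrite /type_weight !powRr1 ?(ltW (lr0 _)).
- split=> //; apply: le_trans mlb; apply: (@le_trans _ _ (expR (De / 2 * n%:R))).
    by apply: le_trans h2; lra.
  by rewrite ler_expR; lra.
- have xs : expR (- (s * (j%:R * A1 + T))) = x `^ s.
    by rewrite xE -expRM; congr expR; ring.
  rewrite -xs; apply: (@le_trans _ _ (expR (s' * T - ep * n%:R) * expR (- (s * (j%:R * A1 + T))))); last first.
    by rewrite ler_pM2r ?expR_gt0.
  rewrite -expRD.
  have e1 : 2 * expR (s * A1) <= expR (De / 2 * n%:R) by apply: le_trans h3; rewrite ler_peMr// mulr_ge0 ?expR_ge0.
  have e2 : 2 <= expR (De / 2 * n%:R - s * A1) by rewrite expRB ler_pdivlMr ?expR_gt0.
  apply: le_trans e2 _; rewrite ler_expR.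
  have sj : s * A1 * j%:R <= s * A1 * (de * n%:R + 1) by rewrite ler_wpM2l.
  have dn : de * (s * A1) * n%:R <= De / 4 * n%:R by rewrite ler_wpM2r.
  lra.
- have c0 : 0 < expR (- ep * n%:R) by exact: expR_gt0.
  have p01w : 0 <= p <= 1 by case/andP: p01 => ? ?; rewrite !ltW.
  apply: le_trans (boosted_block p01w j c0 hP).
  rewrite lerD2l lerN2 -[leRHS]invrK lef_pV2 ?posrE ?invr_gt0 ?mulr_gt0 ?exprn_gt0//.
  have -> : 2 ^+ j = expR (j%:R * ln 2) :> R by rewrite expRM_natl lnK ?posrE.
  rewrite -expRD; apply: (@le_trans _ _ (expR (de * ln 2 / 2 * n%:R))).
    by apply: le_trans h1; rewrite ler_peMr// invr_ge0 ltW.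
  rewrite ler_expR.
  have : de * n%:R * ln 2 <= j%:R * ln 2 by rewrite ler_pM2r.
  have : ep * n%:R <= de * ln 2 / 2 * n%:R by rewrite ler_wpM2r.
  lra.
Qed.

End Blocks.

Section Percolation.
Context {R : realType}.
Variables (L : nat) (lang : seq (seq bool)) (m : R).

(** Half of the m words of each block are given up, so that the failure of some of
    the subtrees can be tolerated. *)
Fixpoint survives h (c : labelling) : bool :=
  if h is h'.+1 then
    m <= 2 * (count (fun w => has (fun x => (path_word c x == w) && survives h' (subtree x c)) (words L)) lang)%:R
  else true.

Lemma depends_survives h : depends_upto (h * L) (survives h).
Proof.
elim: h => [//|h IH] c c' e /=; congr (_ <= 2 * _%:R).
apply: eq_in_count => w _; apply: eq_in_has => x; rewrite mem_words => /eqP sx.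
congr (_ && _).
  rewrite (@depends_path_word x c c')// => u b hu; apply: e; apply: leq_trans hu _.
  by rewrite sx mulSn leq_addr.
by apply: IH => u b hu; apply: e; rewrite size_cat sx mulSn ltn_add2l.
Qed.

Variable p : R.
Hypothesis p01 : 0 <= p <= 1.
Hypothesis lang_uniq : uniq lang.
Hypothesis lang_size : {in lang, forall w, size w = L}.

(** A vertex that carries w, chosen once and for all so that distinct words have
    distinct carriers. *)
Let pth c w := nth [::] (words L) (find (fun x => path_word c x == w) (words L)).

Let pthP c w : size w = L -> occurs c w -> pth c w \in words L /\ path_word c (pth c w) = w.
Proof.
rewrite /occurs => -> h; split; first by rewrite mem_nth// -has_find.
by apply/eqP; exact: (nth_find [::] h).
Qed.

Let sel c x := (path_word c x \in lang) && (pth c (path_word c x) == x).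

Let dep_sel x : size x = L -> depends_upto L (fun c => sel c x).
Proof.
move=> sx c c' e; rewrite /sel /pth (@depends_path_word x c c'); last by move=> u b h; apply: e; rewrite -sx.
congr (_ && (nth _ _ _ == _)).
apply: eq_in_find => y; rewrite mem_words => /eqP sy.
by rewrite (@depends_path_word y c c')// => u b h; apply: e; rewrite -sy.
Qed.

Let S c : R := (count (sel c) (words L))%:R.

Let dep_S : depends_upto L S.
Proof.
move=> c c' e; congr (_%:R); apply: eq_in_count => x; rewrite mem_words => /eqP sx.
by apply: dep_sel e.
Qed.

Let occurs_le_S c : (count (occurs c) lang)%:R <= S c.
Proof.
rewrite ler_nat; apply: (@count_inj_le _ _ (pth c)) => //.
  move=> w wl ow; have [h1 h2] := pthP (lang_size wl) ow; split=> //.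
  by rewrite /sel h2 wl eqxx.
move=> w w' wl wl' ow ow' e.
by have [_ <-] := pthP (lang_size wl) ow; have [_ <-] := pthP (lang_size wl') ow'; rewrite e.
Qed.

Let surv_count h c :
  (count (fun x => sel c x && survives h (subtree x c)) (words L) <=
   count (fun w => has (fun x => (path_word c x == w) && survives h (subtree x c)) (words L)) lang)%N.
Proof.
apply: (@count_inj_le _ _ (path_word c)); first exact: words_uniq.
  move=> x xL /andP[/andP[xl _] sx]; split=> //.
  by apply/hasP; exists x; rewrite ?eqxx.
move=> x y _ _ /andP[/andP[_ /eqP hx] _] /andP[/andP[_ /eqP hy] _] e.
by rewrite -hx -hy e.
Qed.

(** The factor 4 / S^2 of Chebyshev's inequality, on the event that S is at least m. *)
Let kap c : R := (m <= S c)%R%:R * (4 / S c ^+ 2).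

Hypothesis m16 : 16 <= m.

Let kap_ge0 c : 0 <= kap c.
Proof. by rewrite /kap mulr_ge0// divr_ge0// sqr_ge0. Qed.

Let kapS2 c : kap c * (S c * S c) <= 4.
Proof.
rewrite /kap; case: (leP m (S c)) => h /=; last by rewrite !mul0r.
have S0 : 0 < S c by have := m16; lra.
by rewrite mul1r -expr2 divfK// gt_eqF// exprn_gt0.
Qed.

Let kapS c : kap c * S c <= 4 / m.
Proof.
have M := m16.
rewrite /kap; case: (leP m (S c)) => h /=; last by rewrite !mul0r divr_ge0//; lra.
have S0 : 0 < S c by lra.
rewrite mul1r (_ : 4 / S c ^+ 2 * S c = 4 / S c); last by field; rewrite gt_eqF.
by rewrite ler_pM2l// lef_pV2 ?posrE//; lra.
Qed.

Let dep_kap : depends_upto L kap.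
Proof. by move=> c c' e; rewrite /kap (dep_S e). Qed.

Let fails h c : R := \sum_(x <- words L) (sel c x)%:R * (~~ survives h (subtree x c))%:R.

Let not_survives_le h c : (~~ survives h.+1 c)%:R <= (1 - (m <= (count (occurs c) lang)%:R)%R%:R) + kap c * fails h c ^+ 2.
Proof.
have K := mulr_ge0 (kap_ge0 c) (sqr_ge0 (fails h c)).
case: (leP m (count (occurs c) lang)%:R) => hm /=; last first.
  by case: (~~ _) => /=; lra.
rewrite subrr add0r -ltNge; case: ltP => //= hs.
have MS : m <= S c by apply: le_trans (occurs_le_S c).
have S0 : 0 < S c by have := m16; lra.
rewrite /kap MS mul1r mulrAC ler_pdivlMr ?exprn_gt0// mul1r.
have e : S c = (count (fun x => sel c x && survives h (subtree x c)) (words L))%:R + fails h c.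
  rewrite /S /fails -!sum1_count !natr_sum [LHS]big_mkcond/= [X in X + _]big_mkcond/= -big_split/=.
  apply: eq_bigr => x _; case: (sel c x); case: (survives h _) => /=; ring.
have := surv_count h c; rewrite -(ler_nat R) => h1.
have f2 : S c <= 2 * fails h c by lra.
have : S c ^+ 2 <= (2 * fails h c) ^+ 2 by apply: lerXn2r; rewrite ?nnegrE//; lra.
by rewrite exprMn; lra.
Qed.

Let q h := mean p (h * L) (fun c => (~~ survives h c)%:R).

Let mean_fails h : mean p (L + h * L) (fun c => kap c * fails h c ^+ 2) <= 4 * q h ^+ 2 + 4 / m * q h.
Proof.
have q0 : 0 <= q h by apply: mean_ge0.
pose u x x' c := kap c * ((sel c x)%:R * (sel c x')%:R).
have u0 x x' c : 0 <= u x x' c by rewrite mulr_ge0// mulr_ge0.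
have du x x' : size x = L -> size x' = L -> depends_upto L (u x x').
  by move=> sx sx' c c' e; rewrite /u (dep_kap e) (dep_sel sx e) (dep_sel sx' e).
pose v c : R := (~~ survives h c)%:R.
have -> : mean p (L + h * L) (fun c => kap c * fails h c ^+ 2) =
  \sum_(x <- words L) \sum_(x' <- words L)
     mean p (L + h * L) (fun c => u x x' c * v (subtree x c) * v (subtree x' c)).
  transitivity (mean p (L + h * L) (fun c => \sum_(x <- words L) \sum_(x' <- words L)
      u x x' c * v (subtree x c) * v (subtree x' c))).
    apply: eq_mean => c; rewrite expr2 /fails mulr_suml mulr_sumr; apply: eq_bigr => x _.
    rewrite !mulr_sumr; apply: eq_bigr => x' _; rewrite /u /v; ring.
  rewrite /mean tree_sum_sum; apply: eq_bigr => x _; by rewrite tree_sum_sum.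
have term x x' : x \in words L -> x' \in words L ->
   mean p (L + h * L) (fun c => u x x' c * v (subtree x c) * v (subtree x' c)) <=
   mean p L (u x x') * q h ^+ 2 + (x == x')%:R * (mean p L (u x x') * q h).
  rewrite !mem_words => /eqP sx /eqP sx'.
  have E0 : 0 <= mean p L (u x x') by apply: mean_ge0.
  have [<-|ne] := eqVneq x x'; last first.
    by rewrite mean_subtree2//; [rewrite -/(q h) mul0r addr0 -mulrA -expr2|exact: du].
  rewrite mul1r; apply: (@le_trans _ _ (mean p L (u x x) * q h)); last first.
    by rewrite lerDr mulr_ge0 ?sqr_ge0//; apply: mean_ge0.
  rewrite -(@mean_subtree _ p L (h * L) (u x x) v x)//; last exact: du.
  apply: mean_le => // c; rewrite -mulrA ler_wpM2l// /v.
  by case: survives; rewrite /= ?mulr0 ?mulr1.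
apply: (@le_trans _ _ (\sum_(x <- words L) \sum_(x' <- words L)
   (mean p L (u x x') * q h ^+ 2 + (x == x')%:R * (mean p L (u x x') * q h)))).
  rewrite big_seq [leRHS]big_seq; apply: ler_sum => x xL.
  by rewrite big_seq [leRHS]big_seq; apply: ler_sum => x' xL'; exact: term.
under eq_bigr do rewrite big_split/=.
rewrite big_split/=; apply: lerD.
  have -> : \sum_(x <- words L) \sum_(x' <- words L) mean p L (u x x') * q h ^+ 2 =
     mean p L (fun c => kap c * (S c * S c)) * q h ^+ 2.
    under eq_bigr do rewrite -mulr_suml.
    rewrite -mulr_suml; congr (_ * _).
    under eq_bigr do rewrite -tree_sum_sum.
    rewrite -tree_sum_sum; apply: eq_tree_sum => c; rewrite /u.
    under eq_bigr do rewrite -mulr_sumr -mulr_sumr.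
    rewrite -mulr_sumr -mulr_suml /S -sum1_count natr_sum; congr (_ * (_ * _)).
      by rewrite [RHS]big_mkcond; apply: eq_bigr => x _; case: sel.
    by rewrite [RHS]big_mkcond; apply: eq_bigr => x _; case: sel.
  rewrite ler_wpM2r ?sqr_ge0//.
  by rewrite -[leRHS](mean_cst p L); apply: mean_le => // c; exact: kapS2.
have -> : \sum_(x <- words L) \sum_(x' <- words L) (x == x')%:R * (mean p L (u x x') * q h) =
     mean p L (fun c => kap c * S c) * q h.
  transitivity (\sum_(x <- words L) mean p L (u x x) * q h).
    rewrite big_seq [RHS]big_seq; apply: eq_bigr => x xL.
    rewrite (bigD1_seq x) ?words_uniq//= eqxx mul1r big1 ?addr0// => x' ne.
    by rewrite eq_sym (negbTE ne) mul0r.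
  rewrite -mulr_suml; congr (_ * _); rewrite -tree_sum_sum; apply: eq_tree_sum => c.
  rewrite /u /S -sum1_count natr_sum mulr_sumr [RHS]big_mkcond; apply: eq_bigr => x _.
  by case: sel; rewrite /= ?mulr1 ?mulr0.
rewrite ler_wpM2r//.
by rewrite -[leRHS](mean_cst p L); apply: mean_le => // c; exact: kapS.
Qed.

(** If at least m block words occur and their chosen carriers are S in number, the
    next stage fails only when half of the S independent subtrees fail. By
    Chebyshev's inequality this has conditional probability at most
    4 q^2 + 4 q / m, where q is the failure probability of a subtree. For m >= 16 the
    bound q <= 2e is therefore preserved. *)
Lemma survival_probability e h : 0 <= e <= 64^-1 ->
  1 - e <= mean p L (fun c => (m <= (count (occurs c) lang)%:R)%R%:R) ->
  1 - 2 * e <= mean p (h * L) (fun c => (survives h c)%:R).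
Proof.
move=> /andP[e0 e1] hb.
suff : q h <= 2 * e.
  have -> : q h = 1 - mean p (h * L) (fun c => (survives h c)%:R).
    by rewrite -mean1B; apply: eq_mean => c; case: survives => /=; ring.
  lra.
elim: h => [|h IH]; first by rewrite /q /mean tree_sum0 /=; lra.
have q0 : 0 <= q h by apply: mean_ge0.
rewrite /q mulSn; apply: (@le_trans _ _ (mean p (L + h * L) (fun c =>
   (1 - (m <= (count (occurs c) lang)%:R)%R%:R) + kap c * fails h c ^+ 2))).
  by apply: mean_le => // c; exact: not_survives_le.
rewrite meanD mean1B mean_depends => [|c c' ec]; last first.
  have -> // : count (occurs c) lang = count (occurs c') lang.
  apply: eq_in_count => w wl; apply: (@depends_occurs w) => u b hu.
  by apply: ec; rewrite -(lang_size wl).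
have F := mean_fails h.
have M := m16.
have : 4 / m <= 4^-1 by rewrite ler_pdivrMr; lra.
have m0 : 0 <= 4 / m by rewrite divr_ge0//; lra.
move: F; rewrite expr2; move: (4 / m) (q h) IH q0 m0 hb => r qh; nra.
Qed.

End Percolation.

(** * Similarities and the coding map *)

Section Norms.
Context {R : realType} {d : nat}.
Implicit Types (x y : 'rV[R]_d).

Lemma rv_norm_leP x (e : R) : 0 <= e -> (`|x| <= e) <-> (forall i, `|x ord0 i| <= e).
Proof.
move=> e0; rewrite [`|x|]mx_normrE; split=> [/bigmax_leP[_ h] i|h].
  exact: (h (ord0, i)).
by apply/bigmax_leP; split=> // -[i j] _ /=; rewrite (ord1 i).
Qed.

Lemma rv_norm_ltP x (e : R) : 0 < e -> (`|x| < e) <-> (forall i, `|x ord0 i| < e).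
Proof.
move=> e0; rewrite [`|x|]mx_normrE; split=> [/bigmax_ltP[_ h] i|h].
  exact: (h (ord0, i)).
by apply/bigmax_ltP; split=> // -[i j] _ /=; rewrite (ord1 i).
Qed.

Definition dot x y : R := \sum_(i < d) x ord0 i * y ord0 i.

Lemma enorm_ge0 x : 0 <= enorm x. Proof. exact: sqrtr_ge0. Qed.

Lemma enorm_sqr x : enorm x ^+ 2 = dot x x.
Proof. by rewrite sqr_sqrtr ?sumr_ge0// => i _; exact: sqr_ge0. Qed.

Lemma norm_le_enorm x : `|x| <= enorm x.
Proof.
apply/rv_norm_leP; first exact: enorm_ge0.
move=> i; rewrite -sqrtr_sqr ler_sqrt ?sumr_ge0// => [|j _]; last exact: sqr_ge0.
by rewrite (bigD1 i)//= lerDl sumr_ge0// => j _; exact: sqr_ge0.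
Qed.

Definition norm_ratio : R := Num.sqrt d%:R + 1.

Lemma norm_ratio_gt0 : 0 < norm_ratio.
Proof. by rewrite ltr_wpDl// sqrtr_ge0. Qed.

Lemma enorm_le_norm x : enorm x <= norm_ratio * `|x|.
Proof.
apply: (@le_trans _ _ (Num.sqrt d%:R * `|x|)); last by rewrite mulrDl mul1r lerDl.
have -> : Num.sqrt d%:R * `|x| = Num.sqrt (d%:R * `|x| ^+ 2) by rewrite sqrtrM// sqrtr_sqr normr_id.
rewrite ler_sqrt; last by rewrite mulr_ge0 ?sqr_ge0.
apply: (@le_trans _ _ (\sum_(i < d) `|x| ^+ 2)).
  apply: ler_sum => i _; rewrite -real_normK ?num_real//.
  by apply: lerXn2r; rewrite ?nnegrE//; apply: (rv_norm_leP x (normr_ge0 _)).1.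
by rewrite sumr_const card_ord -[X in X <= _]mulr_natl.
Qed.

Lemma dot_polar x y : dot x y = (dot x x + dot y y - dot (x - y) (x - y)) / 2.
Proof.
apply: (mulIf (_ : 2 != 0 :> R)); rewrite ?pnatr_eq0// divfK ?pnatr_eq0//.
by rewrite /dot mulr_suml -big_split -sumrB/=; apply: eq_bigr => i _; rewrite !mxE; ring.
Qed.

Lemma mulmx_trE m n (A : 'M[R]_(m, d)) (B : 'M[R]_(n, d)) i j :
  (A *m B^T) i j = dot (row i A) (row j B).
Proof. by rewrite !mxE /dot; apply: eq_bigr => k _; rewrite !mxE. Qed.

(** A similarity of R^d is onto: up to translation it preserves inner products
    up to the factor r^2, hence it is given by an invertible matrix. *)
Lemma similarity_onto r (f : 'rV[R]_d -> 'rV[R]_d) : 0 < r -> similarity r f ->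
  forall y, exists x, f x = y.
Proof.
move=> r0 sf; pose g x := f x - f 0.
have dg x y : dot (g x - g y) (g x - g y) = r ^+ 2 * dot (x - y) (x - y).
  rewrite -!enorm_sqr /g (_ : f x - f 0 - (f y - f 0) = f x - f y); last first.
    by rewrite opprB addrA subrK.
  by rewrite sf exprMn.
have g0 : g 0 = 0 by rewrite /g subrr.
have dg0 x : dot (g x) (g x) = r ^+ 2 * dot x x.
  by have := dg x 0; rewrite g0 !subr0.
have dgg x y : dot (g x) (g y) = r ^+ 2 * dot x y.
  by rewrite dot_polar dg !dg0 [in RHS]dot_polar; ring.
pose e i : 'rV[R]_d := delta_mx 0 i.
pose A := \matrix_(i < d) g (e i).
have dote x i : dot x (e i) = x ord0 i.
  rewrite /dot (bigD1 i)//= mxE !eqxx mulr1 big1 ?addr0// => j ji.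
  by rewrite mxE (negbTE ji) andbF mulr0.
have AA : A *m A^T = (r ^+ 2)%:M.
  apply/matrixP => i j; rewrite mulmx_trE !rowK dgg dote !mxE eqxx /= eq_sym.
  by case: eqP => _; rewrite ?mulr1 ?mulr0.
have r20 : r ^+ 2 != 0 by rewrite expf_neq0// gt_eqF.
pose B := (r ^+ 2)^-1 *: A^T.
have AB : A *m B = 1%:M by rewrite -scalemxAr AA -scalemx1 scalerA mulVf// scale1r.
have BA := mulmx1C AB.
have gA x : g x *m A^T = r ^+ 2 *: x.
  by apply/rowP => i; rewrite mulmx_trE rowK row_id dgg dote mxE.
have AtB : A^T *m ((r ^+ 2)^-1 *: A) = 1%:M.
  by rewrite -scalemxAr scalemxAl.
move=> y; pose z := y - f 0.
exists (z *m B).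
have h : g (z *m B) *m A^T = z *m A^T.
  by rewrite gA /B -scalemxAr scalerA divff// scale1r.
have : g (z *m B) = z.
  by rewrite -[LHS]mulmx1 -AtB mulmxA h -mulmxA AtB mulmx1.
by rewrite /g /z => /(congr1 (fun u => u + f 0)); rewrite !subrK.
Qed.

End Norms.

Section Composition.
Context {R : realType} {d : nat}.
Variables (f1 f2 : 'rV[R]_d -> 'rV[R]_d) (r1 r2 : R).
Hypotheses (r1_gt0 : 0 < r1) (r1_lt_r2 : r1 < r2) (r2_lt1 : r2 < 1).
Hypotheses (sim1 : similarity r1 f1) (sim2 : similarity r2 f2).
Implicit Types (w : seq bool) (z : nat -> bool).

Let lr := lratio r1 r2.

Definition word_map w (x : 'rV[R]_d) := foldr (fun b x => label_map f1 f2 b x) x w.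

Lemma word_map_cat v w x : word_map (v ++ w) x = word_map v (word_map w x).
Proof. by rewrite /word_map foldr_cat. Qed.

Lemma label_map_sim b : similarity (lr b) (label_map f1 f2 b).
Proof. by case: b. Qed.

Let lr_gt0 b : 0 < lr b.
Proof. by case: b => //=; apply: lt_trans r1_lt_r2. Qed.

Let lr_le b : lr b <= r2.
Proof. by case: b => //=; exact: ltW. Qed.

Let r2_gt0 : 0 < r2. Proof. exact: lt_trans r1_lt_r2. Qed.

Definition word_ratio w := word_weight lr w.

Lemma word_ratio_gt0 w : 0 < word_ratio w. Proof. exact: word_weight_gt0. Qed.

Lemma word_ratio_le w : word_ratio w <= r2 ^+ size w.
Proof.
elim: w => [|a w IH]; first by rewrite /word_ratio word_weight_nil expr0.
by rewrite /word_ratio word_weight_cons /= exprS; apply: ler_pM => //; rewrite ?ltW// word_ratio_gt0.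
Qed.

Lemma word_ratio_cat v w : word_ratio (v ++ w) = word_ratio v * word_ratio w.
Proof. exact: word_weight_cat. Qed.

Lemma word_ratio_le1 w : word_ratio w <= 1.
Proof. by apply: le_trans (word_ratio_le w) _; apply: exprn_ile1; rewrite ltW. Qed.

Lemma word_ratio_prefix v w : word_ratio (v ++ w) <= word_ratio v.
Proof. by rewrite word_ratio_cat ler_piMr ?word_ratio_le1// ltW// word_ratio_gt0. Qed.

Lemma word_map_sim w : similarity (word_ratio w) (word_map w).
Proof.
elim: w => [|a w IH] x y; first by rewrite /word_ratio word_weight_nil mul1r.
by rewrite /= label_map_sim IH mulrA -word_weight_cons.
Qed.

Lemma word_map_onto w y : exists x, word_map w x = y.
Proof. exact: similarity_onto (word_ratio_gt0 w) (word_map_sim w) y. Qed.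

Definition step_size : R := enorm (f1 0) + enorm (f2 0).
(** A bound for the distance of 0 from the limit points of all orbits, by a
    geometric series. *)
Definition orbit_radius : R := step_size / (1 - r2).

Let step_ge0 : 0 <= step_size. Proof. by rewrite addr_ge0 ?enorm_ge0. Qed.

Lemma orbit_radius_ge0 : 0 <= orbit_radius.
Proof. by rewrite divr_ge0// subr_ge0 ltW. Qed.

(** The approximations of the point with address z. *)
Definition orbit z n := word_map (mkseq z n) 0.

Lemma mkseq_addn z n k : mkseq z (n + k) = mkseq z n ++ mkseq (fun i => z (n + i)%N) k.
Proof. by rewrite /mkseq iotaD map_cat/= add0n -[in X in _ ++ X](addn0 n) iotaDl -map_comp. Qed.

Lemma orbit_dist z n k : `|orbit z (n + k) - orbit z n| <= word_ratio (mkseq z n) * orbit_radius.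
Proof.
have d0 : 0 < 1 - r2 by rewrite subr_gt0.
suff h : `|orbit z (n + k) - orbit z n| <= word_ratio (mkseq z n) * (orbit_radius * (1 - r2 ^+ k)).
  apply: le_trans h _; rewrite ler_pM2l ?word_ratio_gt0// ler_piMr ?orbit_radius_ge0//.
  by rewrite lerBlDr lerDl exprn_ge0// ltW.
elim: k => [|k IH]; first by rewrite addn0 subrr normr0 expr0 subrr !mulr0.
have -> : orbit z (n + k.+1) - orbit z n =
   (orbit z (n + k.+1) - orbit z (n + k)) + (orbit z (n + k) - orbit z n) by rewrite addrA subrK.
apply: le_trans (ler_normD _ _) _.
have h : `|orbit z (n + k.+1) - orbit z (n + k)| <= word_ratio (mkseq z n) * (r2 ^+ k * step_size).
  apply: le_trans (norm_le_enorm _) _.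
  rewrite addnS /orbit mkseqS -cats1 word_map_cat word_map_sim /=.
  rewrite mkseq_addn word_ratio_cat -mulrA ler_pM2l ?word_ratio_gt0//; apply: ler_pM.
  - exact/ltW/word_ratio_gt0.
  - exact: enorm_ge0.
  - by apply: le_trans (word_ratio_le _) _; rewrite size_mkseq.
  - by rewrite subr0 /step_size; case: (z _) => /=; rewrite ?lerDl ?lerDr enorm_ge0.
apply: le_trans (lerD h IH) _.
rewrite -mulrDr ler_pM2l ?word_ratio_gt0//.
have -> : step_size = orbit_radius * (1 - r2) by rewrite divfK// gt_eqF.
by rewrite exprS le_eqVlt; apply/orP; left; apply/eqP; ring.
Qed.

Lemma exprn_small (e : R) : 0 < e -> exists n, r2 ^+ n < e.
Proof.
move=> e0; have r21 : `|r2| < 1 by rewrite ger0_norm// ltW.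
have /cvgrPdist_lt/(_ e e0) [N _ /(_ N (leqnn N))] := cvg_expr r21.
by rewrite /= sub0r normrN ger0_norm ?exprn_ge0 ?ltW// => h; exists N.
Qed.

Lemma orbit_cvg z : cvgn (orbit z).
Proof.
apply/cauchy_cvgP; apply: cauchy_exP => e e0.
have B0 := orbit_radius_ge0.
have [N hN] := exprn_small (divr_gt0 e0 (ltr_wpDl B0 ltr01 : 0 < orbit_radius + 1)).
have close n : (N <= n)%N -> `|orbit z n - orbit z N| <= r2 ^+ N * orbit_radius.
  move=> /subnKC <-; apply: le_trans (orbit_dist _ _ _) _.
  by rewrite ler_wpM2r//; apply: le_trans (word_ratio_le _) _; rewrite size_mkseq.
exists (orbit z N); exists N => // n hn; rewrite -ball_normE /= -normrN opprB.
apply: le_lt_trans (close n hn) _.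
have B1 : 0 < orbit_radius + 1 by rewrite ltr_wpDl.
have rN : 0 <= r2 ^+ N by rewrite exprn_ge0// ltW.
by move: hN; rewrite ltr_pdivlMr// mulrDr mulr1; lra.
Qed.

Lemma orbit_limit_dist z (x : 'rV[R]_d) n : orbit z k @[k --> \oo] --> x ->
  `|orbit z n - x| <= word_ratio (mkseq z n) * orbit_radius.
Proof.
move=> /cvgrPdist_le h; apply/ler_addgt0Pl => e e0.
have [N _ /(_ (n + N)%N (leq_addl _ _)) hN] := h e e0.
have -> : orbit z n - x = (orbit z n - orbit z (n + N)) + (orbit z (n + N) - x) by rewrite addrA subrK.
apply: le_trans (ler_normD _ _) _; rewrite addrC; apply: lerD.
  by rewrite -normrN opprB.
by rewrite -normrN opprB; exact: orbit_dist.
Qed.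

End Composition.

Section PathLabels.
Context {R : realType} {d : nat}.
Variables f1 f2 : 'rV[R]_d -> 'rV[R]_d.

Definition path_labels (w : edge -> bool) (xi : nat -> bool) k := w (path_edge xi k).
Definition labelling_of (w : edge -> bool) : labelling := fun u b => w (u, b).

Lemma path_pointE w xi n : path_point f1 f2 w xi n = orbit f1 f2 (path_labels w xi) n.
Proof. by []. Qed.

Lemma path_word_mkseq w xi n : path_word (labelling_of w) (mkseq xi n) = mkseq (path_labels w xi) n.
Proof.
elim: n => [//|n IH]; rewrite !mkseqS -!cats1 path_word_cat IH; congr (_ ++ _).
by rewrite /= /subtree cats0.
Qed.

End PathLabels.

(** * Pieces of the same size *)

Section Packing.
Context {R : realType} {d : nat}.

(** Separated points of a bounded set occupy distinct cells of a grid. *)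
Lemma grid_packing (h H : R) : 0 < h -> 0 <= H -> exists K, forall (e : R) (I : eqType)
    (s : seq I) (y : I -> 'rV[R]_d), 0 < e -> uniq s ->
  {in s &, forall i j, i != j -> h * e <= `|y i - y j|} ->
  {in s &, forall i j, `|y i - y j| <= H * e} -> (size s <= K)%N.
Proof.
move=> h0 H0; pose N := (Num.truncn (2 * H / h)).+1.
exists #|{ffun 'I_d -> 'I_N}| => e I s y e0 us sep close.
case: s us sep close => [|i0 s'] // us sep close; set s := i0 :: s' in us sep close *.
have i0s : i0 \in s by rewrite inE eqxx.
have he : 0 < h * e by rewrite mulr_gt0.
pose t i k := ((y i - y i0) ord0 k + H * e) / (h * e).
have t_itv i k : i \in s -> 0 <= t i k <= 2 * H / h.
  move=> is_; have := close i i0 is_ i0s; move/(rv_norm_leP _ (mulr_ge0 H0 (ltW e0))) => /(_ k).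
  rewrite ler_norml => /andP[h1 h2]; apply/andP; split.
    by rewrite divr_ge0 ?(ltW he)//; lra.
  rewrite /t ler_pdivrMr//.
  have -> : 2 * H / h * (h * e) = 2 * (H * e) by field; rewrite gt_eqF.
  lra.
pose cell i := [ffun k : 'I_d => inord (Num.truncn (t i k)) : 'I_N].
have cell_inj : {in s &, injective cell}.
  move=> i j si sj /ffunP e1; apply/eqP; apply: contraT => ij.
  have := sep i j si sj ij; rewrite leNgt => /negP[].
  apply/(rv_norm_ltP _ he) => k; have := e1 k; rewrite !ffunE => /(congr1 val) /=.
  have ti := t_itv i k si; have tj := t_itv j k sj.
  have bnd x : 0 <= x <= 2 * H / h -> (Num.truncn x < N)%N.
    by move=> /andP[_ hx]; rewrite ltnS; exact: le_truncn.
  rewrite !inordK ?bnd// => tt.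
  have /andP[a1 a2] := truncn_itv (proj1 (andP ti)).
  have /andP[b1 b2] := truncn_itv (proj1 (andP tj)).
  rewrite tt in a1 a2; rewrite -natr1 in a2 b2.
  have -> : (y i - y j) ord0 k = (t i k - t j k) * (h * e).
    rewrite /t -mulrBl divfK ?gt_eqF// !mxE; ring.
  rewrite normrM (gtr0_norm he) -[ltRHS]mul1r ltr_pM2r// ltr_norml.
  by move: (t i k) (t j k) a1 a2 b1 b2 => u v; lra.
by rewrite -(size_map cell) -(card_uniqP _) ?max_card// map_inj_in_uniq.
Qed.

Variables (f1 f2 : 'rV[R]_d -> 'rV[R]_d) (r1 r2 : R).
Hypotheses (r1_gt0 : 0 < r1) (r1_lt_r2 : r1 < r2) (r2_lt1 : r2 < 1).
Hypotheses (sim1 : similarity r1 f1) (sim2 : similarity r2 f2).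

Local Notation wr := (word_ratio r1 r2).
Local Notation fw := (word_map f1 f2).
Local Notation pt := (orbit f1 f2).
Local Notation B := (orbit_radius f1 f2 r2).

(** Words along which the contraction ratio drops to e for the first time; they
    form an antichain. *)
Definition stopping (e : R) (w : seq bool) := (wr w <= e) && (e < wr (take (size w).-1 w)).

Lemma stopping_ratio_le e w : stopping e w -> wr w <= e. Proof. by case/andP. Qed.

Lemma stopping_ratio_gt e w : e < 1 -> stopping e w -> r1 * e < wr w.
Proof.
move=> e1 /andP[h1 h2]; case/lastP: w h1 h2 => [|w a].
  by rewrite /wr word_weight_nil; lra.
rewrite size_rcons/= -cats1 take_size_cat// word_ratio_cat => _ h2.
have -> : wr [:: a] = lratio r1 r2 a by rewrite /wr word_weight_cons word_weight_nil mulr1.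
have a1 : r1 <= lratio r1 r2 a by case: a => //=; exact: ltW.
by rewrite mulrC; apply: lt_le_trans (_ : wr w * r1 <= _); rewrite ?ltr_pM2r// ler_pM2l// word_ratio_gt0.
Qed.

Lemma stopping_prefix e v w : stopping e v -> stopping e (v ++ w) -> w = [::].
Proof.
move=> /andP[h1 _] /andP[_]; case/lastP: w => [//|w a].
rewrite -rcons_cat size_rcons/= -cats1 take_size_cat// => h2.
have := word_ratio_prefix r1_gt0 r1_lt_r2 r2_lt1 v w.
by move=> /(lt_le_trans h2)/lt_le_trans/(_ h1); rewrite ltxx.
Qed.

Lemma stopping_exists e z : 0 < e < 1 -> exists n, stopping e (mkseq z n).
Proof.
move=> /andP[e0 e1]; have [N hN] := exprn_small r1_gt0 r1_lt_r2 r2_lt1 e0.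
have ex : exists n, wr (mkseq z n) <= e.
  exists N; apply: ltW; apply: le_lt_trans hN.
  by have := word_ratio_le r1_gt0 r1_lt_r2 (mkseq z N); rewrite size_mkseq.
exists (ex_minn ex); case: ex_minnP => n hn hmin; rewrite /stopping hn size_mkseq /=.
case: n hn hmin => [|n] hn hmin.
  by move: hn; rewrite /wr word_weight_nil leNgt e1.
rewrite /= mkseqS -cats1 take_size_cat ?size_mkseq// ltNge; apply/negP => /hmin.
by rewrite ltnn.
Qed.

Lemma stopping_size e : 0 < e -> exists N, forall w, stopping e w -> (size w <= N)%N.
Proof.
move=> e0; have [N hN] := exprn_small r1_gt0 r1_lt_r2 r2_lt1 e0.
exists N => w /andP[_ h]; rewrite leqNgt; apply/negP => hs.
have := word_ratio_le r1_gt0 r1_lt_r2 (take (size w).-1 w).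
rewrite size_takel ?leq_pred// => /(lt_le_trans h).
apply/negP; rewrite -leNgt; apply: le_trans (ltW hN).
have r20 : 0 < r2 by apply: lt_trans r1_lt_r2.
apply: ler_wiXn2l; rewrite ?ltW//.
by case: (size w) hs.
Qed.

Lemma word_map_inj w x y : fw w x = fw w y -> x = y.
Proof.
move=> e; have := word_map_sim sim1 sim2 w x y; rewrite e subrr.
have -> : enorm (0 : 'rV[R]_d) = 0.
  by rewrite /enorm big1 ?sqrtr0// => i _; rewrite mxE expr0n.
move/esym/eqP; rewrite mulf_eq0 gt_eqF ?word_ratio_gt0//= => /eqP h.
have := norm_le_enorm (x - y); rewrite h => h1; apply/eqP; rewrite -subr_eq0 -normr_le0//.
Qed.

Section OpenSet.
Variable U : set 'rV[R]_d.
Hypotheses (Uf1 : f1 @` U `<=` U) (Uf2 : f2 @` U `<=` U).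
Hypothesis Udisj : f1 @` U `&` f2 @` U = set0.

Lemma word_map_stable w x : U x -> U (fw w x).
Proof.
move=> Ux; elim: w => //= a w IH.
by case: a => /=; [apply: Uf1|apply: Uf2]; exists (fw w x).
Qed.

Lemma word_map_disjoint v w x y : ~~ prefix v w -> ~~ prefix w v -> U x -> U y -> fw v x <> fw w y.
Proof.
move=> + + Ux Uy; elim: v w => [|a v IH] [|b w] //=; have [<-|ab] := eqVneq a b.
  rewrite /= => h1 h2 e; apply: (IH w h1 h2).
  exact: (@word_map_inj [:: a]).
move=> _ _ e.
have : (f1 @` U `&` f2 @` U) (label_map f1 f2 a (fw v x)).
  case: a b ab e => [] [] //= _ e.
    by split; [exists (fw v x)|rewrite e; exists (fw w y)]; rewrite //; exact: word_map_stable.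
  by split; [rewrite e; exists (fw w y)|exists (fw v x)]; rewrite //; exact: word_map_stable.
by rewrite Udisj.
Qed.

(** Images of the open set U under the maps of incomparable words are disjoint. For
    stopping words they contain balls of radius comparable to e, and those which
    belong to limit points in V have centres at mutual distance at most a multiple
    of e; the number of such centres is bounded. *)
Lemma packing_bound : U !=set0 -> open U ->
  exists K, forall (e : R) (V : set 'rV[R]_d) (ws : seq (seq bool)),
  0 < e < 1 -> (diam V <= e%:E)%E -> uniq ws ->
  {in ws, forall w, stopping e w /\ exists z x, [/\ mkseq z (size w) = w, pt z n @[n --> \oo] --> x & V x]} ->
  (size ws <= K)%N.
Proof.
move=> [x0 Ux0] /(_ _ Ux0) /nbhs_ballP[rho rho0 hball].
have Uball x : enorm (x - x0) < rho -> U x.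
  move=> hx; apply: hball; rewrite -ball_normE /= -normrN opprB.
  exact: le_lt_trans (norm_le_enorm _) hx.
pose c := norm_ratio (R := R) (d := d).
have c0 : 0 < c := norm_ratio_gt0.
pose M := 1 + 2 * (enorm x0 + B).
have B0 : 0 <= B := orbit_radius_ge0 f1 f2 r2_lt1.
have M0 : 0 <= M by rewrite /M addr_ge0// mulr_ge0// addr_ge0// enorm_ge0.
have [K hK] := @grid_packing (rho * r1 / c) M ltac:(rewrite divr_gt0 ?mulr_gt0//) M0.
exists K => e V ws /andP[e0 e1] dV us hws.
apply: (hK e _ ws (fun w => fw w x0)) => // v w vs ws_.
  move=> vw; have [sv _] := hws v vs; have [sw _] := hws w ws_.
  have np v' w' : stopping e v' -> stopping e w' -> v' != w' -> ~~ prefix v' w'.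
    move=> sv' sw' ne; apply/negP => /prefixP[u wE]; move: ne; rewrite wE.
    by rewrite wE in sw'; rewrite (stopping_prefix sv' sw') cats0 eqxx.
  have n1 := np v w sv sw vw; have n2 := np w v sw sv (introN eqP (fun h => elimN eqP vw (esym h))).
  rewrite mulrAC ler_pdivrMr// mulrC -/c.
  apply: (@le_trans _ _ (enorm (fw v x0 - fw w x0))); last by rewrite mulrC; exact: enorm_le_norm.
  rewrite leNgt; apply/negP => lt.
  have [x' hx'] := word_map_onto r1_gt0 r1_lt_r2 sim1 sim2 w (fw v x0).
  apply: (@word_map_disjoint v w x0 x' n1 n2 Ux0 _ (esym hx')); apply: Uball.
  rewrite -(@ltr_pM2l _ (wr w)) ?word_ratio_gt0// -(word_map_sim sim1 sim2) hx'.
  apply: lt_le_trans lt _; have := stopping_ratio_gt e1 sw => /ltW h.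
  have : rho * (r1 * e) <= rho * wr w by rewrite ler_pM2l.
  by lra.
have [sv [z [x [zv zx Vx]]]] := hws v vs; have [sw [z' [x' [zw zx' Vx']]]] := hws w ws_.
have near_ u z0 (y : 'rV[R]_d) : stopping e u -> mkseq z0 (size u) = u -> pt z0 n @[n --> \oo] --> y ->
    `|fw u x0 - y| <= e * (enorm x0 + B).
  move=> su zu zy; rewrite -(subrK (fw u 0) (fw u x0)) -addrA.
  apply: le_trans (ler_normD _ _) _; rewrite mulrDr; apply: lerD.
    apply: le_trans (norm_le_enorm _) _; rewrite (word_map_sim sim1 sim2) subr0.
    by rewrite ler_wpM2r ?enorm_ge0//; exact: stopping_ratio_le.
  have := orbit_limit_dist r1_gt0 r1_lt_r2 r2_lt1 sim1 sim2 (size u) zy; rewrite /orbit zu => h.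
  by apply: le_trans h _; rewrite ler_wpM2r//; exact: stopping_ratio_le.
have d1 := near_ _ _ _ sv zv zx; have d2 := near_ _ _ _ sw zw zx'.
have d3 : `|x - x'| <= e.
  apply: le_trans (norm_le_enorm _) _; rewrite -lee_fin; apply: le_trans dV.
  by apply: ereal_sup_ubound; exists x, x'.
have -> : fw v x0 - fw w x0 = (fw v x0 - x) + (x - x') - (fw w x0 - x').
  by rewrite addrA subrK opprB addrA subrK.
apply: le_trans (ler_normB _ _) _; apply: le_trans (lerD (ler_normD _ _) (lexx _)) _.
by rewrite /M; lra.
Qed.

End OpenSet.
End Packing.

(** * Paths through a surviving tree *)

Section InfiniteSurvival.
Context {R : realType}.
Variables (L : nat) (lang : seq (seq bool)) (m : R).
Local Notation surv := (survives L lang m).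

Definition good c := forall h, surv h c.

Lemma survives_pred h c : surv h.+1 c -> surv h c.
Proof.
elim: h c => [//|h IH] c h1; apply: le_trans h1 _; rewrite ler_pM2l// ler_nat.
apply: sub_count => w /hasP[x xL /andP[xw sx]]; apply/hasP; exists x => //.
by rewrite xw; exact: (IH _ sx).
Qed.

Lemma survives_mono h h' c : (h <= h')%N -> surv h' c -> surv h c.
Proof. by elim: h' => [|h' IH]; rewrite leq_eqVlt => /orP[/eqP->//|]// /IH H /survives_pred. Qed.

(** Among finitely many subtrees, those which survive long enough survive for ever. *)
Lemma survives_uniform c (s : seq (seq bool)) :
  exists H, forall x, x \in s -> surv H (subtree x c) -> good (subtree x c).
Proof.
elim: s => [|y s [H IH]]; first by exists 0%N.
have [gy|/existsNP[h hy]] := pselect (good (subtree y c)).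
  by exists H => x; rewrite inE => /orP[/eqP->//|]; exact: IH.
exists (maxn H h) => x; rewrite inE => /orP[/eqP->|xs] sx.
  by case: hy; apply: survives_mono sx; rewrite leq_maxr.
by apply: IH xs _; apply: survives_mono sx; rewrite leq_maxl.
Qed.

(** Koenig's lemma, since each stage has finitely many carriers. *)
Lemma good_branching c : uniq lang -> good c -> exists G, [/\ uniq G,
  m <= 2 * (size G)%:R & forall w, w \in G -> w \in lang /\
    exists x, [/\ size x = L, path_word c x = w & good (subtree x c)]].
Proof.
move=> ul gc; have [H hH] := survives_uniform c (words L).
exists [seq w <- lang | has (fun x => (path_word c x == w) && surv H (subtree x c)) (words L)].
split; [exact: filter_uniq|by have := gc H.+1; rewrite /= -size_filter|].
move=> w; rewrite mem_filter => /andP[/hasP[x xL /andP[/eqP xw sx]] wl]; split=> //.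
by exists x; split=> //; [apply/eqP; rewrite -mem_words|exact: hH].
Qed.

Hypothesis lang_uniq : uniq lang.
Hypothesis lang_size : {in lang, forall w, size w = L}.
Hypothesis m_gt0 : 0 < m.

(** Phi u stands for the mass of the excluded part of the cylinder u, in a mass
    distribution for which each stage divides the mass equally among m / 2 words. *)
Variable Phi : seq bool -> \bar R.
Hypothesis Phi_super : forall u G, uniq G -> {in G, forall w, w \in lang} ->
  (\sum_(w <- G) Phi (u ++ w) <= Phi u)%E.

Let mu := m / 2.

Lemma potential_step c x n : good (subtree x c) -> (Phi (path_word c x) < (mu ^- n)%:E)%E ->
  exists y, [/\ size y = L, path_word (subtree x c) y \in lang, good (subtree (x ++ y) c) &
     (Phi (path_word c (x ++ y)) < (mu ^- n.+1)%:E)%E].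
Proof.
move=> gx hPhi; have [G [uG mG hG]] := good_branching lang_uniq gx.
have mu0 : 0 < mu by rewrite divr_gt0.
have [[w wG hw]|hno] := pselect (exists2 w, w \in G & (Phi (path_word c x ++ w) < (mu ^- n.+1)%:E)%E).
  have [wl [y [sy yw gy]]] := hG w wG; exists y; split=> //; first by rewrite yw.
    by rewrite (_ : subtree (x ++ y) c = subtree y (subtree x c))//; apply/funext => u; rewrite /subtree catA.
  by rewrite path_word_cat yw.
exfalso; move: hPhi; apply/negP; rewrite -leNgt.
apply: le_trans (Phi_super (path_word c x) uG (fun w wG => (hG w wG).1)).
apply: (@le_trans _ _ (\sum_(w <- G) (mu ^- n.+1)%:E)%E); last first.
  rewrite big_seq [leRHS]big_seq; apply: lee_sum => w wG; rewrite leNgt.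
  by apply/negP => hw; apply: hno; exists w.
rewrite sumEFin lee_fin big_const_seq count_predT iter_addr_0 -mulr_natl.
rewrite exprS invfM mulrA ler_peMl//; first by rewrite invr_ge0 exprn_ge0// ltW.
by rewrite ler_pdivlMr// mul1r /mu; lra.
Qed.

(** By the supermartingale property some good word of the next block has at most the
    average share of the excluded mass; following such words avoids the excluded
    cylinders for ever. *)
Lemma potential_path c : (0 < L)%N -> good c -> (Phi [::] < 1)%E -> exists xi : nat -> bool,
  forall n, (Phi (path_word c (mkseq xi (n * L))) < (mu ^- n)%:E)%E /\
    mkseq (fun k => xi (n * L + k)%N) L \in words L /\
    path_word (subtree (mkseq xi (n * L)) c) (mkseq (fun k => xi (n * L + k)%N) L) \in lang.
Proof.
move=> L0 gc h0.
pose inv n x := [/\ size x = (n * L)%N, good (subtree x c) & (Phi (path_word c x) < (mu ^- n)%:E)%E].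
have /choice[g hg] (nx : nat * seq bool) : exists y, inv nx.1 nx.2 ->
    [/\ inv nx.1.+1 (nx.2 ++ y), size y = L & path_word (subtree nx.2 c) y \in lang].
  have [hinv|] := pselect (inv nx.1 nx.2); last by exists [::].
  have [sx gx px] := hinv; have [y [sy yl gy py]] := potential_step gx px.
  by exists y => _; split=> //; split=> //; rewrite size_cat sx sy mulSn addnC.
pose X := fix X n := if n is n'.+1 then X n' ++ g (n', X n') else [::].
have hX n : inv n (X n).
  elim: n => [|n IH]; last by have [] := hg (n, X n) IH.
  by split=> //=; rewrite ?expr0 ?invr1.
have sX n : size (X n) = (n * L)%N by have [] := hX n.
pose xi k := nth false (X k.+1) k.
have nthX n j k : (k < n * L)%N -> nth false (X (n + j)%N) k = nth false (X n) k.
  move=> kn; elim: j => [|j IH]; first by rewrite addn0.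
  rewrite addnS /= nth_cat sX ifT//; apply: leq_trans kn _.
  by rewrite leq_mul2r leq_addr orbT.
have kS k : (k < k.+1 * L)%N by exact: leq_pmulr.
have XE n : X n = mkseq xi (n * L).
  apply: (@eq_from_nth _ false); first by rewrite sX size_mkseq.
  move=> k; rewrite sX => kn.
  rewrite nth_mkseq// /xi; case: (leqP n k.+1) => h.
    by rewrite -(subnKC h) nthX.
  by rewrite -(subnKC (ltnW h)) nthX.
exists xi => n; have [_ _ p] := hX n; have [_ sg lg] := hg (n, X n) (hX n).
have gE : g (n, X n) = mkseq (fun k => xi (n * L + k)%N) L.
  have := XE n.+1; rewrite /= mulSn addnC.
  by rewrite mkseq_addn XE => /eqP; rewrite eqseq_cat// eqxx => /eqP.
by rewrite -gE -XE; split=> //; split; rewrite // mem_words sg.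
Qed.

End InfiniteSurvival.

(** * Covers of the generated set *)

Definition words_upto n := undup (flatten [seq words k | k <- iota 0 n.+1]).

Lemma mem_words_upto n w : (w \in words_upto n) = (size w <= n)%N.
Proof.
rewrite mem_undup; apply/flatten_mapP/idP => [[k]|h].
  by rewrite mem_iota add0n ltnS /= mem_words => kn /eqP->.
by exists (size w); rewrite ?mem_iota ?mem_words ?add0n ?ltnS.
Qed.

Section BadPotential.
Context {R : realType}.
Variables (L : nat) (mu : R) (Bad : nat -> seq (seq bool)).
Hypothesis mu_gt0 : 0 < mu.

(** mu^(-n) is the mass of a cylinder of n blocks, and Bad i lists the cylinders
    excluded by the i-th member of a cover. *)
Definition bad_mass i u : R := \sum_(x <- Bad i | prefix u x) mu ^- (size x %/ L).
Definition bad_potential u : \bar R := (\sum_(0 <= i <oo) (bad_mass i u)%:E)%E.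

Lemma bad_mass_ge0 i u : 0 <= bad_mass i u.
Proof. by apply: sumr_ge0 => x _; rewrite invr_ge0 exprn_ge0// ltW. Qed.

Lemma bad_mass_super i u G : uniq G -> {in G, forall w, size w = L} ->
  \sum_(w <- G) bad_mass i (u ++ w) <= bad_mass i u.
Proof.
move=> uG sG; rewrite /bad_mass.
under eq_bigr do rewrite big_mkcond/=.
rewrite exchange_big/= [leRHS]big_mkcond/=; apply: ler_sum => x _.
set q := mu ^- _; have q0 : 0 <= q by rewrite invr_ge0 exprn_ge0// ltW.
pose w0 := take L (drop (size u) x).
have pw w : w \in G -> prefix (u ++ w) x -> prefix u x /\ w = w0.
  move=> wG /prefixP[v xE]; split; first by apply/prefixP; exists (w ++ v); rewrite xE catA.
  by rewrite /w0 xE -catA drop_size_cat// take_size_cat// sG.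
have [px|px] := boolP (prefix u x); last first.
  rewrite big_seq big1// => w wG; case: ifPn => // /(pw w wG)[h].
  by rewrite h in px.
apply: (@le_trans _ _ (\sum_(w <- G | w == w0) q)).
  rewrite [leRHS]big_mkcond/= big_seq [leRHS]big_seq; apply: ler_sum => w wG.
  by case: ifPn => [/(pw w wG)[_ ->]|_]; rewrite ?eqxx//; case: ifP.
rewrite big_const_seq iter_addr_0 count_uniq_mem//.
by case: (_ \in _); rewrite ?mulr1n ?mulr0n.
Qed.

Lemma bad_potential_super u G : uniq G -> {in G, forall w, size w = L} ->
  (\sum_(w <- G) bad_potential (u ++ w) <= bad_potential u)%E.
Proof.
move=> uG sG; rewrite /bad_potential -nneseries_sum; last first.
  by move=> w i _; rewrite lee_fin bad_mass_ge0.
apply: lee_nneseries => i _.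
  by move=> _; apply: sume_ge0 => w _; rewrite lee_fin bad_mass_ge0.
by rewrite sumEFin lee_fin bad_mass_super.
Qed.

Lemma bad_potential_ge i x : x \in Bad i -> ((mu ^- (size x %/ L))%:E <= bad_potential x)%E.
Proof.
move=> xB; apply: (@le_trans _ _ (bad_mass i x)%:E).
  rewrite lee_fin /bad_mass (perm_big _ (perm_to_rem xB)) big_cons/= prefix_refl.
  by rewrite lerDl sumr_ge0// => y _; rewrite invr_ge0 exprn_ge0// ltW.
rewrite /bad_potential.
have h := @nneseries_lim_ge R (fun i => (bad_mass i x)%:E) xpredT 0%N i.+1
  ltac:(by move=> n _ _; rewrite lee_fin bad_mass_ge0).
apply: le_trans h; rewrite big_nat_recr//= leeDr// sume_ge0// => j _.
by rewrite lee_fin bad_mass_ge0.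
Qed.

End BadPotential.

Section Covers.
Context {R : realType} {d : nat}.
Implicit Types (V : set 'rV[R]_d) (s : R).

Lemma diam_pow_ge0 s V : (0 <= diam_pow s V)%E.
Proof. by rewrite /diam_pow; case: eqP => // _; exact: poweR_ge0. Qed.

Lemma diam_ge0 V : V !=set0 -> (0 <= diam V)%E.
Proof.
move=> [x Vx]; apply: ereal_sup_ubound; exists x, x; split=> //.
by rewrite subrr /enorm big1 ?sqrtr0// => i _; rewrite mxE expr0n.
Qed.

(** Sets of diameter 0 have to be given a positive size before stopping words of
    this size can be considered. *)
Lemma enlarged_size s (V : set 'rV[R]_d) (k : R) : 0 < s -> 0 < k -> (diam V <= (2^-1)%:E)%E ->
  exists e, [/\ 0 < e < 1, (diam V <= e%:E)%E & ((e `^ s)%:E <= diam_pow s V + k%:E)%E].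
Proof.
move=> s0 k0 dV.
have [d0|d0] := leP (diam V) 0%E.
  pose e := Num.min 2^-1 (k `^ s^-1).
  have e0 : 0 < e by rewrite lt_min invr_gt0 ltr0n powR_gt0.
  exists e; split.
  - by rewrite e0 /= gt_min; apply/orP; left; lra.
  - by apply: le_trans d0 _; rewrite lee_fin ltW.
  - apply: (@le_trans _ _ k%:E); last by rewrite leeDr// diam_pow_ge0.
    rewrite lee_fin; apply: (@le_trans _ _ ((k `^ s^-1) `^ s)).
      by apply: ge0_ler_powR; rewrite ?nnegrE ?(ltW s0) ?(ltW e0) ?powR_ge0// ge_min lexx orbT.
    by rewrite -powRrM mulVf ?gt_eqF// powRr1// ltW.
have : diam V \is a fin_num.
  by rewrite fin_numElt (lt_trans (ltNyr 0) d0)/= (le_lt_trans dV (ltry _)).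
move=> /fineK dE; set e := fine (diam V) in dE; rewrite -dE !lte_fin lee_fin in d0 dV *.
exists e; split=> //; first by rewrite d0; lra.
rewrite /diam_pow ifF -?dE ?poweR_EFin ?leeDl ?lee_fin ?(ltW k0)//.
apply/negbTE/negP => /eqP V0; have : diam V = -oo%E.
  rewrite V0 /diam (_ : [set _ | _] = set0) ?ereal_sup0//.
  by rewrite -subset0 => z [x [y []]].
by rewrite -dE.
Qed.

Variables (f1 f2 : 'rV[R]_d -> 'rV[R]_d) (r1 r2 : R).
Hypotheses (r1_gt0 : 0 < r1) (r1_lt_r2 : r1 < r2) (r2_lt1 : r2 < 1).
Hypotheses (sim1 : similarity r1 f1) (sim2 : similarity r2 f2).

Local Notation wr := (word_ratio r1 r2).
Local Notation pt := (orbit f1 f2).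

Variable U : set 'rV[R]_d.
Hypotheses (U0 : U !=set0) (Uo : open U) (Uf1 : f1 @` U `<=` U) (Uf2 : f2 @` U `<=` U).
Hypothesis Udisj : f1 @` U `&` f2 @` U = set0.

Lemma take_mkseq (z : nat -> bool) k l : (k <= l)%N -> take k (mkseq z l) = mkseq z k.
Proof. by move=> kl; rewrite -(subnKC kl) mkseq_addn take_size_cat// size_mkseq. Qed.

(** The mass distribution principle. A cover of small total size excludes, for each
    of its members V i, the block cylinders above the boundedly many stopping words
    of size e i that meet V i (packing_bound). Their mass mu^(-n) is at most
    mu (e i)^s, since a block multiplies the mass by 1 / mu <= x^s. If the total
    excluded mass is less than 1, there is a path that avoids all excluded
    cylinders, and its limit point is not covered. *)
Lemma cover_lower_bound (omega : edge -> bool) (s : R) L lang (m x : R) : 0 < s ->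
  uniq lang -> {in lang, forall w, size w = L} -> {in lang, forall w, x <= wr w} ->
  16 <= m -> 0 < x -> 2 <= m * x `^ s ->
  (forall h, survives L lang m h (labelling_of omega)) ->
  exists2 k : R, 0 < k & forall V : (set 'rV[R]_d)^nat,
    generated_set f1 f2 omega `<=` \bigcup_i V i -> (forall i, (diam (V i) <= (2^-1)%:E)%E) ->
    (k%:E <= \sum_(0 <= i <oo) diam_pow s (V i))%E.
Proof.
move=> s0 ul sl xl m16 x0 mx alive.
have [K hK] := packing_bound r1_gt0 r1_lt_r2 r2_lt1 sim1 sim2 Uf1 Uf2 Udisj U0 Uo.
pose mu := m / 2.
have mu0 : 0 < mu by rewrite divr_gt0//; lra.
have mux : 1 <= mu * x `^ s by rewrite /mu; lra.
have L0 : (0 < L)%N.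
  rewrite lt0n; apply/eqP => L0.
  have [G [uG mG hG]] := good_branching (R := R) (m := m) ul alive.
  have : (size G <= 1)%N.
    apply: (@uniq_leq_size _ G [:: [::]] uG) => w /hG[wl _].
    by rewrite inE -size_eq0 sl// L0.
  by rewrite -(ler_nat R); lra.
pose k := (4 * (K%:R + 1) * mu)^-1.
have K0 : 0 <= K%:R :> R by [].
have k0 : 0 < k by rewrite invr_gt0 !mulr_gt0//; lra.
exists k => // V cov dV; rewrite leNgt; apply/negP => small.
have kk i : 0 < k / (2 ^ (i + 1))%:R :> R by rewrite divr_gt0// ltr0n expn_gt0.
have /choice[e he] i := enlarged_size s0 (kk i) (dV i).
have /choice[N hN] i : exists N, forall w, stopping r1 r2 (e i) w -> (size w <= N)%N.
  by have [/andP[e0 _] _ _] := he i; exact: stopping_size.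
(* Q i w: the piece of w has size e i, meets V i and is coded by block words. *)
pose Q i w := stopping r1 r2 (e i) w /\ exists z y,
  [/\ mkseq z (size w) = w, pt z n @[n --> \oo] --> y, V i y &
      forall n, (n <= size w %/ L)%N -> mkseq (fun j => z (n * L + j)%N) L \in lang].
pose ws i := [seq w <- words_upto (N i) | `[< Q i w >]].
have wsP i w : w \in ws i -> Q i w by rewrite mem_filter => /andP[/asboolP].
have ws_size i : (size (ws i) <= K)%N.
  have [e01 de _] := he i; apply: (hK (e i) (V i)) => //.
    by rewrite filter_uniq// undup_uniq.
  by move=> w /wsP[sw [z [y [h1 h2 h3 _]]]]; split=> //; exists z, y.
pose Bad i := [seq take (size w %/ L * L) w | w <- ws i].
have block_wr z n : (forall j, (j < n)%N -> mkseq (fun i => z (j * L + i)%N) L \in lang) ->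
    x ^+ n <= wr (mkseq z (n * L)).
  elim: n => [|n IH] hz; first by rewrite /word_ratio word_weight_nil expr0.
  rewrite mulSn addnC mkseq_addn word_ratio_cat exprSr; apply: ler_pM; rewrite ?exprn_ge0 ?(ltW x0)//.
    by apply: IH => j jn; apply: hz; apply: ltn_trans jn _.
  exact/xl/hz.
have mass i w : w \in ws i -> mu ^- (size w %/ L) <= mu * e i `^ s.
  move=> /wsP[sw [z [y [zw _ _ zl]]]]; set n := (size w %/ L)%N.
  have [/andP[e0 e1] _ _] := he i.
  have h1 : x ^+ n.+1 <= e i.
    apply: le_trans (stopping_ratio_le sw); apply: le_trans (block_wr z n.+1 _) _.
      by move=> j jn; apply: zl; rewrite -ltnS.
    have lw : (size w <= n.+1 * L)%N by rewrite mulSn addnC ltnW// {1}(divn_eq (size w) L) ltn_add2l ltn_mod.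
    rewrite -[in leRHS]zw -(subnKC lw) mkseq_addn; exact: word_ratio_prefix.
  have h2 : (x `^ s) ^+ n.+1 <= e i `^ s.
    have -> : (x `^ s) ^+ n.+1 = (x ^+ n.+1) `^ s.
      by rewrite -powR_mulrn ?powR_ge0// -powRrM mulrC powRrM powR_mulrn ?(ltW x0).
    by apply: ge0_ler_powR; rewrite ?nnegrE ?exprn_ge0 ?(ltW x0) ?(ltW s0) ?(ltW e0).
  have h3 : mu ^- n.+1 <= (x `^ s) ^+ n.+1.
    rewrite -exprVn; apply: lerXn2r; rewrite ?nnegrE ?powR_ge0 ?invr_ge0 ?(ltW mu0)//.
    by rewrite -[leLHS]mul1r ler_pdivrMr// mulrC.
  have -> : mu ^- n = mu * mu ^- n.+1 by rewrite exprS invfM mulrA divff ?mul1r// gt_eqF.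
  by rewrite ler_pM2l//; exact: le_trans h3 h2.
pose Phi := bad_potential L mu Bad.
have Phi0 : (Phi [::] < 1)%E.
  have t1 i : bad_mass L mu Bad i [::] <= (K%:R * mu) * e i `^ s.
    rewrite /bad_mass (eq_bigl xpredT) => [|v]; last by rewrite prefix0s.
    rewrite big_map; apply: (@le_trans _ _ (\sum_(w <- ws i) mu * e i `^ s)).
      rewrite big_seq [leRHS]big_seq; apply: ler_sum => w wws.
      by rewrite size_takel ?leq_trunc_div// mulnK// mass.
    rewrite big_const_seq iter_addr_0 count_predT -[leLHS]mulr_natl mulrA.
    rewrite ler_wpM2r ?powR_ge0// ler_wpM2r ?(ltW mu0)// ler_nat; exact: ws_size.
  have Kmu : 0 <= K%:R * mu by rewrite mulr_ge0// ltW.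
  apply: (@le_lt_trans _ _ ((K%:R * mu)%:E * (\sum_(0 <= i <oo) (diam_pow s (V i) + (k / (2 ^ (i + 1))%:R)%:E)))%E).
    rewrite -nneseriesZl => [|i _]; last by rewrite adde_ge0 ?diam_pow_ge0// lee_fin ltW.
    apply: lee_nneseries => [i _ _|i _]; first by rewrite lee_fin bad_mass_ge0.
    apply: (@le_trans _ _ ((K%:R * mu)%:E * (e i `^ s)%:E)%E); first by rewrite -EFinM lee_fin.
    by apply: lee_wpmul2l; rewrite ?lee_fin//; have [] := he i.
  rewrite nneseriesD => [|i _ _|i _ _]; rewrite ?diam_pow_ge0 ?lee_fin ?(ltW (kk _))//.
  have -> : (\sum_(0 <= i <oo) (k / (2 ^ (i + 1))%:R)%:E = k%:E)%E.
    by have /cvg_lim := @cvg_geometric_eseries_half R k 0; rewrite expr0 divr1; apply.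
  apply: (@le_lt_trans _ _ ((K%:R * mu)%:E * (k%:E + k%:E))%E).
    by apply: lee_wpmul2l; rewrite ?lee_fin// leeD2r// ltW.
  have kE : 4 * (K%:R + 1) * mu * k = 1.
    by rewrite /k divff// gt_eqF// !mulr_gt0//; lra.
  have muk : 0 < mu * k by rewrite mulr_gt0.
  have -> : ((K%:R * mu)%:E * (k%:E + k%:E) = (2 * (K%:R * (mu * k)))%:E)%E.
    by rewrite -EFinD -EFinM; congr EFin; ring.
  rewrite lte_fin; have : 4 * (K%:R * (mu * k)) + 4 * (mu * k) = 1 by rewrite -[RHS]kE; ring.
  have : 0 <= K%:R * (mu * k) by rewrite mulr_ge0// ltW.
  by lra.
have super u G : uniq G -> {in G, forall w, w \in lang} ->
   (\sum_(w <- G) Phi (u ++ w) <= Phi u)%E.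
  move=> uG Gl; apply: bad_potential_super => // w wG; exact/sl/Gl.
have m0 : 0 < m by lra.
have [xi hxi] := potential_path ul m0 super L0 alive Phi0.
pose z := path_labels omega xi.
have zblock n : mkseq (fun j => z (n * L + j)%N) L \in lang.
  have [_ [_]] := hxi n.
  have := path_word_mkseq omega xi (n * L + L); rewrite !mkseq_addn path_word_cat path_word_mkseq.
  by move/eqP; rewrite eqseq_cat// eqxx /= => /eqP ->.
have zPhi n : (Phi (mkseq z (n * L)) < (mu ^- n)%:E)%E.
  by have [h _] := hxi n; rewrite path_word_mkseq in h.
have [y zy] := proj1 (cvg_ex _) (orbit_cvg r1_gt0 r1_lt_r2 r2_lt1 sim1 sim2 (z := z)).
have [i _ Vy] : (\bigcup_i V i) y by apply: cov; exists xi.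
have [e01 _ _] := he i.
have [n sn] := stopping_exists r1_gt0 r1_lt_r2 r2_lt1 z e01.
have nws : mkseq z n \in ws i.
  rewrite mem_filter mem_words_upto hN// andbT; apply/asboolP; split=> //.
  by exists z, y; rewrite size_mkseq; split.
have : mkseq z (n %/ L * L) \in Bad i.
  apply/mapP; exists (mkseq z n) => //.
  by rewrite size_mkseq take_mkseq// leq_trunc_div.
move=> /(bad_potential_ge L mu0); rewrite size_mkseq mulnK// -/(Phi _) leNgt.
by rewrite zPhi.
Qed.

Lemma ler_sum_sub (I : eqType) (s1 s2 : seq I) (F : I -> R) : uniq s1 ->
  {subset s1 <= s2} -> (forall i, 0 <= F i) -> \sum_(i <- s1) F i <= \sum_(i <- s2) F i.
Proof.
move=> + + F0; elim: s1 s2 => [|i s1 IH] s2 /=; first by rewrite big_nil sumr_ge0.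
move=> /andP[i1 u1] child; have i2 : i \in s2 by apply: child; rewrite inE eqxx.
rewrite big_cons (perm_big _ (perm_to_rem i2)) big_cons lerD2l; apply: IH => // j j1.
have := child j; rewrite inE j1 orbT => /(_ isT); rewrite (perm_mem (perm_to_rem i2)) inE.
by case: eqP => [e|//]; rewrite e in j1; rewrite j1 in i1.
Qed.

(** The pieces of the occurring stopping words of size e form a cover. Each of these
    words contributes at least (r1 e)^s to the convergent series, which bounds their
    number by a multiple of e^(-s). *)
Lemma cover_upper_bound (omega : edge -> bool) (s T : R) : 0 < s ->
  (forall n, \sum_(0 <= k < n) \sum_(w <- words k) (occurs (labelling_of omega) w)%:R * wr w `^ s <= T) ->
  exists C : R, forall e, 0 < e < 2^-1 -> exists (n : nat) (V : 'I_n -> set 'rV[R]_d),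
    [/\ n%:R <= C * e `^ (- s), (forall i, (diam (V i) <= e%:E)%E) &
        generated_set f1 f2 omega `<=` \bigcup_i V i].
Proof.
move=> s0 hT.
pose B := orbit_radius f1 f2 r2.
have B0 : 0 <= B := orbit_radius_ge0 f1 f2 r2_lt1.
pose c := norm_ratio (R := R) (d := d).
have c0 : 0 < c := norm_ratio_gt0.
pose C1 := c * (2 * B) + 1.
have cB : 0 <= c * (2 * B) by rewrite mulr_ge0 ?(ltW c0)// mulr_ge0.
have C10 : 0 < C1 by rewrite /C1; lra.
exists (T * (r1 / C1) `^ (- s)) => e /andP[e0 e2].
pose e' := e / C1.
have e'0 : 0 < e' by rewrite divr_gt0.
have e'C : e' * C1 = e by rewrite divfK// gt_eqF.
have e'1 : e' < 1 by rewrite /C1 in e'C; nra.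
have [N hN] := stopping_size r1_gt0 r1_lt_r2 r2_lt1 e'0.
pose c' := labelling_of omega.
pose ws := [seq w <- words_upto N | stopping r1 r2 e' w && occurs c' w].
pose V (i : 'I_(size ws)) := [set x : 'rV[R]_d | exists z,
   mkseq z (size (nth [::] ws i)) = nth [::] ws i /\ pt z n @[n --> \oo] --> x].
exists (size ws), V; split.
- have h : (size ws)%:R * (r1 * e') `^ s <= T.
    apply: le_trans (hT N.+1).
    apply: (@le_trans _ _ (\sum_(w <- ws) (occurs c' w)%:R * wr w `^ s)).
      rewrite -[size ws]count_predT mulr_natl -[leLHS]iter_addr_0 -big_const_seq.
      rewrite big_seq [leRHS]big_seq; apply: ler_sum => w; rewrite mem_filter => /andP[/andP[sw ->] _].
      have re0 : 0 <= r1 * e' by rewrite mulr_ge0 ?(ltW e'0) ?(ltW r1_gt0).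
      have w0 := ltW (word_ratio_gt0 r1_gt0 r1_lt_r2 w).
      rewrite mul1r; apply: ge0_ler_powR; rewrite ?nnegrE ?(ltW s0)//.
      exact: ltW (stopping_ratio_gt r1_gt0 r1_lt_r2 e'1 sw).
    have -> : \sum_(0 <= k < N.+1) \sum_(w <- words k) (occurs c' w)%:R * wr w `^ s =
       \sum_(w <- flatten [seq words k | k <- iota 0 N.+1]) (occurs c' w)%:R * wr w `^ s.
      by rewrite big_flatten big_map /index_iota subn0.
    apply: ler_sum_sub => [|w|w]; first by rewrite filter_uniq// undup_uniq.
      by rewrite mem_filter mem_undup => /andP[].
    by rewrite mulr_ge0// powR_ge0.
  have re : r1 * e' = r1 / C1 * e by rewrite /e'; ring.
  have rC : 0 < r1 / C1 by rewrite divr_gt0.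
  have -> : T * (r1 / C1) `^ (- s) * e `^ (- s) = T / (r1 * e') `^ s.
    by rewrite -mulrA -powRM ?(ltW rC) ?(ltW e0)// -re powRN.
  by rewrite ler_pdivlMr// powR_gt0// mulr_gt0.
- move=> i; apply: ge_ereal_sup => _ [x [y [[z [zw zx]] [z' [zw' zy]] ->]]]; rewrite lee_fin.
  have : nth [::] ws i \in ws by rewrite mem_nth.
  rewrite mem_filter => /andP[/andP[/stopping_ratio_le sw _] _].
  have h1 := orbit_limit_dist r1_gt0 r1_lt_r2 r2_lt1 sim1 sim2 (size (nth [::] ws i)) zx.
  have h2 := orbit_limit_dist r1_gt0 r1_lt_r2 r2_lt1 sim1 sim2 (size (nth [::] ws i)) zy.
  rewrite /orbit zw in h1; rewrite /orbit zw' in h2.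
  have hB : wr (nth [::] ws i) * B <= e' * B by rewrite ler_wpM2r.
  apply: le_trans (enorm_le_norm _) _.
  apply: (@le_trans _ _ (c * (e' * B + e' * B))).
    rewrite ler_pM2l//; set p := word_map f1 f2 _ 0 in h1 h2.
    have -> : x - y = (p - y) - (p - x) by rewrite opprB [RHS]addrC addrA subrK.
    by apply: le_trans (ler_normB _ _) _; apply: lerD; [exact: le_trans h2 hB|exact: le_trans h1 hB].
  by rewrite -e'C /C1; nra.
- move=> x [xi hx].
  have [n sn] := stopping_exists r1_gt0 r1_lt_r2 r2_lt1 (path_labels omega xi) (introT andP (conj e'0 e'1)).
  set w := mkseq _ n in sn.
  have wws : w \in ws.
    rewrite mem_filter sn mem_words_upto hN// andbT; apply/occursP; exists (mkseq xi n).
    exact: path_word_mkseq.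
  have iw : (index w ws < size ws)%N by rewrite index_mem.
  exists (Ordinal iw) => //; exists (path_labels omega xi).
  by rewrite /= nth_index// size_mkseq.
Qed.

End Covers.

(** * Dimensions from covers *)

Section DimensionFromCovers.
Context {R : realType} {d : nat}.
Implicit Types (A : set 'rV[R]_d) (s D : R).

(** The conclusion of the mass distribution principle; it gives Hausdorff dimension
    at least s. *)
Definition mass_bound s A := exists2 k : R, 0 < k & forall V : (set 'rV[R]_d)^nat,
  A `<=` \bigcup_i V i -> (forall i, (diam (V i) <= (2^-1)%:E)%E) ->
  (k%:E <= \sum_(0 <= i <oo) diam_pow s (V i))%E.

(** Upper box dimension at most s, with a constant; it bounds the Hausdorff
    dimension as well. *)
Definition box_bound s A := exists C : R, forall e, 0 < e < 2^-1 ->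
  exists (n : nat) (V : 'I_n -> set 'rV[R]_d),
    [/\ n%:R <= C * e `^ (- s), (forall i, (diam (V i) <= e%:E)%E) &
        A `<=` \bigcup_i V i].

Lemma diam_set0 : diam (set0 : set 'rV[R]_d) = -oo%E.
Proof.
rewrite /diam (_ : [set _ | _] = set0) ?ereal_sup0//.
by rewrite -subset0 => z [x [y []]].
Qed.

Lemma diam_pow_set0 s : diam_pow s (set0 : set 'rV[R]_d) = 0%E.
Proof. by rewrite /diam_pow eqxx. Qed.

Lemma diam_fine (V : set 'rV[R]_d) e : V !=set0 -> (diam V <= e%:E)%E ->
  exists2 x : R, 0 <= x <= e & diam V = x%:E.
Proof.
move=> V0 dV; have d0 := diam_ge0 V0.
have /fineK fE : diam V \is a fin_num.
  by rewrite fin_numElt (lt_le_trans (ltNyr 0) d0)/= (le_lt_trans dV (ltry _)).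
by exists (fine (diam V)) => //; rewrite -!lee_fin fE d0.
Qed.

Lemma diam_pow_le s (V : set 'rV[R]_d) (e : R) : 0 <= s -> 0 <= e -> (diam V <= e%:E)%E ->
  (diam_pow s V <= (e `^ s)%:E)%E.
Proof.
move=> s0 e0 dV; rewrite /diam_pow; case: eqP => [_|/eqP/set0P V0].
  by rewrite lee_fin powR_ge0.
have [x /andP[x0 xe] ->] := diam_fine V0 dV.
by rewrite poweR_EFin lee_fin; apply: ge0_ler_powR.
Qed.

Lemma diam_pow_decr s s' (V : set 'rV[R]_d) : 0 <= s' -> s' <= s -> 0 < s ->
  (diam V <= (2^-1)%:E)%E -> (diam_pow s V <= diam_pow s' V)%E.
Proof.
move=> s'0 ss' s0 dV; rewrite /diam_pow; case: eqP => // /eqP/set0P V0.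
have [x /andP[x0 x2] ->] := diam_fine V0 dV.
rewrite !poweR_EFin lee_fin.
case: (ltgtP 0 x) x0 => // [x_gt0 _|<- _]; last by rewrite [0 `^ s]powR0 ?powR_ge0// gt_eqF.
by apply: ger_powR => //; rewrite x_gt0; lra.
Qed.

Lemma content_ge0 s e A : (0 <= hausdorff_content s e A)%E.
Proof.
apply/ereal_infP => _ [V _ <-]; apply: nneseries_ge0 => i _ _; exact: diam_pow_ge0.
Qed.

Lemma hausdorff_dim_ge D A : (forall s, 0 < s < D -> mass_bound s A) ->
  (D%:E <= hausdorff_dim A)%E.
Proof.
move=> mb; apply/ereal_infP => _ [s' [s'0 H0] <-]; rewrite lee_fin leNgt; apply/negP => s'D.
have [k k0 hk] : mass_bound ((s' + D) / 2) A by apply: mb; lra.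
suff : (k%:E <= hausdorff_measure s' A)%E by rewrite H0 lee_fin leNgt k0.
apply: (@le_trans _ _ (hausdorff_content s' 2^-1 A)); last first.
  by apply: ereal_sup_ubound; exists 2^-1 => //=; rewrite invr_gt0.
apply/ereal_infP => _ [V [cov dV] <-]; apply: le_trans (hk V cov dV) _.
apply: lee_nneseries => [i _ _|i _]; first exact: diam_pow_ge0.
by apply: diam_pow_decr => //; lra.
Qed.

Lemma hausdorff_measure_eq0 s s' A : 0 < s' -> s' < s -> box_bound s' A ->
  hausdorff_measure s A = 0%E.
Proof.
move=> s'0 ss' [C hC]; apply/eqP; rewrite eq_le; apply/andP; split; last first.
  apply: (@le_trans _ _ (hausdorff_content s 1 A)); first exact: content_ge0.
  by apply: ereal_sup_ubound; exists 1 => //=.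
apply/ereal_supP => _ [/= delta d0 <-]; apply/lee_addgt0Pr => eps eps0; rewrite add0e.
pose a := (eps / (`|C| + 1)) `^ (s - s')^-1.
have C1 : 0 < `|C| + 1 by rewrite ltr_wpDl.
have a0 : 0 < a by rewrite powR_gt0// divr_gt0.
pose e := Num.min (Num.min delta a) 4^-1.
have e0 : 0 < e by rewrite !lt_min d0 a0 invr_gt0 ltr0n.
have ea : e <= a by rewrite !ge_min lexx orbT.
have ed : e <= delta by rewrite !ge_min lexx.
have e4 : e <= 4^-1 by rewrite ge_min lexx orbT.
have [|n [V [nC dV cov]]] := hC e; first by rewrite e0/=; lra.
pose W i := if insub i is Some j then V j else set0.
have W0 i : (n <= i)%N -> W i = set0 by move=> ni; rewrite /W insubF// ltnNge ni.
apply: (@le_trans _ _ (\sum_(0 <= i <oo) diam_pow s (W i))%E).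
  apply: ereal_inf_lbound; exists W => //; split.
    move=> x /cov[j _ Vx]; exists (val j) => //; rewrite /W valK; exact: Vx.
  move=> i; rewrite /W; case: insubP => [j _ _|_]; last by rewrite diam_set0 leNye.
  by apply: le_trans (dV j) _; rewrite lee_fin.
have s0 : 0 < s by lra.
rewrite (@nneseries_split _ _ 0%N n) => [|i _]; last exact: diam_pow_ge0.
rewrite add0n [X in (_ + X)%E]eseries0 ?adde0 => [|i ni _]; last by rewrite W0// diam_pow_set0.
apply: (@le_trans _ _ (\sum_(0 <= i < n) (e `^ s)%:E)%E).
  apply: lee_sum => i _; apply: diam_pow_le; rewrite ?(ltW s0) ?(ltW e0)//.
  by rewrite /W; case: insubP => [j _ _|_]; rewrite ?diam_set0 ?leNye.
rewrite sumEFin big_const_nat subn0 iter_addr_0 lee_fin -mulr_natl.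
apply: (@le_trans _ _ (C * e `^ (- s') * e `^ s)); first by rewrite ler_wpM2r ?powR_ge0.
rewrite -mulrA -powRD ?(gt_eqF e0) ?implybT// addrC.
apply: (@le_trans _ _ ((`|C| + 1) * a `^ (s - s'))).
  apply: (@le_trans _ _ ((`|C| + 1) * e `^ (s - s'))).
    by rewrite ler_wpM2r ?powR_ge0//; have := ler_norm C; lra.
  rewrite ler_pM2l//; apply: ge0_ler_powR; rewrite ?nnegrE ?(ltW e0) ?(ltW a0)//; lra.
by rewrite -powRrM mulVf ?powRr1 ?divr_ge0 ?(ltW eps0) ?(ltW C1)//; [rewrite mulrC divfK// gt_eqF|rewrite gt_eqF//; lra].
Qed.

Lemma hausdorff_dim_le D A : 0 <= D -> (forall s, D < s -> box_bound s A) ->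
  (hausdorff_dim A <= D%:E)%E.
Proof.
move=> D0 ub; apply/lee_addgt0Pr => e e0; rewrite -EFinD.
apply: ereal_inf_lbound; exists (D + e) => //; split; first by rewrite addr_ge0// ltW.
by apply: (@hausdorff_measure_eq0 _ (D + e / 2)); try lra; apply: ub; lra.
Qed.

Lemma hausdorff_dim_eq D A : 0 <= D -> (forall s, 0 < s < D -> mass_bound s A) ->
  (forall s, D < s -> box_bound s A) -> hausdorff_dim A = D%:E.
Proof.
move=> D0 lb ub; apply/eqP.
by rewrite eq_le hausdorff_dim_ge// hausdorff_dim_le.
Qed.

Lemma hausdorff_dim_set1 (x : 'rV[R]_d) : hausdorff_dim [set x] = 0%E.
Proof.
apply: hausdorff_dim_eq => // s; first by lra.
move=> s0; exists 1 => e /andP[e0 e2]; exists 1%N, (fun=> [set x]); split.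
- by rewrite mul1r -[1%:R](powRr0 e); apply: ger_powR; rewrite ?e0; lra.
- move=> _; apply/ereal_supP => _ [y [z [-> -> ->]]].
  by rewrite lee_fin subrr /enorm big1 ?sqrtr0 ?(ltW e0)// => i _; rewrite mxE expr0n.
- by move=> y ->; exists ord0.
Qed.

Lemma covering_number_bounds s s' A : 0 < s -> mass_bound s A -> box_bound s' A ->
  exists k C : R, 0 < k /\ forall e, 0 < e < 2^-1 -> exists N : R,
    covering_number e A = N%:E /\ k * e `^ (- s) <= N <= C * e `^ (- s').
Proof.
move=> s0 [k k0 hk] [C hC]; exists k, C; split=> // e e02; have /andP[e0 e2] := e02.
have lb : ((k * e `^ (- s))%:E <= covering_number e A)%E.
  apply/ereal_infP => _ [n [V [dV cov]] <-].
  pose W i := if insub i is Some j then V j else set0.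
  have dW i : (diam (W i) <= e%:E)%E.
    by rewrite /W; case: insubP => [j _ _|_]; rewrite ?diam_set0 ?leNye.
  have : (k%:E <= \sum_(0 <= i <oo) diam_pow s (W i))%E.
    apply: hk => [x /cov[j _ Vx]|i].
      by exists (val j) => //; rewrite /W valK; exact: Vx.
    by apply: le_trans (dW i) _; rewrite lee_fin ltW.
  have W0 i : (n <= i)%N -> W i = set0 by move=> ni; rewrite /W insubF// ltnNge ni.
  rewrite (@nneseries_split _ _ 0%N n) => [|i _]; last exact: diam_pow_ge0.
  rewrite add0n [X in (_ + X)%E]eseries0 ?adde0 => [h|i ni _]; last by rewrite W0// diam_pow_set0.
  have : (k%:E <= \sum_(0 <= i < n) (e `^ s)%:E)%E.
    apply: le_trans h _; apply: lee_sum => i _.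
    by apply: diam_pow_le; rewrite ?(ltW s0) ?(ltW e0).
  rewrite sumEFin big_const_nat subn0 iter_addr_0 !lee_fin -[in leRHS]mulr_natl powRN => h'.
  by rewrite ler_pdivrMr// powR_gt0.
have [n [V [nC dV cov]]] := hC e e02.
have ub : (covering_number e A <= (n%:R)%:E)%E.
  by apply: ereal_inf_lbound; exists n => //; exists V.
have fN : covering_number e A \is a fin_num.
  by rewrite fin_numElt (lt_le_trans (ltNyr _) lb)/= (le_lt_trans ub (ltry _)).
exists (fine (covering_number e A)); rewrite fineK//; split=> //.
rewrite -!lee_fin fineK// lb/=; apply: le_trans ub _; by rewrite lee_fin.
Qed.

(** Up to constants the covering number lies between e^(-(D - h)) and e^(-(D + h)),
    and the logarithms of the constants are negligible against ln e. *)
Lemma has_box_dimI D A : 0 < D -> (forall s, 0 < s < D -> mass_bound s A) ->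
  (forall s, D < s -> box_bound s A) -> has_box_dim A D%:E.
Proof.
move=> D0 lb ub.
have main eps : 0 < eps -> \forall e \near (0 : R)^'+, exists y : R,
   (lne (covering_number e A) * ((- ln e)^-1)%:E)%E = y%:E /\ `|D - y| <= eps.
  move=> eps0; pose h := Num.min (eps / 2) (D / 2).
  have h0 : 0 < h by rewrite lt_min !divr_gt0.
  have he : h <= eps / 2 by rewrite ge_min lexx.
  have hD : h <= D / 2 by rewrite ge_min lexx orbT.
  have [|||k [C [k0 kC]]] := @covering_number_bounds (D - h) (D + h) A.
  - by lra.
  - by apply: lb; lra.
  - by apply: ub; lra.
  pose M := (`|ln k| + `|ln C| + 1) / (eps / 2).
  have M0 : 0 < M by rewrite divr_gt0 ?ltr_wpDl ?addr_ge0//; lra.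
  near=> e.
  have e0 : 0 < e by near: e; exact: nbhs_right_gt.
  have e2 : e < 2^-1 by near: e; apply: nbhs_right_lt; rewrite invr_gt0.
  have eM : e < expR (- M) by near: e; apply: nbhs_right_lt; exact: expR_gt0.
  have {}eM : M < - ln e by rewrite ltrNr -[X in _ < X]expRK ltr_ln ?posrE ?expR_gt0.
  have l0 : 0 < - ln e := lt_trans M0 eM.
  have [N [NE /andP[kN NC]]] := kC e ltac:(by rewrite e0).
  have p0 a : 0 < e `^ a by exact: powR_gt0.
  have N0 : 0 < N by apply: lt_le_trans kN; rewrite mulr_gt0.
  have C0 : 0 < C by have := lt_le_trans N0 NC; rewrite pmulr_lgt0.
  exists (ln N / (- ln e)); rewrite NE lne_EFin// -EFinM; split=> //.
  have lnE K a : 0 < K -> ln (K * e `^ (- a)) = ln K + a * - ln e.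
    by move=> K0; rewrite lnM ?posrE// ln_powR mulNr mulrN.
  have kN' : ln k + (D - h) * - ln e <= ln N.
    by rewrite -lnE// ler_ln ?posrE ?mulr_gt0.
  have NC' : ln N <= ln C + (D + h) * - ln e.
    by rewrite -lnE// ler_ln ?posrE ?mulr_gt0.
  have eML : `|ln k| + `|ln C| + 1 < - ln e * (eps / 2) by rewrite -ltr_pdivrMr//; lra.
  have hle : h * - ln e <= eps / 2 * - ln e by rewrite ler_pM2r.
  have := ler_norm (ln C); have := ler_norm (- ln k); rewrite normrN => k1 C1.
  have := normr_ge0 (ln C); have := normr_ge0 (ln k) => k2 C2.
  have qE : ln N / - ln e * - ln e = ln N by rewrite divfK// gt_eqF.
  set q := ln N / - ln e in qE *.
  have h1 : (D - eps) * - ln e <= q * - ln e by rewrite qE; lra.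
  have h2 : q * - ln e <= (D + eps) * - ln e by rewrite qE; lra.
  rewrite ler_pM2r// in h1; rewrite ler_pM2r// in h2.
  by rewrite ler_norml; lra.
apply/fine_cvgP; split.
  by apply: filterS (main 1 ltr01) => e [y [-> _]].
apply/cvgrPdist_le => eps eps0; apply: filterS (main eps eps0) => e [y [E hy]].
by rewrite /= E.
Unshelve. all: end_near.
Qed.

End DimensionFromCovers.

(** * From finite expectations to the probability space *)

Section RandomLabels.
Context {R : realType} {disp : measure_display} {T : measurableType disp}.
Variables (P : probability T R) (p : R) (omega : edge -> {RV P >-> bool}).
Hypothesis p01 : 0 <= p <= 1.
Hypothesis iid : iid_labels p omega.

Definition config (t : T) : labelling := labelling_of (fun e => omega e t).

Definition cylinder n (c : labelling) : set T :=
  \bigcap_(e in [set` edges n]) omega e @^-1` [set c e.1 e.2].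

Lemma cylinder_measurable n c : measurable (cylinder n c).
Proof. by apply: fin_bigcap_measurable => // e _; exact: measurable_funPTI. Qed.

(** Mutual independence, applied to the edges of the first n levels. *)
Lemma cylinder_prob n c : P (cylinder n c) = (tree_weight (fun _ _ => lprob p) n c)%:E.
Proof.
have [ind law] := iid.
rewrite /cylinder (ind (edges n) (fun e => [set c e.1 e.2])) ?edges_uniq// /tree_weight -prodEFin.
apply: eq_bigr => e _; have [lt lf] := law e.
by case: (c e.1 e.2).
Qed.

Lemma config_sum n (f : labelling -> R) t : depends_upto n f ->
  f (config t) = \sum_(c <- confs n) f c * \1_(cylinder n c) t.
Proof.
move=> df; rewrite -[LHS](tree_sum_eval (config t) df) /tree_sum.
apply: eq_bigr => c _; rewrite mulrC indicE; congr (_ * _).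
rewrite /tree_weight; have [tc|tc] := boolP (t \in cylinder n c).
  move/set_mem: tc => tc; rewrite big_seq big1// => -[u b] ub /=.
  by rewrite (_ : config t u b = c u b) ?eqxx//; exact: (tc (u, b) ub).
apply/eqP; rewrite prodf_seq_eq0; apply/hasP.
move: tc => /negP; rewrite in_setE => /existsNP[[u b] /not_implyP[ub h]].
exists (u, b); first exact: ub.
have -> : (config t u b == c u b) = false by apply/eqP => h'; exact: h h'.
by rewrite /= eqxx.
Qed.

Lemma config_measurable n (f : labelling -> R) : depends_upto n f ->
  measurable_fun setT (fun t => f (config t)).
Proof.
move=> df; rewrite (_ : (fun t => _) = (fun t => \sum_(c <- confs n) f c * \1_(cylinder n c) t)).
  apply: measurable_sum => c; apply: measurable_funM => //.
  exact/measurable_indic/cylinder_measurable.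
by apply/funext => t; exact: config_sum.
Qed.

Lemma config_expectation n (f : labelling -> R) : depends_upto n f -> (forall c, 0 <= f c) ->
  (\int[P]_t (f (config t))%:E = (mean p n f)%:E)%E.
Proof.
move=> df f0.
transitivity (\int[P]_t (\sum_(c <- confs n) (f c)%:E * (\1_(cylinder n c) t)%:E))%E.
  by apply: eq_integral => t _; rewrite (config_sum t df) -sumEFin.
rewrite ge0_integral_sum//; last 2 first.
- move=> c; apply: measurable_funeM; apply/measurable_EFinP.
  exact/measurable_indic/cylinder_measurable.
- by move=> c t _; rewrite -EFinM lee_fin mulr_ge0.
rewrite /mean /tree_sum -sumEFin; apply: eq_bigr => c _.
rewrite ge0_integralZl ?lee_fin//; last first.
  by apply/measurable_EFinP; exact/measurable_indic/cylinder_measurable.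
rewrite integral_indic//; last exact: cylinder_measurable.
transitivity ((f c)%:E * P (cylinder n c))%E; first by rewrite setIT.
by rewrite cylinder_prob -EFinM mulrC.
Qed.

Lemma config_event n (Q : pred labelling) : depends_upto n Q ->
  measurable [set t | Q (config t)] /\ P [set t | Q (config t)] = (mean p n (fun c => (Q c)%:R))%:E.
Proof.
move=> dQ; have dQ' : depends_upto n (fun c => (Q c)%:R : R) by move=> c c' e; rewrite (dQ c c').
have mQ : measurable [set t | Q (config t)].
  rewrite (_ : [set t | _] = (fun t => (Q (config t))%:R : R) @^-1` [set 1]).
    by rewrite -[X in measurable X]setTI; apply: (config_measurable dQ') => //; exact: measurable_set1.
  apply/seteqP; split => t /=; first by move=> ->.
  by case: (Q _) => //= /esym/eqP; rewrite oner_eq0.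
split=> //; rewrite -config_expectation//.
rewrite -[X in P X]setIT -(integral_indic P measurableT)//; apply: eq_integral => t _.
by congr EFin; rewrite indicE; congr (nat_of_bool _)%:R; apply/idP/idP; rewrite in_setE.
Qed.

(** By monotone convergence the sum of the series has finite expectation. *)
Lemma ae_bounded_sums (f : nat -> labelling -> R) (g : R) : 0 < g < 1 ->
  (forall n c, 0 <= f n c) -> (forall n, depends_upto n (f n)) ->
  (forall n, mean p n (f n) <= g ^+ n) ->
  {ae P, forall t, exists S : R, forall n, \sum_(0 <= k < n) f k (config t) <= S}.
Proof.
move=> /andP[g0 g1] f0 df fg.
pose F t : \bar R := (\sum_(0 <= k <oo) (f k (config t))%:E)%E.
have mf k : measurable_fun setT (fun t => (f k (config t))%:E).
  by apply/measurable_EFinP; exact: config_measurable (df k).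
have F0 t : (0 <= F t)%E by apply: nneseries_ge0 => k _ _; rewrite lee_fin.
have : P.-integrable setT F.
  apply/integrableP; split.
    by apply: ge0_emeasurable_sum => // k t _ _; rewrite lee_fin.
  under eq_integral => t _ do rewrite gee0_abs//.
  rewrite integral_nneseries// => [|k t _]; last by rewrite lee_fin.
  apply: (@le_lt_trans _ _ (1 / (1 - g))%:E); last exact: ltry.
  have h k : (\int[P]_t (f k (config t))%:E = (mean p k (f k))%:E)%E by exact: config_expectation.
  under eq_eseriesr => k _ do rewrite h.
  apply: lime_le.
    by apply: is_cvg_nneseries => k _ _; rewrite lee_fin mean_ge0.
  near=> n; rewrite sumEFin lee_fin.
  apply: le_trans (geometric_le_lim n ler01 g0 _); last by rewrite ger0_norm// ltW.
  rewrite /series/= !big_mkord; apply: ler_sum => k _; rewrite /= mul1r.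
  exact: fg.
move=> /(integrable_ae measurableT); apply: filterS => t /(_ I) Ft.
exists (fine (F t)) => n; rewrite -lee_fin fineK// -sumEFin.
by apply: nneseries_lim_ge => k _ _; rewrite lee_fin.
Unshelve. all: end_near.
Qed.

(** By continuity from above, the event that S i holds for all h has probability at
    least 1 - e i; the union over i has probability 1 as e i becomes arbitrarily
    small. *)
Lemma ae_eventually_surv (S : nat -> nat -> pred labelling) (N : nat -> nat -> nat) (e : nat -> R) :
  (forall i h, depends_upto (N i h) (S i h)) ->
  (forall i h c, S i h.+1 c -> S i h c) ->
  (forall i h, 1 - e i <= mean p (N i h) (fun c => (S i h c)%:R)) ->
  (forall d : R, 0 < d -> exists i, e i <= d) ->
  {ae P, forall t, exists i, forall h, S i h (config t)}.
Proof.
move=> dS SS eS e0.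
pose A i h := [set t | S i h (config t)].
have mA i h : measurable (A i h) by have [] := config_event (dS i h).
have mB i : measurable (\bigcap_h A i h) by exact: bigcap_measurable.
have PB i : ((1 - e i)%:E <= P (\bigcap_h A i h))%E.
  have dec : {homo A i : n m / (n <= m)%N >-> (m <= n)%O}.
    apply/nonincreasing_seqP => h; apply/subsetPset => t; exact: SS.
  have c := nonincreasing_cvg_mu (le_lt_trans (probability_le1 P (mA i 0%N)) (ltry 1)) (mA i) (mB i) dec.
  rewrite -(cvg_lim _ c)//; apply: lime_ge; first by apply/cvg_ex; eexists; exact: c.
  by near=> h; have [_ /= ->] := config_event (dS i h); rewrite lee_fin eS.
have mC : measurable (\bigcup_i \bigcap_h A i h) by exact: bigcup_measurable.
exists (~` (\bigcup_i \bigcap_h A i h)); split.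
- exact: measurableC.
- apply/eqP; rewrite eq_le measure_ge0 andbT; apply/lee_addgt0Pr => d d0; rewrite add0e.
  have [i ei] := e0 d d0.
  apply: (@le_trans _ _ (P (~` (\bigcap_h A i h)))).
    apply: le_measure; rewrite ?inE; [exact: measurableC|exact: measurableC|].
    by move=> t h1 h2; apply: h1; exists i.
  rewrite probability_setC// leeBlDr; last exact: fin_num_measure.
  apply: (@le_trans _ _ (d%:E + (1 - e i)%:E)%E); last by rewrite leeD2l.
  by rewrite -EFinD lee_fin; lra.
- by apply: subsetC => t [i _ h]; exists i => k; exact: h.
Unshelve. all: end_near.
Qed.

End RandomLabels.

(** * Above and below the critical exponent *)

Section CriticalExponent.
Context {R : realType}.
Variables r1 r2 p : R.
Hypotheses (r1_gt0 : 0 < r1) (r1_lt_r2 : r1 < r2) (r2_lt1 : r2 < 1).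
Hypothesis p01 : 0 < p < 1.

Let p01w : 0 <= p <= 1. Proof. by case/andP: p01 => h1 h2; rewrite !ltW. Qed.

(** The expected number of vertices that carry w bounds the probability that there is
    one. *)
Lemma occ_prob_le_mean w : occ_prob p w <= word_weight (fun a => 2 * lprob p a) w.
Proof.
elim: w => [|a w IH]; first by rewrite word_weight_nil occ_prob_le1.
have l0 := lprob_gt0 p01 a; have f0 := occ_prob_ge0 p01w w.
rewrite occ_prob_cons word_weight_cons.
apply: (@le_trans _ _ (2 * lprob p a * occ_prob p w)); first by rewrite expr2; nra.
by rewrite ler_pM2l// mulr_gt0.
Qed.

Lemma occ_prob_le_mean_powR t w : 0 <= t <= 1 -> occ_prob p w <= word_weight (fun a => 2 * lprob p a) w `^ t.
Proof.
move=> /andP[t0 t1]; set M := word_weight _ w.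
have M0 : 0 < M by apply: word_weight_gt0 => a; rewrite mulr_gt0// lprob_gt0.
case: (leP M 1) => M1.
  apply: le_trans (occ_prob_le_mean w) _; rewrite -/M -[leLHS](powRr1 (ltW M0)).
  by apply: ger_powR => //; rewrite M0.
apply: le_trans (occ_prob_le1 p01w w) _; rewrite -[leLHS](powRr0 M).
by apply: ler_powR => //; exact: ltW.
Qed.

Lemma weight_powR t s a : weight r1 r2 p t s a = (2 * lprob p a) `^ t * lratio r1 r2 a `^ s.
Proof.
rewrite /weight expRD !powR_expR//; first exact: lratio_gt0.
by rewrite mulr_gt0// lprob_gt0.
Qed.

(** Interpolating occ_prob <= 1 and occ_prob_le_mean bounds the expected s-weight of
    the occurring words by the sum of the tilted weights, which is less than 1 for
    s > D. *)
Lemma occurring_weight_decay D s : critical r1 r2 p D -> D < s ->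
  exists2 g : R, 0 < g < 1 & forall n,
    \sum_(w <- words n) occ_prob p w * word_ratio r1 r2 w `^ s <= g ^+ n.
Proof.
move=> [t [t01 wD _]] Ds.
have dec a : weight r1 r2 p t s a < weight r1 r2 p t D a.
  rewrite /weight ltr_expR ltrD2l ltr_nM2r//; apply: ln_lt0.
  by rewrite lratio_gt0 ?lratio_lt1.
exists (weight r1 r2 p t s true + weight r1 r2 p t s false).
  by rewrite addr_gt0 ?expR_gt0//= -wD; apply: ltrD.
move=> n; rewrite -sum_word_weight; apply: ler_sum => w _.
rewrite (@eq_word_weight _ _ (fun a => (2 * lprob p a) `^ t * lratio r1 r2 a `^ s)); last exact: weight_powR.
rewrite word_weight_mul !word_weight_powR => [||a]; last by rewrite mulr_ge0// ltW// lprob_gt0.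
  by rewrite ler_wpM2r ?powR_ge0// occ_prob_le_mean_powR.
by move=> a; rewrite ltW// lratio_gt0.
Qed.

(** For t < 1 the drift is nonnegative at the critical tilt, and growth_of_ge0_drift
    applies below D; for t = 1 it is nonpositive, and growth_of_le0_drift applies at
    D itself. *)
Lemma critical_growth D s : critical r1 r2 p D -> 0 <= s -> s < D ->
  exists2 s', s < s' & growth r1 r2 p s'.
Proof.
move=> cD s0 sD; have [t [t01 wD slack]] := cD.
have w0 a : 0 < weight r1 r2 p t D a by exact: expR_gt0.
have neg a : ln (lratio r1 r2 a) < 0 by apply: ln_lt0; rewrite lratio_gt0 ?lratio_lt1.
case: slack => [[tK K0]|[t1 K0]].
  exists ((s + D) / 2); first lra.
  apply: (growth_of_ge0_drift r1_gt0 r1_lt_r2 p01 w0 wD K0).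
  have lnw a : ln (weight r1 r2 p t D a) = t * ln (2 * lprob p a) + D * ln (lratio r1 r2 a).
    by rewrite /weight expRK.
  rewrite !lnw /=.
  have n1 := neg true; have n2 := neg false; rewrite /= in n1 n2.
  have w1 := w0 true; have w2 := w0 false.
  move: tK; rewrite /drift; set u := weight _ _ _ _ _ true in w1 *.
  set v := weight _ _ _ _ _ false in w2 *.
  move=> tK.
  have -> : u * (t * ln (2 * p) + D * ln r1) + v * (t * ln (2 * (1 - p)) + D * ln r2) =
     D * (u * ln r1 + v * ln r2) by rewrite -[RHS]add0r -tK; ring.
  have : u * ln r1 + v * ln r2 < 0 by nra.
  by move=> h; rewrite ltr_nM2r//; lra.
exists D => //; move: wD K0; rewrite t1 => wD K0.
apply: (growth_of_le0_drift r1_gt0 r1_lt_r2 r2_lt1 p01 _ _ wD K0) => [|a]; first lra.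
by rewrite weight_powR powRr1// mulr_ge0// ltW// lprob_gt0.
Qed.

End CriticalExponent.

(** * Almost sure dimensions *)

Section Monotone.
Context {R : realType} {d : nat}.
Implicit Types (A : set 'rV[R]_d) (s : R).

Lemma mass_bound_le s s' A : 0 < s -> s <= s' -> mass_bound s' A -> mass_bound s A.
Proof.
move=> s0 ss' [k k0 hk]; exists k => // V cov dV; apply: le_trans (hk V cov dV) _.
apply: lee_nneseries => [i _ _|i _]; first exact: diam_pow_ge0.
by apply: diam_pow_decr => //; lra.
Qed.

Lemma box_bound_le s s' A : s <= s' -> box_bound s A -> box_bound s' A.
Proof.
move=> ss' [C hC]; exists `|C| => e e02; have [n [V [nC dV cov]]] := hC e e02.
have /andP[e0 e2] := e02.
exists n, V; split=> //; apply: le_trans nC _.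
apply: (@le_trans _ _ (`|C| * e `^ (- s))); first by rewrite ler_wpM2r ?powR_ge0 ?ler_norm.
by rewrite ler_wpM2l// ger_powR// ?e0 ?lerN2//; lra.
Qed.


End Monotone.

Section AlmostSure.
Context {R : realType} {d : nat}.
Variables (f1 f2 : 'rV[R]_d -> 'rV[R]_d) (r1 r2 : R).
Hypotheses (r1_gt0 : 0 < r1) (r1_lt_r2 : r1 < r2) (r2_lt1 : r2 < 1).
Hypotheses (sim1 : similarity r1 f1) (sim2 : similarity r2 f2).
Variable U : set 'rV[R]_d.
Hypotheses (U0 : U !=set0) (Uo : open U) (Uf1 : f1 @` U `<=` U) (Uf2 : f2 @` U `<=` U).
Hypothesis Udisj : f1 @` U `&` f2 @` U = set0.

Context {disp : measure_display} {T : measurableType disp}.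
Variables (P : probability T R) (p : R) (omega : edge -> {RV P >-> bool}).
Hypothesis iid : iid_labels p omega.
Hypothesis p01 : 0 < p < 1.

Let p01w : 0 <= p <= 1. Proof. by case/andP: p01 => h1 h2; rewrite !ltW. Qed.

Local Notation F t := (generated_set f1 f2 (fun e => omega e t)).

Lemma ae_box_bound D s : 0 < s -> D < s -> critical r1 r2 p D ->
  {ae P, forall t, box_bound s (F t)}.
Proof.
move=> s0 Ds cD.
have [g g01 hg] := occurring_weight_decay r1_gt0 r1_lt_r2 r2_lt1 p01 cD Ds.
pose f n (c : labelling) : R := \sum_(w <- words n) (occurs c w)%:R * word_ratio r1 r2 w `^ s.
have f0 n c : 0 <= f n c by apply: sumr_ge0 => w _; rewrite mulr_ge0// powR_ge0.
have df n : depends_upto n (f n).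
  move=> c c' e; rewrite /f big_seq [RHS]big_seq; apply: eq_bigr => w.
  by rewrite mem_words => /eqP wn; rewrite (@depends_occurs w c c')// wn.
have fg n : mean p n (f n) <= g ^+ n.
  apply: le_trans (hg n); rewrite le_eqVlt; apply/orP; left; apply/eqP.
  transitivity (\sum_(w <- words n) word_ratio r1 r2 w `^ s * occ_prob p w).
    by rewrite -mean_occurs; apply: eq_mean => c; apply: eq_bigr => w _; rewrite mulrC.
  by apply: eq_bigr => w _; rewrite mulrC.
have := ae_bounded_sums p01w iid g01 f0 df fg; apply: filterS => t [S hS].
exact: (cover_upper_bound r1_gt0 r1_lt_r2 r2_lt1 sim1 sim2 s0 hS).
Qed.

(** Block families with failure probability e_i -> 0 give surviving trees with
    probability 1 - 2 e_i each; on each of these events cover_lower_bound applies. *)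
Lemma ae_mass_bound D s : 0 < s -> s < D -> critical r1 r2 p D ->
  {ae P, forall t, mass_bound s (F t)}.
Proof.
move=> s0 sD cD.
have [s' ss' gs'] := critical_growth r1_gt0 r1_lt_r2 r2_lt1 p01 cD (ltW s0) sD.
pose e i : R := (i + 64)%:R^-1.
have e0 i : 0 < e i by rewrite invr_gt0 ltr0n addn_gt0 orbT.
have e64 i : e i <= 64^-1.
  by rewrite lef_pV2 ?posrE ?ltr0n ?addn_gt0 ?orbT// ler_nat leq_addl.
have /choice[q hq] i : exists q : (nat * seq (seq bool)) * (R * R),
    block_family r1 r2 p s (e i) q.1.1 q.1.2 q.2.1 q.2.2.
  have [L [lang [m [x h]]]] := block_family_exists r1_gt0 r1_lt_r2 r2_lt1 p01 (ltW s0) ss' (e0 i) gs'.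
  by exists ((L, lang), (m, x)).
pose S i h : pred labelling := fun c => survives (q i).1.1 (q i).1.2 (q i).2.1 h c.
have dS i h : depends_upto (h * (q i).1.1) (S i h) by exact: depends_survives.
have SS i h c : S i h.+1 c -> S i h c by exact: survives_pred.
have Sp i h : 1 - 2 * e i <= mean p (h * (q i).1.1) (fun c => (S i h c)%:R).
  have [[ul sl] _ [m16 _] _ hE] := hq i.
  by apply: survival_probability => //; rewrite ltW ?e0 ?e64.
have small (x : R) : 0 < x -> exists i, 2 * e i <= x.
  move=> x0; exists (Num.truncn (2 / x)).+1.
  have h := truncnS_gt (2 / x).
  have h2 : 2 / x <= (((Num.truncn (2 / x)).+1 + 64)%:R : R).
    by apply: le_trans (ltW h) _; rewrite ler_nat leq_addr.
  rewrite /e ler_pdivrMr ?ltr0n// mulrC -ler_pdivrMr//.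
have := ae_eventually_surv iid dS SS Sp small; apply: filterS => t [i hi].
have [[ul sl] xl [m16 x0] mx _] := hq i.
exact: (cover_lower_bound r1_gt0 r1_lt_r2 r2_lt1 sim1 sim2 U0 Uo Uf1 Uf2 Udisj s0 ul sl xl m16 x0 mx hi).
Qed.

(** By monotonicity in s, sequences of exponents that converge to D suffice. *)
Lemma ae_all_bounds D : 0 < D -> critical r1 r2 p D ->
  {ae P, forall t, (forall s, 0 < s < D -> mass_bound s (F t)) /\
    (forall s, D < s -> box_bound s (F t))}.
Proof.
move=> D0 cD.
pose u (n : nat) : R := D * (1 - n.+2%:R^-1); pose v (n : nat) : R := D + n.+1%:R^-1.
have inv0 n : 0 < (n.+1%:R^-1 : R) by rewrite invr_gt0.
have u0 n : 0 < u n by rewrite mulr_gt0// subr_gt0 invf_lt1// ltr1n.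
have uD n : u n < D by rewrite /u mulrBr mulr1 ltrBlDr ltrDl mulr_gt0.
have lower : {ae P, forall t, forall n, mass_bound (u n) (F t)}.
  by apply: ae_foralln => n; exact: ae_mass_bound (u0 n) (uD n) cD.
have upper : {ae P, forall t, forall n, box_bound (v n) (F t)}.
  apply: ae_foralln => n; apply: ae_box_bound cD; last by rewrite /v ltrDl.
  by rewrite /v addr_gt0.
apply: filterS2 lower upper => t lo up; split=> s.
  move=> /andP[s0 sD].
  have [n hn] : exists n, s <= u n.
    have x0 : 0 < (D - s) / D by rewrite divr_gt0// subr_gt0.
    exists (Num.truncn ((D - s) / D)^-1).
    have h := truncnS_gt ((D - s) / D)^-1; set N := _.+1 in h.
    have h2 : N.+1%:R^-1 <= (D - s) / D.
      rewrite -[leRHS]invrK lef_pV2 ?posrE ?invr_gt0//.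
      by apply: le_trans (ltW h) _; rewrite ler_nat.
    rewrite /u -/N mulrBr mulr1 lerBrDr -lerBrDl mulrC.
    by rewrite ler_pdivlMr// in h2.
  exact: mass_bound_le s0 hn (lo n).
move=> Ds; have x0 : 0 < s - D by rewrite subr_gt0.
have h := truncnS_gt (s - D)^-1; set N := _.+1 in h.
apply: box_bound_le (up (Num.truncn (s - D)^-1)); rewrite /v -/N.
by rewrite -lerBrDl -[leRHS]invrK lef_pV2 ?posrE ?invr_gt0// ltW.
Qed.

Lemma ae_dimensions D : 0 < D -> critical r1 r2 p D ->
  {ae P, forall t, hausdorff_dim (F t) = D%:E /\ has_box_dim (F t) D%:E}.
Proof.
move=> D0 cD; have := ae_all_bounds D0 cD; apply: filterS => t [lo up].
by split; [apply: hausdorff_dim_eq => //; exact: ltW|exact: has_box_dimI].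
Qed.

End AlmostSure.

Section Deterministic.
Context {R : realType} {d : nat}.
Variables (f1 f2 : 'rV[R]_d -> 'rV[R]_d) (r1 r2 : R).
Hypotheses (r1_gt0 : 0 < r1) (r1_lt_r2 : r1 < r2) (r2_lt1 : r2 < 1).
Hypotheses (sim1 : similarity r1 f1) (sim2 : similarity r2 f2).
Context {disp : measure_display} {T : measurableType disp}.
Variables (P : probability T R) (p : R) (omega : edge -> {RV P >-> bool}).

(** With constant labels every path leads to the same point. *)
Lemma generated_set_cst (b : bool) (w : edge -> bool) : (forall e, w e = b) ->
  exists x, generated_set f1 f2 w = [set x].
Proof.
move=> wb.
have E xi : path_point f1 f2 w xi = orbit f1 f2 (fun=> b) :> (nat -> 'rV[R]_d).
  by apply/funext => n; rewrite path_pointE; congr (orbit _ _ _ n); apply/funext => k; exact: wb.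
have [x hx] := proj1 (cvg_ex _) (orbit_cvg r1_gt0 r1_lt_r2 r2_lt1 sim1 sim2 (z := fun=> b)).
exists x; apply/seteqP; split => y.
  move=> [xi]; rewrite E => hy; exact: (cvg_unique _ hy hx).
by move=> ->; exists (fun=> true); rewrite E.
Qed.

(** There are countably many edges, so that almost surely all labels coincide. *)
Lemma ae_degenerate : iid_labels p omega -> p = 0 \/ p = 1 ->
  {ae P, forall t, hausdorff_dim (generated_set f1 f2 (fun e => omega e t)) = 0%:E}.
Proof.
move=> [_ law] p01.
have [b hb] : exists b, forall e, {ae P, forall t, omega e t = b}.
  exists (p == 1) => e; have [lt lf] := law e.
  exists (omega e @^-1` [set ~~ (p == 1)]); split; first exact: measurable_funPTI.
    case: p01 => pE; rewrite pE ?eqxx in lt lf *; first by rewrite eq_sym oner_eq0/= lt.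
    by rewrite /= lf subrr.
  by move=> t /=; case: (omega e t); case: (p == 1).
have : {ae P, forall t, forall e, omega e t = b}.
  have : {ae P, forall t, forall n, if unpickle n is Some e then omega e t = b else True}.
    by apply: ae_foralln => n; case: unpickle => [e|]; [exact: hb|exact: aeW].
  by apply: filterS => t h e; have := h (pickle e); rewrite pickleK.
apply: filterS => t ht.
by have [x ->] := generated_set_cst ht; exact: hausdorff_dim_set1.
Qed.

End Deterministic.

Theorem theorem1p2 (R : realType) (r1 r2 : R)
    (r1_gt0 : 0 < r1) (r1_lt_r2 : r1 < r2) (r2_lt1 : r2 < 1) :
  exists (s0 : R) (s_tilde : R -> R) (p_lo p_hi : R),
    unique (fun s => r1 `^ s + r2 `^ s = 1) s0 /\
    (forall p, 0 < p < 1 ->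
      unique (fun s => p * r1 `^ s + (1 - p) * r2 `^ s = 2^-1) (s_tilde p)) /\
    (forall p : R, 0 < p < 1 -> p != 2^-1 -> c2 p = 1 - c1 p) /\
    [/\ 0 < p_lo, p_lo < 2^-1, 2^-1 < p_hi & p_hi < 1] /\
    unique (fun p => 0 < p < 2^-1 /\
              ln (2 * p) / ln (2 * (1 - p)) = - ((r2 / r1) `^ s0)) p_lo /\
    (exists s_hi : R,
      unique (fun ps : R * R => let: (p, s) := ps in
        [/\ 2^-1 < p < 1,
            p * r1 `^ s + (1 - p) * r2 `^ s = 2^-1 &
            p * r1 `^ s * ln p + (1 - p) * r2 `^ s * ln (1 - p) =
              - (2^-1 * ln 2)]) (p_hi, s_hi)) /\
    forall (d : nat) (f1 f2 : 'rV[R]_d -> 'rV[R]_d) (U : set 'rV[R]_d),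
      similarity r1 f1 -> similarity r2 f2 ->
      U !=set0 -> bounded_set U -> open U ->
      f1 @` U `<=` U -> f2 @` U `<=` U -> f1 @` U `&` f2 @` U = set0 ->
      U = interior (closure U) ->
      (* D p is the almost sure value of dim_H F. *)
      exists D : R -> R,
        (forall p, 0 < p < 1 ->
          [/\ p_lo <= p <= 2^-1 -> D p = s0,
              2^-1 <= p <= p_hi -> D p = s_tilde p &
              (p <= p_lo) || (p_hi <= p) -> D p = s_hat r1 r2 p]) /\
        (forall p, 0 <= p <= 1 ->
          forall (disp : measure_display) (T : measurableType disp)
                 (P : probability T R) (omega : edge -> {RV P >-> bool}),
            iid_labels p omega ->
            {ae P, forall t,
              hausdorff_dim (generated_set f1 f2 (fun e => omega e t)) =
                (D p)%:E}) /\
        (forall p, 0 < p < 1 ->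
          forall (disp : measure_display) (T : measurableType disp)
                 (P : probability T R) (omega : edge -> {RV P >-> bool}),
            iid_labels p omega ->
            {ae P, forall t,
              has_box_dim (generated_set f1 f2 (fun e => omega e t))
                (D p)%:E}) /\
        [/\ {in `[0, p_lo] &, forall p q, p < q -> D p < D q},
            {in `[p_lo, 2^-1] &, forall p q, D p = D q} &
            {in `[2^-1, 1] &, forall p q, p < q -> D q < D p}].
Proof.
have [s0 [s_tilde [p_lo [p_hi [D [[us0 ut bounds ulo uhi] [D0 D1 crit formulas [m1 m2 m3]]]]]]]] :=
  critical_exponents r1_gt0 r1_lt_r2 r2_lt1.
exists s0, s_tilde, p_lo, p_hi; split=> //; split=> //; split.
  by move=> p p01 p2; have [_ _ h _] := c12_facts p01 p2; lra.
split=> //; split=> //; split=> //.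
move=> d f1 f2 U sim1 sim2 U0 _ Uo Uf1 Uf2 Udisj _.
exists D; split; first exact: formulas.
have dims p : 0 < p < 1 -> forall (disp : measure_display) (T : measurableType disp)
     (P : probability T R) (omega : edge -> {RV P >-> bool}), iid_labels p omega ->
   {ae P, forall t, hausdorff_dim (generated_set f1 f2 (fun e => omega e t)) = (D p)%:E /\
     has_box_dim (generated_set f1 f2 (fun e => omega e t)) (D p)%:E}.
  move=> p01 disp T P omega iid; have cp := crit p p01.
  exact: (ae_dimensions r1_gt0 r1_lt_r2 r2_lt1 sim1 sim2 U0 Uo Uf1 Uf2 Udisj iid p01
    (critical_gt0 r1_gt0 r1_lt_r2 r2_lt1 p01 cp) cp).
split.
  move=> p p01 disp T P omega iid.
  have [pin|pout] := boolP (0 < p < 1).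
    by have := dims p pin disp T P omega iid; apply: filterS => t [].
  have p_end : p = 0 \/ p = 1.
    move: p01 pout; rewrite !le_eqVlt negb_and -!leNgt => /andP[/orP[/eqP<-|h0] /orP[/eqP->|h1]]; try by [left|right].
    by move=> /orP[|] h; lra.
  have Dp : D p = 0 by case: p_end => ->.
  by rewrite Dp; exact: (ae_degenerate r1_gt0 r1_lt_r2 r2_lt1 sim1 sim2 iid p_end).
split=> // p p01 disp T P omega iid.
by have := dims p p01 disp T P omega iid; apply: filterS => t [].
Qed.
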